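(* Let $\mathcal X,\mathcal Y\subseteq\mathbb R^d$ be two open (connected, possibly unbounded) domains endowed with the Euclidean metric and assume that there are constants $\ell_c,\Lambda_c\in\mathbb R$ such that $$\ell_c\preceq\nabla_2^2c(x,y)\preceq\Lambda_c\quad\text{and}\quad\nabla_1^2c(x,y)\preceq\Lambda_c\qquad\forall x,y\in\mathbb R^d .$$ Assume further that $\nu$ satisfies $\mathrm{TI}(\tau)$ for some $\tau\in(0,\infty)$. (i) Assume that $\sup_{x\in\mathbb R^d}|c(x,y)-c(x,\hat y)|\le\mathrm{Lip}_{\infty,2}(c)|y-\hat y|$ for all $y,\hat y\in\mathbb R^d$, for a finite constant $\mathrm{Lip}_{\infty,2}(c)$. Then for every $\varepsilon>0$ Sinkhorn's algorithm converges exponentially fast, and for $$\varepsilon\le\frac{\tau(\Lambda_c-\ell_c)+\sqrt{\tau^2(\Lambda_c-\ell_c)^2+4\tau\,\mathrm{Lip}_{\infty,2}(c)^2}}{2}$$ it converges with rate $$1-\frac{\varepsilon^2}{\varepsilon^2+\tau\varepsilon(\Lambda_c-\ell_c)+\tau\,\mathrm{Lip}_{\infty,2}^2(c)}.$$ (ii) Assume that $\sup_{y\in\mathbb R^d}|c(x,y)-c(\hat x,y)|\le\mathrm{Lip}_{1,\infty}(c)|x-\hat x|$ for all $x,\hat x\in\mathbb R^d$, for a finite constant $\mathrm{Lip}_{1,\infty}(c)$, and further that $\|\nabla^2_{12}c(x,y)\|_2\le\Lambda_c$ and that $\rho$ satisfies the logarithmic Sobolev inequality $\mathrm{LSI}(C_\rho)$.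 Then for every $\varepsilon>0$ Sinkhorn's algorithm converges exponentially fast, and for $$\varepsilon\le1\wedge\Big(\tau(\Lambda_c-\ell_c)+2\tau\Lambda_c^2C_\rho\big(1+4C_\rho\mathrm{Lip}_{1,\infty}(c)^2\big)\Big)^{1/4}$$ it converges with rate $$1-\frac{\varepsilon^4}{\varepsilon^4+\tau\varepsilon^3(\Lambda_c-\ell_c)+2\tau\Lambda_c^2C_\rho\big(\varepsilon^2+4C_\rho\mathrm{Lip}_{1,\infty}(c)^2\big)}.$$
   Context: $\rho\in\mathcal P(\mathcal X)$, $\nu\in\mathcal P(\mathcal Y)$, $\varepsilon>0$. $\nabla_i,\nabla_i^2$ are gradient and Hessian in the $i$-th variable, $\nabla^2_{12}=\nabla_1\nabla_2$; $\|\cdot\|_2$ is the matrix operator norm; $\preceq$ is semidefinite order (a scalar stands for that multiple of the identity). $\mathscr H(p|q)=\int\log\frac{dp}{dq}dp$ ($+\infty$ if $p\not\ll q$). $\mathrm{TI}(\tau)$ for $\nu$ means $\mathbf W_2^2(\mu,\nu)\le2\tau\mathscr H(\mu|\nu)$ for all $\mu\in\mathcal P(\mathcal Y)$, where $\mathbf W_2$ is the Wasserstein distance of order two. $\mathrm{LSI}(C_\rho)$ for $\rho$ means $\mathscr H(p|\rho)\le\frac{C_\rho}{2}\int|\nabla\log\frac{dp}{d\rho}|^2dp$ for all $p\in\mathcal P(\mathcal X)$. $\pi^\nu_\varepsilon$ is the unique minimizer of $\inf_{\pi\in\Pi(\rho,\nu)}\int c\,d\pi+\varepsilon\mathscr H(\pi|\rho\otimes\nu)$,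 with $\Pi(\rho,\nu)$ the set of couplings; as throughout the paper, it is assumed to exist and to have $\rho\otimes\nu$-density of the form $\exp(-(c(x,y)+\varphi^\nu_\varepsilon(x)+\psi^\nu_\varepsilon(y))/\varepsilon)$. Sinkhorn's algorithm: starting from $\varphi^0_\varepsilon$ (typically $0$), for $n\ge0$, $\psi^n_\varepsilon(y)=\varepsilon\log\int e^{-(c(x,y)+\varphi^n_\varepsilon(x))/\varepsilon}\rho(dx)$ and $\varphi^{n+1}_\varepsilon(x)=\varepsilon\log\int e^{-(c(x,y)+\psi^n_\varepsilon(y))/\varepsilon}\nu(dy)$; $\pi^{n,n}$ has $\rho\otimes\nu$-density $e^{-(c+\varphi^n_\varepsilon(x)+\psi^n_\varepsilon(y))/\varepsilon}$. The initialization is assumed smooth enough that differentiation under the integral sign is justified along the iterates. For given $\varepsilon$: ''Sinkhorn's algorithm converges exponentially fast'' means there is $\kappa'\in(0,1)$ such that for all $n\ge1$, $\mathscr H(\pi^\nu_\varepsilon|\pi^{n+1,n+1})\le(1-\kappa')^n\mathscr H(\pi^\nu_\varepsilon|\pi^{0,0})$; ''with rate $1-\kappa$'' means this holds for all $n\ge1$ with $\kappa'=\kappa$. *)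

(* Defs.v *)
From HB Require Import structures.
From mathcomp Require Import all_boot all_order all_algebra.
From mathcomp Require Import all_classical all_reals all_analysis.

Set Implicit Arguments.
Unset Strict Implicit.
Unset Printing Implicit Defensive.

Import Order.TTheory GRing.Theory Num.Theory.
Import numFieldNormedType.Exports.

Local Open Scope classical_set_scope.
Local Open Scope ring_scope.

(* R^d is 'rV[R]_d with its Borel sigma-algebra. Its product sigma-algebra on
   R^d x R^d is again the Borel one. *)
HB.instance Definition _ (R : realType) (m n : nat) :=
  let G : set (set 'M[R]_(m, n)) := open in
  @isMeasurable.Build (sigma_display G) 'M[R]_(m, n) <<s G >>
    (@sigma_algebra0 _ setT G) (@sigma_algebraC 'M[R]_(m, n) G)
    (@sigma_algebra_bigcup _ setT G).

(* The library norm on 'rV[R]_d is the sup norm (same topology, same notion of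
   differentiability); metric quantities use the Euclidean norm below. *)
Section calculus.
Context {R : realType} {d : nat}.
Local Notation V := 'rV[R]_d.

Definition enorm (v : V) : R := Num.sqrt (\sum_i v 0 i ^+ 2).

Definition basis (i : 'I_d) : V := delta_mx 0 i.

Definition grad (f : V -> R) (x : V) : V := \row_i 'D_(basis i) f x.

Definition hess (f : V -> R) (x : V) : 'M[R]_d :=
  \matrix_(i, j) 'D_(basis i) ('D_(basis j) f) x.

Definition hess1 (c : V -> V -> R) (x y : V) : 'M[R]_d := hess (c^~ y) x.

Definition hess2 (c : V -> V -> R) (x y : V) : 'M[R]_d := hess (c x) y.

Definition hess12 (c : V -> V -> R) (x y : V) : 'M[R]_d :=
  \matrix_(i, j) 'D_(basis i) (fun x' => 'D_(basis j) (c x') y) x.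

(* Twice Frechet differentiable on R^d x R^d, jointly in both variables. *)
Definition twice_differentiable (c : V -> V -> R) : Prop :=
  let f := fun z : V * V => c z.1 z.2 in
  (forall z, differentiable f z) /\
  (forall w z, differentiable ('D_w f) z).

Definition psd_le (A B : 'M[R]_d) : Prop :=
  forall v : V, (v *m A *m v^T) 0 0 <= (v *m B *m v^T) 0 0.

Definition opnorm2 (A : 'M[R]_d) : R :=
  sup [set enorm (v *m A) | v in [set v : V | enorm v <= 1]].

End calculus.

Section entropy.
Context {disp : measure_display} {T : measurableType disp} {R : realType}.
Local Open Scope ereal_scope.

(* The negative part of log(dp/dq) is always p-integrable, so the integral is
   a genuine one. *)
Definition KL (p q : probability T R) : \bar R :=
  if `[< p `<< q >] then
    \int[p]_x lne (Radon_Nikodym (charge_of_finite_measure p) q x)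
  else +oo.

Definition has_density (p q : set T -> \bar R) (f : T -> R) : Prop :=
  measurable_fun setT f /\
  forall A, measurable A -> p A = \int[q]_(x in A) (f x)%:E.

End entropy.

Section transport.
Context {R : realType} {d : nat}.
Local Notation V := 'rV[R]_d.
Local Open Scope ereal_scope.

Definition coupling (mu nu : probability V R) (pi : probability (V * V)%type R)
  : Prop :=
  (forall A, measurable A -> pi (A `*` setT) = mu A) /\
  (forall B, measurable B -> pi (setT `*` B) = nu B).

Definition W2 (mu nu : probability V R) : \bar R :=
  sqrte (ereal_inf [set \int[pi]_z (enorm (z.1 - z.2)%R ^+ 2)%:E |
                    pi in coupling mu nu]).

(* P(Y) is represented by the Borel probabilities mu on R^d with mu Y = 1. *)
Definition TI (Y : set V) (nu : probability V R) (tau : R) : Prop :=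
  forall mu : probability V R, mu Y = 1 ->
    W2 mu nu ^+ 2 <= (2 * tau)%:E * KL mu nu.

(* The Fisher information of p is read as +oo when dp/drho has no version that
   is differentiable on X. The zeros of h form a p-null set, so the values of
   grad (ln \o h) there do not matter. *)
Definition LSI (X : set V) (rho : probability V R) (C : R) : Prop :=
  forall (p : probability V R) (h : V -> R),
    p X = 1 ->
    has_density p rho h ->
    (forall x, X x -> (0 <= h x)%R /\ differentiable h x) ->
    KL p rho <=
      (C / 2)%:E * \int[p]_(x in X) (enorm (grad (@ln R \o h) x) ^+ 2)%:E.

(* (_ + _)%dE is the addition for which +oo + -oo = +oo: plans of infinite
   entropy are never optimal. *)
Definition eot_cost (rho nu : probability V R) (c : V -> V -> R) (eps : R)
    (pi : probability (V * V)%type R) : \bar R :=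
  (\int[pi]_z (c z.1 z.2)%:E + eps%:E * KL pi (rho \x nu))%dE.

Definition eot_minimizer rho nu c eps (pi : probability (V * V)%type R) : Prop :=
  coupling rho nu pi /\
  forall pi', coupling rho nu pi' ->
    eot_cost rho nu c eps pi <= eot_cost rho nu c eps pi'.

(* exp(-(c(x,y) + phi(x) + psi(y)) / eps) *)
Definition gibbs (c : V -> V -> R) (eps : R) (phi psi : V -> R) (z : V * V) : R :=
  expR (- (c z.1 z.2 + phi z.1 + psi z.2) / eps)%R.

(* Measures are compared on measurable sets only, the library leaves their
   values on other sets unconstrained. *)
Definition eot_plan rho nu c eps (pi : probability (V * V)%type R) : Prop :=
  [/\ eot_minimizer rho nu c eps pi,
      (forall pi', eot_minimizer rho nu c eps pi' ->
         forall A, measurable A -> pi' A = pi A) &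
      exists phi psi : V -> R,
        [/\ measurable_fun setT phi, measurable_fun setT psi &
            has_density pi (rho \x nu) (gibbs c eps phi psi)] ].

End transport.

Section sinkhorn.
Context {R : realType} {d : nat}.
Local Notation V := 'rV[R]_d.
Variables (rho nu : probability V R) (c : V -> V -> R) (eps : R).

Definition psi_kernel (phi : V -> R) (y x : V) : R :=
  expR (- (c x y + phi x) / eps).

Definition phi_kernel (psi : V -> R) (x y : V) : R :=
  expR (- (c x y + psi y) / eps).

Definition psi_step (phi : V -> R) (y : V) : R :=
  eps * ln (\int[rho]_x psi_kernel phi y x).

Definition phi_step (psi : V -> R) (x : V) : R :=
  eps * ln (\int[nu]_y phi_kernel psi x y).

Definition sinkhorn_phi (phi0 : V -> R) (n : nat) : V -> R :=
  iter n (phi_step \o psi_step) phi0.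

Definition sinkhorn_psi (phi0 : V -> R) (n : nat) : V -> R :=
  psi_step (sinkhorn_phi phi0 n).

(* a |-> \int F a b mu(db) is finite, and its derivatives up to order two exist
   and are obtained by differentiating F under the integral sign. *)
Definition diff_under_integral (mu : probability V R) (F : V -> V -> R) : Prop :=
  let Z := fun a => \int[mu]_b F a b in
  forall a,
  [/\ mu.-integrable setT (fun b => (F a b)%:E),
      differentiable Z a,
      (forall u, differentiable ('D_u Z) a),
      (forall u,
         mu.-integrable setT (fun b => ('D_u (F^~ b) a)%:E) /\
         'D_u Z a = \int[mu]_b 'D_u (F^~ b) a) &
      (forall u v,
         mu.-integrable setT (fun b => ('D_v ('D_u (F^~ b)) a)%:E) /\
         'D_v ('D_u Z) a = \int[mu]_b 'D_v ('D_u (F^~ b)) a) ].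

Definition admissible_init (phi0 : V -> R) : Prop :=
  measurable_fun setT phi0 /\
  forall n,
    diff_under_integral rho (psi_kernel (sinkhorn_phi phi0 n)) /\
    diff_under_integral nu (phi_kernel (sinkhorn_psi phi0 n)).

(* piN n is pi^{n,n}. Its density has total mass 1 because psi^n normalises it,
   so it can be required to be a probability from the outset. *)
Definition sinkhorn_plans (phi0 : V -> R)
    (piN : nat -> probability (V * V)%type R) : Prop :=
  forall n, has_density (piN n) (rho \x nu)%E
    (gibbs c eps (sinkhorn_phi phi0 n) (sinkhorn_psi phi0 n)).

End sinkhorn.

Section convergence.
Context {R : realType} {d : nat}.
Local Notation V := 'rV[R]_d.

Definition sinkhorn_rate (pi : probability (V * V)%type R)
    (piN : nat -> probability (V * V)%type R) (kappa : R) : Prop :=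
  forall n, (1 <= n)%N ->
    (KL pi (piN n.+1) <= ((1 - kappa) ^+ n)%:E * KL pi (piN 0%N))%E.

Definition converges_exponentially (pi : probability (V * V)%type R)
    (piN : nat -> probability (V * V)%type R) : Prop :=
  exists kappa : R, 0 < kappa < 1 /\ sinkhorn_rate pi piN kappa.

End convergence.

(* Main.v *)
From HB Require Import structures.
Require Import Defs.
From mathcomp Require Import all_boot all_order all_algebra.
From mathcomp Require Import all_classical all_reals all_analysis.
From mathcomp Require Import measurable_realfun.
From mathcomp Require Import ring lra.

Set Implicit Arguments.
Unset Strict Implicit.
Unset Printing Implicit Defensive.

Import Order.TTheory GRing.Theory Num.Theory.
Import numFieldNormedType.Exports.

Local Open Scope classical_set_scope.
Local Open Scope ring_scope.

(** Let H(n) be the entropy of the optimal plan relative to the n-th Sinkhorn plan.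
   The rate comes from a contraction H(n+1) <= (1 - kappa) H(n), valid for n >= 1,
   together with H(1) <= H(0). Here kappa = eps / (eps + tau M), where M is a
   constant such that every function y |-> c(x,y) + psi(y), with psi a Sinkhorn
   potential, lies below its tangent at any y plus M/2 times the squared distance.

   For the contraction, write f = (phi_n - phi_(n+1)) / eps and
   g = (psi_(n+1) - psi_n) / eps. The half step, with potentials phi_(n+1) and
   psi_n, has first marginal rho and second marginal mu = e^g nu, and
   - H(n) - H(n+1) >= int f drho >= KL(mu | nu), by convexity of the exponential
     and by data processing (KL_curr_ge, KL_second_marginal);
   - H(n+1) <= M / (2 eps) int |y - z|^2 dgam(y,z) for every coupling gam of mu and
     nu (KL_next_le_transport). Indeed H(n+1) = int a drho + int b dnu, where a and
     b are the differences of the potentials divided by eps; the variational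
     formula of the entropy, applied to the laws of x given y and of x given z
     under the new plan, bounds this by the mean entropy between those laws. The
     logarithm of their density ratio is controlled by semiconcavity, its linear
     term having mean zero;
   - TI(tau) bounds the least transport cost by 2 tau KL(mu | nu).
   Hence H(n+1) <= (tau M / eps) (H(n) - H(n+1)) (step_contraction), which is the
   contraction.

   The constant M is found by differentiating psi = eps log int e^(-(c + phi)/eps)
   twice: its Hessian is minus the conditional mean of the Hessian of c plus 1/eps
   times the conditional covariance of the gradient of c (psi_step_semiconcave), so
   M = Lam - ell + V / eps where V bounds this covariance. If c is L-Lipschitz in y
   then V = L^2. If c is L-Lipschitz in x, the law of x given y has a log-density
   relative to rho of slope at most 2 L / eps, and the logarithmic Sobolev
   inequality bounds the variance of Lam-Lipschitz functions under such a law
   (lsi_variance): its Herbst argument makes the square of a centred Lipschitz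
   function exponentially integrable under rho, and entropy duality carries this
   bound to the perturbed law.

   The entropies H(n) are sums of integrals of potentials only if the latter are
   integrable up to the optimal ones. The potentials in the Lipschitz variable are
   Lipschitz, hence integrable because TI or LSI yields exponential moments; those
   in the other variable all equal minus c(.,0) or minus c(0,.) up to a bounded
   term (potential_gaps_integrable). *)

(** * Densities and relative entropy *)

Section density.
Context {disp : measure_display} {T : measurableType disp} {R : realType}.
Implicit Types p q m : probability T R.
Local Open Scope ereal_scope.

Lemma has_density_dominates p q (h : T -> R) : has_density p q h -> p `<< q.
Proof.
move=> [mh ph]; apply/null_content_dominatesP => A mA qA0; rewrite ph//.
apply: null_set_integral => //. exact/measurable_EFinP/measurable_funTS.
Qed.

Lemma has_density_RN p q (h : T -> R) : (forall x, 0 <= h x)%R ->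
  has_density p q h ->
  ae_eq q setT (Radon_Nikodym (charge_of_finite_measure p) q)
    (fun x => (h x)%:E).
Proof.
move=> h0 ph; have pq := has_density_dominates ph; case: ph => mh ph.
apply: integral_ae_eq => //.
- exact: Radon_Nikodym_integrable.
- exact/measurable_EFinP.
- by move=> E _ mE; rewrite -Radon_Nikodym_integral//; exact: ph.
Qed.

Lemma ge0_integral_density p q (h : T -> R) (g : T -> \bar R) :
  (forall x, 0 <= h x)%R -> has_density p q h ->
  measurable_fun setT g -> (forall x, 0 <= g x) ->
  \int[p]_x g x = \int[q]_x (g x * (h x)%:E).
Proof.
move=> h0 ph mg g0; have pq := has_density_dominates ph.
rewrite -(Radon_Nikodym_SigmaFinite.change_of_variables pq)//.
have [mh _] := ph.
apply: ge0_ae_eq_integral => //.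
- apply: emeasurable_funM => //.
  exact: measurable_int (Radon_Nikodym_SigmaFinite.f_integrable pq).
- by apply: emeasurable_funM => //; exact/measurable_EFinP.
- move=> x _; apply: mule_ge0 => //.
  exact: Radon_Nikodym_SigmaFinite.f_ge0.
- by move=> x _; rewrite mule_ge0// lee_fin.
apply: ae_eqe_mul2l.
apply: ae_eq_trans (has_density_RN h0 ph).
exact: ae_eq_Radon_Nikodym_SigmaFinite.
Qed.

Lemma integral_density p q (h : T -> R) (g : T -> R) :
  (forall x, 0 <= h x)%R -> has_density p q h -> measurable_fun setT g ->
  \int[p]_x (g x)%:E = \int[q]_x (g x * h x)%:E.
Proof.
move=> h0 ph mg.
have mgE : measurable_fun setT (EFin \o g) by exact/measurable_EFinP.
rewrite [LHS]integralE [RHS]integralE.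
rewrite (ge0_integral_density h0 ph)//; last exact: measurable_funepos.
rewrite (ge0_integral_density h0 ph)//; last exact: measurable_funeneg.
congr (_ - _); apply: eq_integral => x _.
  rewrite !funeposE /= -EFin_max -EFinM -EFin_max; congr EFin.
  by rewrite maxr_pMl// mul0r.
rewrite !funenegE /= -!EFin_max -EFinM; congr EFin.
by rewrite maxr_pMl// mul0r mulNr.
Qed.

Lemma integrable_density p q (h : T -> R) (g : T -> R) :
  (forall x, 0 <= h x)%R -> has_density p q h -> measurable_fun setT g ->
  p.-integrable setT (EFin \o g) <->
  q.-integrable setT (fun x => (g x * h x)%:E).
Proof.
move=> h0 ph mg; have [mh _] := ph.
have mgh : measurable_fun setT (fun x => (g x * h x)%:E).
  by apply/measurable_EFinP; exact: measurable_funM.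
have E : \int[p]_x `|(g x)%:E| = \int[q]_x `|(g x * h x)%:E|.
  rewrite (ge0_integral_density h0 ph)//.
    by apply: eq_integral => x _ /=; rewrite -EFinM normrM (ger0_norm (h0 x)).
  by apply: measurableT_comp => //; exact/measurable_EFinP.
split=> /integrableP[_ +]; rewrite /= => H; apply/integrableP; split => //=.
- by rewrite -E.
- exact/measurable_EFinP.
- by rewrite E.
Qed.

Lemma has_density_div p q m (F G : T -> R) :
  measurable_fun setT F -> measurable_fun setT G ->
  has_density p m (expR \o F) -> has_density q m (expR \o G) ->
  has_density p q (fun x => expR (F x - G x)).
Proof.
move=> mF mG [mp pE] [mq qE]; split.
  by apply: measurableT_comp => //; exact: measurable_funB.
move=> A mA; rewrite pE//.
rewrite [RHS]integral_mkcond (@ge0_integral_density q m (expR \o G))//.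
- rewrite [LHS]integral_mkcond; apply: eq_integral => x _.
  rewrite !patchE; case: ifPn => // _; last by rewrite mul0e.
  by rewrite /= -EFinM -expRD subrK.
- by move=> x; exact: expR_ge0.
- apply/(measurable_restrictT _ mA).
  apply/measurable_EFinP/measurable_funTS; apply: measurableT_comp => //.
  exact: measurable_funB.
- by move=> x; rewrite patchE; case: ifPn => // _; rewrite lee_fin expR_ge0.
Qed.

Lemma KL_density p q (w : T -> R) : measurable_fun setT w ->
  has_density p q (expR \o w) -> KL p q = \int[p]_x (w x)%:E.
Proof.
move=> mw ph; have pq := has_density_dominates ph.
rewrite /KL asboolT//.
have ew0 x : (0 <= (expR \o w) x)%R by exact: expR_ge0.
have H : ae_eq p setT (fun x => lne (Radon_Nikodym (charge_of_finite_measure p) q x))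
    (fun x => (w x)%:E).
  apply: (null_dominates_ae_eq measurableT pq).
  have := has_density_RN ew0 ph.
  move=> [N [mN N0 subN]]; exists N; split => //.
  apply: subset_trans subN; apply: subsetC => x /= /(_ I) E _.
  by rewrite E lne_EFin ?expR_gt0// expRK.
apply: ae_eq_integral => //; last exact/measurable_EFinP.
set g := Radon_Nikodym _ _.
have mg : measurable_fun setT g by apply: measurable_int; exact: Radon_Nikodym_integrable.
rewrite (_ : (fun x => _) = (fun x => if g x <= 0 then -oo else (ln (fine (g x)))%:E)).
  apply: measurable_fun_ifT => //.
  - apply: (measurable_fun_bool true).
    by have := emeasurable_fun_infty_c measurableT mg 0.
  - by apply/measurable_EFinP/measurableT_comp => //; exact: measurableT_comp.
apply/funext => x; have : g x \is a fin_num by exact: Radon_Nikodym_fin_num.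
by case: (g x).
Qed.

Lemma exists_density m (h : T -> R) : measurable_fun setT h ->
  (forall x, 0 <= h x)%R -> \int[m]_x (h x)%:E = 1 ->
  exists p, has_density p m h.
Proof.
move=> mh h0 h1.
pose P A := \int[m]_(x in A) (h x)%:E.
have P0 : P set0 = 0 by rewrite /P integral_set0.
have Pge0 A : 0 <= P A by apply: integral_ge0 => x _; rewrite lee_fin.
have Psigma : semi_sigma_additive P.
  move=> F mF tF mUF; rewrite /P ge0_integral_bigcup//.
  - apply: is_cvg_nneseries => n _ _; exact: Pge0.
  - exact/measurable_EFinP/measurable_funTS.
  - by move=> x _; rewrite lee_fin.
pose M := isMeasure.Build _ _ _ P P0 Pge0 Psigma.
pose PM : {measure set T -> \bar R} := HB.pack P M.
have PMT : PM setT = 1 by [].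
pose MP := Measure_isProbability.Build _ _ _ PM PMT.
pose PP : probability T R := HB.pack P PM MP.
by exists PP; split.
Qed.

End density.

(** * Calculus on Euclidean space *)

Section euclid.
Context {R : realType} {d : nat}.
Local Notation V := 'rV[R]_d.

Definition dot (u v : V) : R := \sum_i u 0 i * v 0 i.

Lemma enorm_ge0 (v : V) : 0 <= enorm v.
Proof. exact: sqrtr_ge0. Qed.

Lemma sqr_enorm (v : V) : enorm v ^+ 2 = dot v v.
Proof.
rewrite /enorm sqr_sqrtr; last by apply: sumr_ge0 => i _; exact: sqr_ge0.
by apply: eq_bigr => i _; rewrite expr2.
Qed.

Lemma enormZ (a : R) (v : V) : enorm (a *: v) = `|a| * enorm v.
Proof.
rewrite /enorm -sqrtr_sqr -sqrtrM ?sqr_ge0// mulr_sumr; congr Num.sqrt.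
by apply: eq_bigr => i _; rewrite mxE exprMn.
Qed.

Lemma enormN (v : V) : enorm (- v) = enorm v.
Proof. by rewrite -scaleN1r enormZ normrN1 mul1r. Qed.

Lemma cauchy_schwarz (u v : V) : dot u v <= enorm u * enorm v.
Proof.
have dot_ge0 (w : V) : 0 <= dot w w by rewrite -sqr_enorm sqr_ge0.
have dotE (a b : R) : dot (a *: u - b *: v) (a *: u - b *: v) =
    a ^+ 2 * dot u u - 2 * a * b * dot u v + b ^+ 2 * dot v v.
  rewrite /dot !mulr_sumr -sumrB -big_split /=; apply: eq_bigr => i _.
  by rewrite !mxE; ring.
have := dot_ge0 (enorm v *: u - enorm u *: v); rewrite dotE -!sqr_enorm.
have [u0|u0] := eqVneq (enorm u) 0.
  move=> _; have : dot u u = 0 by rewrite -sqr_enorm u0 expr0n.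
  move/eqP; rewrite psumr_eq0 => [/allP h|i _]; last by rewrite -expr2 sqr_ge0.
  rewrite /dot big1 ?u0 ?mul0r// => i _.
  have := h i (mem_index_enum i); rewrite /= -expr2 sqrf_eq0 => /eqP ->.
  by rewrite mul0r.
have [v0|v0] := eqVneq (enorm v) 0.
  move=> _; have : dot v v = 0 by rewrite -sqr_enorm v0 expr0n.
  move/eqP; rewrite psumr_eq0 => [/allP h|i _]; last by rewrite -expr2 sqr_ge0.
  rewrite /dot big1 ?v0 ?mulr0// => i _.
  have := h i (mem_index_enum i); rewrite /= -expr2 sqrf_eq0 => /eqP ->.
  by rewrite mulr0.
move=> H; have uv0 : 0 < enorm u * enorm v.
  by rewrite mulr_gt0// lt0r ?u0 ?v0 enorm_ge0.
rewrite -(ler_pM2l uv0); lra.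
Qed.

Lemma le_enorm_sum (v : V) : enorm v <= \sum_i `|v 0 i|.
Proof.
rewrite /enorm -[leRHS]ger0_norm ?sumr_ge0// -sqrtr_sqr.
rewrite ler_wsqrtr//.
have H (r : seq 'I_d) : \sum_(i <- r) v 0 i ^+ 2 <= (\sum_(i <- r) `|v 0 i|) ^+ 2.
  elim: r => [|i r IH]; first by rewrite !big_nil expr0n.
  rewrite !big_cons sqrrD -normrX ger0_norm ?sqr_ge0//.
  have h : 0 <= (`|v 0 i| * \sum_(j <- r) `|v 0 j|) *+ 2.
    by rewrite mulrn_wge0// mulr_ge0// sumr_ge0.
  lra.
exact: H.
Qed.

Lemma coord_le_enorm (v : V) i : `|v 0 i| <= enorm v.
Proof.
rewrite -sqrtr_sqr /enorm ler_wsqrtr// (bigD1 i)//= lerDl.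
by apply: sumr_ge0 => j _; exact: sqr_ge0.
Qed.

Lemma derive_dot (f : V -> R) x u : differentiable f x ->
  'D_u f x = dot (grad f x) u.
Proof.
move=> df; rewrite deriveE// [in LHS](row_sum_delta u) linear_sum.
apply: eq_bigr => i _; rewrite linearZ /= mxE /basis deriveE//.
by rewrite mulrC.
Qed.

Lemma enorm_grad_le (f : V -> R) x K : differentiable f x -> 0 <= K ->
  (forall u, 'D_u f x <= K * enorm u) -> enorm (grad f x) <= K.
Proof.
move=> df K0 h; have := h (grad f x); rewrite derive_dot// -sqr_enorm expr2.
have [->//|n0] := eqVneq (enorm (grad f x)) 0.
by rewrite ler_pM2r// lt0r n0 enorm_ge0.
Qed.

Lemma derive_le_lipschitz (f : V -> R) L x u : derivable f x u ->
  (forall y y', `|f y - f y'| <= L * enorm (y - y')) ->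
  `|'D_u f x| <= L * enorm u.
Proof.
move=> df lf.
have H : `|h^-1 *: ((f \o shift x) (h *: u) - f x)| @[h --> (0 : R)^'] --> `|'D_u f x|.
  exact: cvg_norm.
rewrite -(cvg_lim _ H)//; apply: limr_le; first by apply/cvg_ex; eexists; exact: H.
near=> h; have h0 : h != 0 by near: h; exact: nbhs_dnbhs_neq.
rewrite normrZ normfV mulrC ler_pdivrMr ?normr_gt0//.
by rewrite (le_trans (lf _ _))//= addrK enormZ mulrCA mulrC.
Unshelve. all: by end_near. Qed.

Lemma is_derive_line (f : V -> R) y v (t : R) : derivable f (y + t *: v) v ->
  is_derive t 1 (fun s : R => f (y + s *: v)) ('D_v f (y + t *: v)).
Proof.
move=> df; have E : (fun h : R => h^-1 *: (((fun s : R => f (y + s *: v)) \o shift t) (h *: 1)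
     - f (y + t *: v))) =
   (fun h : R => h^-1 *: ((f \o shift (y + t *: v)) (h *: v) - f (y + t *: v))).
  apply/funext => h /=; congr (_ *: (f _ - _)).
  by rewrite /GRing.scale /= mulr1 -/(GRing.scale _ _) scalerDl addrCA.
by split; rewrite /derivable /derive E.
Qed.

End euclid.

Section real_functions.
Context {R : realType}.

Lemma is_derive_continuous (g g' : R -> R) :
  (forall t, is_derive t (1 : R) g (g' t)) -> continuous g.
Proof.
move=> dg t; apply: differentiable_continuous.
apply/derivable1_diffP; exact: (@ex_derive _ _ _ _ _ _ _ (dg t)).
Qed.

Lemma mvt (g g' : R -> R) a b : a < b ->
  (forall t, is_derive t (1 : R) g (g' t)) ->
  exists2 c, a < c < b & g b - g a = g' c * (b - a).
Proof.
move=> ab dg.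
have [|c cab ->] := MVT ab (fun x _ => dg x).
  exact/continuous_subspaceT/(is_derive_continuous dg).
by exists c.
Qed.

(** Second-order Taylor bound from an upper bound on the second derivative. *)
Lemma taylor2_le (g g' g'' : R -> R) M :
  (forall t, is_derive t (1 : R) g (g' t)) ->
  (forall t, is_derive t (1 : R) g' (g'' t)) ->
  (forall t, g'' t <= M) ->
  g 1 <= g 0 + g' 0 + M / 2.
Proof.
move=> dg dg' g''M.
have g'le t : 0 <= t -> g' t <= g' 0 + M * t.
  rewrite le_eqVlt => /orP[/eqP <-|t0]; first by rewrite mulr0 addr0.
  have [c _ E] := mvt t0 dg'.
  by rewrite -lerBlDl E subr0 ler_wpM2r// ltW.
pose h (t : R) := g t - g' 0 * t - M / 2 * t ^+ 2.
have dh t : is_derive t (1 : R) h (g' t - g' 0 - M * t).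
  have dgt := dg t; rewrite /h; apply: is_derive_eq.
  by rewrite /GRing.scale /=; field.
have [|c /andP[c0 _] E] := mvt _ dh (a := 0) (b := 1); first exact: ltr01.
have : h 1 - h 0 <= 0.
  rewrite E subr0 mulr1; have := g'le c (ltW c0); lra.
rewrite /h; lra.
Qed.

End real_functions.

(** * Borel measurability on Euclidean space *)

Section borel.
Context {R : realType} {d : nat}.
Local Notation V := 'rV[R]_d.

Lemma open_measurable_rV (A : set V) : open A -> measurable A.
Proof. by move=> oA; exact: sub_sigma_algebra. Qed.

Lemma continuous_measurable_rV (f : V -> R) :
  continuous f -> measurable_fun setT f.
Proof.
move=> /continuousP cf; apply: (measurability _ (RGenOpens.measurableE R)).
move=> _ [_ [a [b ->] <-]]; rewrite setTI; apply: open_measurable_rV.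
exact/cf/interval_open.
Qed.

Lemma differentiable_measurable_rV (f : V -> R) :
  (forall x, differentiable f x) -> measurable_fun setT f.
Proof.
move=> df; apply: continuous_measurable_rV => x.
exact: differentiable_continuous.
Qed.

Lemma measurable_coord i : measurable_fun setT (fun v : V => v 0 i).
Proof. by apply: continuous_measurable_rV; exact: coord_continuous. Qed.

Lemma measurable_enorm : measurable_fun setT (@enorm R d).
Proof.
have -> : @enorm R d = fun v : V => (\sum_i v 0 i ^+ 2) `^ 2^-1.
  apply/funext => v; rewrite powR12_sqrt//.
  by apply: sumr_ge0 => i _; exact: sqr_ge0.
apply: (measurableT_comp (measurable_powR _)).
apply: measurable_sum => i; apply: measurable_funX; exact: measurable_coord.
Qed.

Lemma measurable_sqr_enorm_sub :
  measurable_fun setT (fun z : V * V => enorm (z.1 - z.2) ^+ 2).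
Proof.
under eq_fun do rewrite sqr_enorm.
apply: measurable_sum => i; apply: measurable_funM;
  under eq_fun do rewrite !mxE;
  apply: measurable_funB; exact: (measurableT_comp (measurable_coord i)).
Qed.

(** A Caratheodory function: it is the pointwise limit of the functions got by
   rounding the first argument to finer and finer grids, each of which is
   measurable because a grid is countable. *)
Lemma measurable_caratheodory (c : V -> V -> R) :
  (forall x, measurable_fun setT (c x)) ->
  (forall y, continuous (c^~ y)) ->
  measurable_fun setT (fun z : V * V => c z.1 z.2).
Proof.
move=> mc cc.
(* grid points, and the index of the cell that contains x *)
pose q (n : nat) (k : 'rV[int]_d) : V := \row_i ((k 0 i)%:~R / n.+1%:R).
pose fl (n : nat) (x : V) : 'rV[int]_d := \row_i Num.floor (x 0 i * n.+1%:R).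
apply: (@measurable_fun_cvg _ _ _ setT
  (fun n (z : V * V) => c (q n (fl n z.1)) z.2)) => [n|[x y] _ /=].
- move=> _ B mB; rewrite setTI.
  rewrite [X in measurable X](_ : _ = \bigcup_(k : 'rV[int]_d)
     ((fl n @^-1` [set k]) `*` (c (q n k) @^-1` B))); last first.
    apply/seteqP; split => [[x y] /= Bc|[x y] /= [k _ [/= <- //]]].
    by exists (fl n x).
  apply: countable_bigcupT_measurable; first exact: countableP.
  move=> k; apply: measurableX; last by rewrite -[X in measurable X]setTI; exact: mc.
  rewrite (_ : _ @^-1` _ = \bigcap_(i in [set: 'I_d])
    ((fun v : V => v 0 i * n.+1%:R) @^-1` `[(k 0 i)%:~R, (k 0 i + 1)%:~R[)).
    apply: fin_bigcap_measurable => // i _.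
    rewrite -[X in measurable X]setTI; apply: measurable_funM => //.
    exact: measurable_coord.
  apply/seteqP; split => [v /= <- i _ /=|v /= h].
    by rewrite in_itv /= !mxE floor_itv.
  apply/rowP => i; rewrite !mxE; apply/eqP; rewrite floor_eq.
  by have := h i I; rewrite /= in_itv.
- suff H : q n (fl n x) @[n --> \oo] --> x by exact: cvg_comp H (cc y x).
  apply/cvg_ballP => e e0.
  near=> n; split => // i j; rewrite (ord1 i) /q /fl !mxE /ball /=.
  have n0 : (0 : R) < n.+1%:R by rewrite ltr0n.
  have /andP[h1 h2] := floor_itv (x 0 j * n.+1%:R).
  rewrite intrD in h2.
  have ne : n.+1%:R^-1 < e by near: n; exact: (near_infty_natSinv_lt (PosNum e0)).
  rewrite -(@ger0_norm _ (_ - _)); last by rewrite subr_ge0 ler_pdivrMr.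
  rewrite normr_id ger0_norm; last by rewrite subr_ge0 ler_pdivrMr.
  apply: lt_trans ne; rewrite ltrBlDr -[X in X + _]mul1r -mulrDl.
  by rewrite ltr_pdivlMr// addrC.
Unshelve. all: by end_near. Qed.

End borel.

(** * Scalar inequalities *)

Section real_analysis.
Context {R : realType}.

Lemma ler_small_error (a b K e0 : R) : 0 < e0 ->
  (forall e, 0 < e < e0 -> a <= b + K * e) -> a <= b.
Proof.
move=> e00 h; apply/ler_addgt0Pr => e e_gt0.
have K1 : 0 < `|K| + 1 by rewrite ltr_wpDl.
pose t := Num.min (e0 / 2) (e / (`|K| + 1)).
have t0 : 0 < t by rewrite lt_min !divr_gt0.
have te : t < e0.
  rewrite /t gt_min; apply/orP; left; lra.
have := h t; rewrite t0 te => /(_ isT) /le_trans; apply; rewrite lerD2l.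
have tK : t <= e / (`|K| + 1) by rewrite ge_min lexx orbT.
have Kt : K * t <= (`|K| + 1) * t.
  by rewrite ler_pM2r//; have := ler_norm K; lra.
rewrite (le_trans Kt)// mulrC -ler_pdivlMr//.
Qed.

Lemma expR_le_quad (t : R) : t <= 2^-1 -> expR t <= 1 + t + 2 * t ^+ 2.
Proof.
move=> t2; have t1 : 0 < 1 - t by lra.
have : expR t <= (1 - t)^-1.
  rewrite -[t]opprK expRN lef_pV2 ?posrE ?expR_gt0//; last by lra.
  by have := expR_ge1Dx (- t); rewrite opprK.
move/le_trans; apply; rewrite -[leLHS]mul1r ler_pdivrMr// mulrC.
have -> : (1 - t) * (1 + t + 2 * t ^+ 2) = 1 + t ^+ 2 * (1 - 2 * t) by ring.
by rewrite lerDl mulr_ge0// ?sqr_ge0//; lra.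
Qed.

(** The differential inequality says that u(s)/s - B u(s) - A s has nonpositive
   derivative; as s tends to 0 this function tends to at most e. *)
Lemma log_mgf_ode (u u' : R -> R) (T A B e K e0 : R) :
  0 < T -> 0 <= B -> B * T <= 1 -> 0 <= K -> 0 < e0 ->
  (forall s : R, is_derive s (1 : R) u (u' s)) ->
  (forall s : R, 0 < s <= T -> s * u' s - u s <= A * s ^+ 2 + B * s ^+ 2 * u' s) ->
  (forall s : R, 0 < s < e0 -> u s <= s * e + K * s ^+ 2) ->
  u T * (1 - B * T) <= T * e + A * T ^+ 2.
Proof.
move=> T0 B0 BT K0 e00 du hu hsmall.
pose w (s : R) := u s * s^-1 - B * u s - A * s.
pose w' (s : R) := u' s * s^-1 - u s * s^-2 - B * u' s - A.
have dw (s : R) : 0 < s -> is_derive s (1 : R) w (w' s).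
  move=> s0; have dus := du s.
  have dinv : is_derive s (1 : R) (fun x : R => x^-1) (- s^-2).
    apply: is_derive_eq; first by apply: is_deriveV; exact: lt0r_neq0.
    by rewrite /GRing.scale /= mulr1.
  rewrite /w; apply: is_derive_eq.
  by rewrite /GRing.scale /= /w'; ring.
suff H : w T <= e.
  have : w T * T <= e * T by rewrite ler_pM2r.
  have -> : w T * T = u T * (1 - B * T) - A * T ^+ 2.
    by rewrite /w; field; rewrite gt_eqF.
  by lra.
apply: (@ler_small_error _ _ (K + B * `|e| + `|A|) (Num.min e0 T)).
  by rewrite lt_min e00.
move=> s; rewrite lt_min => /and3P[s0 se sT].
have wTs : w T <= w s.
  have [||c /andP[] sc cT E] := @MVT _ w w' s T sT.
  - by move=> x; rewrite in_itv/= => /andP[sx _]; apply: dw; exact: lt_trans sx.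
  - apply: derivable_within_continuous => x; rewrite in_itv/= => /andP[sx _].
    exact: (@ex_derive _ _ _ _ _ _ _ (dw _ (lt_le_trans s0 sx))).
  rewrite /= bnd_simp in sc; rewrite /= bnd_simp in cT.
  rewrite -subr_le0 E pmulr_lle0 ?subr_gt0//.
  have c0 : 0 < c by exact: lt_trans sc.
  have c20 : 0 < c ^+ 2 by rewrite exprn_gt0.
  have := hu c; rewrite c0 (ltW cT) => /(_ isT).
  have -> : w' c = (c * u' c - u c - B * c ^+ 2 * u' c - A * c ^+ 2) / c ^+ 2.
    by rewrite /w'; field; rewrite gt_eqF.
  by move=> h; rewrite pmulr_lle0 ?invr_gt0//; lra.
apply: (le_trans wTs).
have sB : 0 <= s^-1 - B.
  rewrite subr_ge0 -[leRHS]mul1r ler_pdivlMr//.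
  by rewrite (le_trans _ BT)// ler_wpM2l// ltW.
have -> : w s = u s * (s^-1 - B) - A * s by rewrite /w; ring.
have h1 : u s * (s^-1 - B) <= (s * e + K * s ^+ 2) * (s^-1 - B).
  by rewrite ler_wpM2r// hsmall// s0.
have E : (s * e + K * s ^+ 2) * (s^-1 - B) = e + K * s - s * (B * e) - B * K * s ^+ 2.
  by field; rewrite gt_eqF.
rewrite E in h1.
have h2 : - (s * (B * e)) <= s * (B * `|e|).
  rewrite -mulrN -mulrN ler_pM2l// ler_wpM2l//.
  by have := ler_norm (- e); rewrite normrN.
have h3 : - (A * s) <= `|A| * s.
  by rewrite -mulNr ler_pM2r//; have := ler_norm (- A); rewrite normrN.
have h4 : 0 <= B * K * s ^+ 2 by rewrite !mulr_ge0// ltW.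
lra.
Qed.

(** 2 sinh(s) - 2 s is increasing, and 2 cosh(2 s) - 2 is the square of
   2 sinh(s). *)
Lemma cosh_ge (t : R) : 2 + t ^+ 2 <= expR t + expR (- t).
Proof.
have sinh_ge (s : R) : 0 <= s -> 2 * s <= expR s - expR (- s).
  rewrite le_eqVlt => /orP[/eqP <-|s0]; first by rewrite oppr0 expR0; lra.
  pose g (x : R) := expR x - expR (- x) - 2 * x.
  have dg x : is_derive x (1 : R) g (expR x + expR (- x) - 2).
    rewrite /g; apply: is_derive_eq; rewrite /GRing.scale /=; ring.
  have [c _] := mvt s0 dg; rewrite /g oppr0 expR0 addr0 => E.
  suff : 0 <= (expR c + expR (- c) - 2) * s by rewrite -E; lra.
  rewrite mulr_ge0 ?(ltW s0)//.
  have -> : expR c + expR (- c) - 2 = (expR (c / 2) - expR (- c / 2)) ^+ 2.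
    rewrite sqrrB -!expRM_natr -expRD.
    rewrite (_ : c / 2 * 2%:R = c); last by field.
    rewrite (_ : - c / 2 * 2%:R = - c); last by field.
    rewrite (_ : c / 2 + _ = 0) ?expR0; last by field.
    by ring.
  exact: sqr_ge0.
have -> : expR t + expR (- t) = 2 + (expR (t / 2) - expR (- (t / 2))) ^+ 2.
  rewrite sqrrB -!expRM_natr -expRD.
  rewrite (_ : t / 2 * 2%:R = t); last by field.
  rewrite (_ : - (t / 2) * 2%:R = - t); last by field.
  by rewrite subrr expR0; ring.
rewrite lerD2l.
have E x : (expR x - expR (- x)) ^+ 2 = (expR `|x| - expR (- `|x|)) ^+ 2.
  by case: (ler0P x) => // _; rewrite opprK -sqrrN opprB.
rewrite E -[leLHS]real_normK ?num_real//.
rewrite ler_sqr ?nnegrE//.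
apply: le_trans (sinh_ge _ (normr_ge0 _)).
rewrite normrM (@ger0_norm _ 2^-1)//; lra.
Qed.

End real_analysis.

(** * Expectations and moment generating functions *)

Section expectation.
Context {disp : measure_display} {T : measurableType disp} {R : realType}.
Variable m : probability T R.

Lemma integrable_bounded (f : T -> R) M : measurable_fun setT f ->
  (forall x, `|f x| <= M) -> m.-integrable setT (EFin \o f).
Proof.
move=> mf fM; apply: (@le_integrable _ _ _ m setT measurableT _ (EFin \o cst M)).
- exact/measurable_EFinP.
- by move=> x _ /=; rewrite lee_fin (le_trans (fM x))// ler_norm.
- exact: finite_measure_integrable_cst.
Qed.

Lemma expectation_cst (k : R) : \int[m]_x k = k.
Proof.
rewrite Rintegral_cst// (_ : fine (m setT) = 1) ?mulr1//.
have -> : m setT = 1%E by exact: probability_setT.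
by [].
Qed.

Lemma integrable_cst_prob (k : R) : m.-integrable setT (EFin \o (fun=> k)).
Proof. exact: finite_measure_integrable_cst. Qed.

Lemma integrable_scale k (f : T -> R) : m.-integrable setT (EFin \o f) ->
  m.-integrable setT (EFin \o (fun x => k * f x)).
Proof. by move=> fi; exact: (integrableZl measurableT k fi). Qed.

Lemma integrable_add (f g : T -> R) : m.-integrable setT (EFin \o f) ->
  m.-integrable setT (EFin \o g) ->
  m.-integrable setT (EFin \o (fun x => f x + g x)).
Proof. by move=> fi gi; exact: (integrableD measurableT fi gi). Qed.

Lemma integrable_sub (f g : T -> R) : m.-integrable setT (EFin \o f) ->
  m.-integrable setT (EFin \o g) ->
  m.-integrable setT (EFin \o (fun x => f x - g x)).
Proof. by move=> fi gi; exact: (integrableB measurableT fi gi). Qed.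

Lemma integrable_dominated (f g : T -> R) : measurable_fun setT f ->
  m.-integrable setT (EFin \o g) -> (forall x, `|f x| <= g x) ->
  m.-integrable setT (EFin \o f).
Proof.
move=> mf gi fg; apply: (@le_integrable _ _ _ m setT measurableT _ (EFin \o g)) => //.
- exact/measurable_EFinP.
- by move=> x _ /=; rewrite lee_fin (le_trans (fg x))// ler_norm.
Qed.

Lemma EFin_expectation (f : T -> R) : m.-integrable setT (EFin \o f) ->
  (\int[m]_x f x)%:E = (\int[m]_x (f x)%:E)%E.
Proof. by move=> fi; rewrite /Rintegral fineK//; exact: integrable_fin_num. Qed.

Lemma expectation_density (p : probability T R) (h g : T -> R) :
  (forall x, 0 <= h x) -> has_density p m h -> measurable_fun setT g ->
  \int[p]_x g x = \int[m]_x (g x * h x).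
Proof. by move=> h0 ph mg; rewrite /Rintegral (integral_density h0 ph). Qed.

(** Monotonicity of the integral of nonnegative functions needs no
   measurability: it is a supremum over the simple functions below. *)
Lemma ge0_le_integral_nomeas (D : set T) (f g : T -> \bar R) :
  (forall x, D x -> 0 <= f x)%E -> (forall x, D x -> f x <= g x)%E ->
  (\int[m]_(x in D) f x <= \int[m]_(x in D) g x)%E.
Proof.
move=> f0 fg; have g0 x : D x -> (0 <= g x)%E by move=> Dx; exact: le_trans (f0 _ Dx) (fg _ Dx).
rewrite !ge0_integralE//; apply: le_ereal_sup => _ [h hf <-]; exists h => //.
move=> x; apply: le_trans (hf x) _; rewrite !patchE; case: ifPn => //.
by rewrite inE; exact: fg.
Qed.

End expectation.

Section log_mgf.
Context {disp : measure_display} {T : measurableType disp} {R : realType}.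
Variables (m : probability T R) (F : T -> R) (M : R).
Hypotheses (M0 : 0 <= M) (mF : measurable_fun setT F)
  (FM : forall x, `|F x| <= M).

Definition mgf (s : R) : R := \int[m]_x expR (s * F x).
Definition log_mgf (s : R) : R := ln (mgf s).

Let mexp s : measurable_fun setT (fun x => expR (s * F x)).
Proof. by apply: measurableT_comp => //; exact: measurable_funM. Qed.

Let exp_bound s x : expR (s * F x) <= expR (`|s| * M).
Proof.
rewrite ler_expR (le_trans (ler_norm _))// normrM ler_wpM2l//.
Qed.

Let exp_bound' s x : expR (- (`|s| * M)) <= expR (s * F x).
Proof.
rewrite ler_expR lerNl (le_trans (ler_norm _))// normrN normrM ler_wpM2l//.
Qed.

Lemma integrable_expM (g : T -> R) K s : measurable_fun setT g ->
  (forall x, `|g x| <= K) ->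
  m.-integrable setT (EFin \o (fun x => g x * expR (s * F x))).
Proof.
move=> mg gK; apply: (@integrable_bounded _ _ _ _ _ (K * expR (`|s| * M))).
  exact: measurable_funM.
move=> x; rewrite normrM ler_pM// ger0_norm ?expR_ge0//.
Qed.

Lemma integrable_exp s : m.-integrable setT (EFin \o (fun x => expR (s * F x))).
Proof.
have := @integrable_expM (cst 1) 1 s (measurable_cst _).
by under eq_fun do rewrite mul1r; apply => x; rewrite normr1.
Qed.

Lemma mgf_gt0 s : 0 < mgf s.
Proof.
apply: (@lt_le_trans _ _ (expR (- (`|s| * M)))); first exact: expR_gt0.
rewrite -[leLHS](expectation_cst m); apply: le_Rintegral => //.
- exact: integrable_cst_prob.
- exact: integrable_exp.
Qed.

Lemma is_derive_mgf (s : R) :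
  is_derive s (1 : R) mgf (\int[m]_x (F x * expR (s * F x))).
Proof.
have dF (t : R) x : is_derive t (1 : R) (fun t : R => expR (t * F x)) (F x * expR (t * F x)).
  apply: is_derive_eq; rewrite /GRing.scale /=; ring.
have Is : `]s - 1, s + 1[%classic s by rewrite /= in_itv/=; apply/andP; split; lra.
have intf (t : R) : `]s - 1, s + 1[%classic t ->
  m.-integrable setT (EFin \o (fun x => expR (t * F x))).
  by move=> _; exact: integrable_exp.
have derf (t : R) x : `]s - 1, s + 1[%classic t -> setT x ->
    derivable ((fun (t : R) (x : T) => expR (t * F x))^~ x) t 1.
  by move=> _ _; exact: (@ex_derive _ _ _ _ _ _ _ (dF t x)).
pose G := cst (M * expR ((`|s| + 1) * M)) : T -> R.
have G0 x : 0 <= G x by rewrite /G /= mulr_ge0// expR_ge0.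
have intG : m.-integrable setT (EFin \o G) by exact: integrable_cst_prob.
have Gub (t : R) x : `]s - 1, s + 1[%classic t -> setT x ->
    `|partial1of2 (fun (t : R) (x : T) => expR (t * F x)) t x| <= G x.
  rewrite /= in_itv /= => /andP[t1 t2] _.
  rewrite partial1of2E (@derive_val _ _ _ _ _ _ _ (dF t x)) normrM ler_pM//.
  rewrite ger0_norm ?expR_ge0// (le_trans (exp_bound _ _))// ler_expR.
  rewrite ler_wpM2r// -lerBlDl (le_trans (lerB_dist _ _))//.
  by rewrite ltW// ltr_norml; apply/andP; split; lra.
split.
  exact: (derivable_under_integral measurableT Is intf derf G0 intG Gub).
rewrite -derive1E.
rewrite (differentiation_under_integral measurableT Is intf derf G0 intG Gub).
apply: eq_Rintegral => x _.
by rewrite partial1of2E (@derive_val _ _ _ _ _ _ _ (dF s x)).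
Qed.

Lemma is_derive_log_mgf (s : R) : is_derive s (1 : R) log_mgf
  ((\int[m]_x (F x * expR (s * F x))) / mgf s).
Proof.
have d1 := is_derive_mgf s; have d2 := is_derive1_ln (mgf_gt0 s).
by rewrite mulrC; exact: is_derive1_comp.
Qed.

(** Second-order expansion of the exponential, valid while |s F| is at most 1/2. *)
Lemma log_mgf_le_small s : 0 < s < (2 * (M + 1))^-1 ->
  log_mgf s <= s * (\int[m]_x F x) + 2 * M ^+ 2 * s ^+ 2.
Proof.
move=> /andP[s0 sM].
have iF : m.-integrable setT (EFin \o F) by exact: integrable_bounded FM.
have M1 : 0 < M + 1 by rewrite ltr_wpDl.
have h : mgf s <= 1 + (s * (\int[m]_x F x) + 2 * M ^+ 2 * s ^+ 2).
  have -> : 1 + (s * (\int[m]_x F x) + 2 * M ^+ 2 * s ^+ 2) =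
      \int[m]_x (s * F x + (1 + 2 * M ^+ 2 * s ^+ 2)).
    rewrite RintegralD//; last 2 first.
    - exact: integrable_scale.
    - exact: integrable_cst_prob.
    by rewrite RintegralZl// expectation_cst addrCA.
  apply: le_Rintegral => //.
  - exact: integrable_exp.
  - apply: (@integrable_bounded _ _ _ _ _ (s * M + (1 + 2 * M ^+ 2 * s ^+ 2))).
      by apply: measurable_funD => //; exact: measurable_funM.
    move=> x; rewrite (le_trans (ler_normD _ _))// lerD//.
      by rewrite normrM gtr0_norm// ler_pM2l.
    by rewrite ger0_norm// addr_ge0// mulr_ge0// ?sqr_ge0// mulr_ge0// sqr_ge0.
  move=> x _; apply: (le_trans (expR_le_quad _)).
    have : s * F x <= s * M.
      by rewrite ler_pM2l// (le_trans (ler_norm _)).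
    have : s * (2 * (M + 1)) < 1 by rewrite -ltr_pdivlMr ?mul1r// mulr_gt0.
    by lra.
  suff : (s * F x) ^+ 2 <= M ^+ 2 * s ^+ 2 by lra.
  rewrite exprMn mulrC ler_wpM2r ?sqr_ge0//.
  by rewrite -[F x ^+ 2]real_normK ?num_real// ler_sqr ?nnegrE.
rewrite /log_mgf (le_trans _ (_ : mgf s - 1 <= _))//; last by lra.
have := @le_ln1Dx R (mgf s - 1); rewrite [1 + _]addrC subrK; apply.
by rewrite ltrBrDl subrr mgf_gt0.
Qed.

End log_mgf.

(** * Truncations and the chain rule *)

Section measure_extra.
Context {disp : measure_display} {T : measurableType disp} {R : realType}.
Variable m : probability T R.

Lemma le_integral_gen (f g : T -> \bar R) :
  measurable_fun setT f -> measurable_fun setT g -> (forall x, f x <= g x)%E ->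
  (\int[m]_x f x <= \int[m]_x g x)%E.
Proof.
move=> mf mg fg; rewrite (integralE _ _ f) (integralE _ _ g); apply: leeB.
  apply: ge0_le_integral_nomeas => x _; first exact: funepos_ge0.
  by rewrite !funeposE ge_max !le_max fg lexx orbT.
apply: ge0_le_integral_nomeas => x _; first exact: funeneg_ge0.
by rewrite !funenegE ge_max !le_max leeN2 fg lexx orbT.
Qed.

End measure_extra.

Section truncation.
Context {R : realType}.

(** A bounded 1-Lipschitz truncation of the identity that is smooth, so that
   truncated test functions remain admissible in the logarithmic Sobolev
   inequality. *)
Definition trunc (n : nat) (t : R) : R := t / (1 + (t / n.+1%:R) ^+ 2).

Let den n (t : R) : 0 < 1 + (t / n.+1%:R) ^+ 2.
Proof. by rewrite ltr_pwDl// sqr_ge0. Qed.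

Lemma trunc_bounded n t : `|trunc n t| <= n.+1%:R.
Proof.
rewrite /trunc normrM normfV (gtr0_norm (den n t)) ler_pdivrMr//.
have n0 : (0 : R) < n.+1%:R by rewrite ltr0n.
set s := t / n.+1%:R; have -> : t = s * n.+1%:R by rewrite /s divfK// gt_eqF.
rewrite normrM (gtr0_norm n0) mulrC ler_pM2l//.
by rewrite -[s ^+ 2]real_normK ?num_real//; have := sqr_ge0 (`|s| - 1); have := normr_ge0 s; nra.
Qed.

Lemma trunc_le n t : `|trunc n t| <= `|t|.
Proof.
rewrite /trunc normrM normfV (gtr0_norm (den n t)) ler_pdivrMr//.
by rewrite ler_peMr// lerDl sqr_ge0.
Qed.

Lemma trunc_ge0 n t : 0 <= t -> 0 <= trunc n t.
Proof. by move=> t0; rewrite /trunc divr_ge0// ltW. Qed.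

Definition trunc' n (t : R) :=
  (1 - (t / n.+1%:R) ^+ 2) / (1 + (t / n.+1%:R) ^+ 2) ^+ 2.

Lemma is_derive_trunc n (t : R) : is_derive t (1 : R) (trunc n) (trunc' n t).
Proof.
rewrite /trunc /trunc'; have := den n t.
have : n.+1%:R != 0 :> R by rewrite pnatr_eq0.
move: n.+1%:R => N N0 D0.
have d1 : is_derive t (1 : R) (fun t : R => 1 + (t / N) ^+ 2) (2 * t / N ^+ 2).
  by apply: is_derive_eq; rewrite /GRing.scale /=; field.
have d2 : is_derive t (1 : R) (fun t : R => (1 + (t / N) ^+ 2)^-1)
   (- (1 + (t / N) ^+ 2) ^- 2 * (2 * t / N ^+ 2)).
  by apply: is_deriveV; rewrite gt_eqF.
apply: is_derive_eq; rewrite /GRing.scale /=.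
have E : 2 * t / N ^+ 2 * t = 2 * (t / N) ^+ 2 by field.
rewrite [t * (_ * (2 * _ / _))]mulrCA [t * (2 * _ / _)]mulrC E mulr1.
have : 1 + (t / N) ^+ 2 != 0 by rewrite gt_eqF.
by move: ((t / N) ^+ 2) => x x0; field.
Qed.

Lemma trunc'_le n t : `|trunc' n t| <= 1.
Proof.
rewrite /trunc' normrM normfV (@ger0_norm _ (_ ^+ 2)) ?sqr_ge0//.
rewrite ler_pdivrMr ?exprn_gt0// mul1r.
set s := (_ / _) ^+ 2; have s0 : 0 <= s by exact: sqr_ge0.
by rewrite ler_norml; apply/andP; split; nra.
Qed.

Lemma cvg_trunc t : trunc n t @[n --> \oo] --> t.
Proof.
rewrite -[X in _ --> X]divr1 /trunc; apply: cvgM; first exact: cvg_cst.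
apply: cvgV; first exact: oner_neq0.
rewrite -[X in _ --> X]addr0; apply: cvgD; first exact: cvg_cst.
rewrite -[X in _ --> X](expr0n R 2) /=.
have H : t * n.+1%:R^-1 @[n --> \oo] --> (0 : R).
  rewrite -[X in _ --> X](mulr0 t); apply: cvgM; first exact: cvg_cst.
  exact: cvg_harmonic.
under eq_fun do rewrite expr2.
by rewrite expr2; exact: cvgM.
Qed.

End truncation.

Section chain.
Context {R : realType} {d : nat}.
Local Notation V := 'rV[R]_d.

Lemma differentiable_compR (g : R -> R) (f : V -> R) x a :
  differentiable f x -> is_derive (f x) (1 : R) g a ->
  differentiable (g \o f) x /\ forall u, 'D_u (g \o f) x = a * 'D_u f x.
Proof.
move=> df dg.
have dg1 : derivable g (f x) 1 by exact: (@ex_derive _ _ _ _ _ _ _ dg).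
have dgf : differentiable g (f x) by exact/derivable1_diffP.
have dc : differentiable (g \o f) x by exact: differentiable_comp.
split=> // u; rewrite !deriveE// diff_comp//= deriv1E// derive1E.
by rewrite (@derive_val _ _ _ _ _ _ _ dg) mulrC.
Qed.

End chain.

(** * Herbst's argument *)

Section lsi.
Context {R : realType} {d : nat}.
Local Notation V := 'rV[R]_d.
Variables (X : set V) (rho : probability V R) (C : R).
Hypotheses (oX : open X) (rhoX : rho X = 1%E) (C0 : 0 <= C) (lsi : LSI X rho C).

Lemma density_full_set (p : probability V R) (h : V -> R) (q : probability V R) (Y : set V) :
  open Y -> q Y = 1%E -> has_density p q h -> p Y = 1%E.
Proof.
move=> oY qY ph; have pq := has_density_dominates ph.
have mY := open_measurable_rV oY.
have qYC : q (~` Y) = 0%E by rewrite probability_setC// qY subee.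
have /null_content_dominatesP/(_ _ (measurableC mY) qYC) pYC := pq.
by rewrite -[Y]setCK probability_setC ?pYC ?sube0//; exact: measurableC.
Qed.

Lemma lsi_exp (p : probability V R) (W H : V -> R) :
  has_density p rho (expR \o W) -> (forall x, differentiable W x) ->
  (forall x, enorm (grad W x) ^+ 2 <= H x) ->
  (KL p rho <= (C / 2)%:E * \int[p]_x (H x)%:E)%E.
Proof.
move=> pW dW WH.
have pX := density_full_set oX rhoX pW.
apply: (le_trans (lsi pX pW _)).
  move=> x _; split; first exact: expR_ge0.
  by have [] := differentiable_compR (dW x) (is_derive_expR (W x)).
apply: lee_wpmul2l; first by rewrite lee_fin divr_ge0.
have -> : ln (R:=R) \o (expR \o W) = W by apply/funext => x; exact: expRK.
rewrite integral_mkcond; apply: ge0_le_integral_nomeas => x _.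
  by rewrite patchE; case: ifPn => // _; rewrite lee_fin sqr_ge0.
rewrite patchE; case: ifPn => _; rewrite lee_fin//.
by apply: le_trans (WH x); exact: sqr_ge0.
Qed.

Section bounded.
Variables (F : V -> R) (M : R).
Hypotheses (M0 : 0 <= M) (dF : forall x, differentiable F x)
  (FM : forall x, `|F x| <= M).

Let mF : measurable_fun setT F := differentiable_measurable_rV dF.

Let mgf' s := \int[rho]_x (F x * expR (s * F x)).

(** The tilt of rho by exp(s F) has entropy s u'(s) - u(s), where u is the
   logarithm of the moment generating function of F. The majorant H of the squared
   gradient is constant in Herbst's argument; for the square of a Lipschitz
   function it is a multiple of that square. *)
Lemma lsi_tilt (H : V -> R) (K s : R) :
  measurable_fun setT H -> (forall x, `|H x| <= K) ->
  (forall x, enorm (grad F x) ^+ 2 <= H x) ->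
  s * (mgf' s / mgf rho F s) - log_mgf rho F s <=
  C / 2 * s ^+ 2 * ((\int[rho]_x (H x * expR (s * F x))) / mgf rho F s).
Proof.
move=> mH HK FH.
pose u := log_mgf rho F s; pose Z := mgf rho F s.
have Z0 : 0 < Z := mgf_gt0 rho mF FM s.
have expu : expR u = Z by rewrite /u /log_mgf lnK// posrE.
pose W x := s * F x - u.
have WE x : expR (W x) = expR (s * F x) / Z by rewrite /W expRB expu.
have mW : measurable_fun setT W.
  by apply: measurable_funB => //; exact: measurable_funM.
have [p pW] : exists p : probability V R, has_density p rho (expR \o W).
  apply: exists_density => [|x|]; first exact: measurableT_comp.
    exact: expR_ge0.
  have iE : rho.-integrable setT (EFin \o (expR \o W)).
    have -> : expR \o W = fun x => Z^-1 * expR (s * F x).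
      by apply/funext => x; rewrite /= WE mulrC.
    by apply: integrable_scale; exact: (integrable_exp rho mF FM _).
  rewrite -EFin_expectation//.
  have -> : expR \o W = fun x => Z^-1 * expR (s * F x).
    by apply/funext => x; rewrite /= WE mulrC.
  rewrite RintegralZl//; last exact: (integrable_exp rho mF FM _).
  by rewrite -/(mgf rho F s) -/Z mulVf// gt_eqF.
have pE (g : V -> R) : measurable_fun setT g ->
    \int[p]_x g x = \int[rho]_x (g x * expR (W x)).
  by move=> mg; apply: (expectation_density _ pW) => // x; exact: expR_ge0.
have tiltE (g : V -> R) (K' : R) : measurable_fun setT g -> (forall x, `|g x| <= K') ->
    \int[p]_x g x = (\int[rho]_x (g x * expR (s * F x))) / Z.
  move=> mg gK; rewrite pE// mulrC -RintegralZl//; last first.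
    exact: (integrable_expM rho mF FM _ mg gK).
  by apply: eq_Rintegral => x _; rewrite WE; ring.
have iF : p.-integrable setT (EFin \o F) by exact: integrable_bounded FM.
have iW : p.-integrable setT (EFin \o W).
  by apply: integrable_sub; [exact: integrable_scale|exact: integrable_cst_prob].
have iH : p.-integrable setT (EFin \o H) by exact: integrable_bounded HK.
have dWx x : differentiable W x.
  by apply: differentiableB => //; apply: differentiableZ.
have gW x : enorm (grad W x) ^+ 2 <= s ^+ 2 * H x.
  have -> : grad W x = s *: grad F x.
    apply/rowP => i; rewrite !mxE.
    rewrite deriveB; [|by apply: diff_derivable; exact: differentiableZ|exact: derivable_cst].
    rewrite (@deriveZ _ _ _ F s); last exact: diff_derivable.
    by rewrite derive_cst subr0.
  by rewrite enormZ exprMn real_normK ?num_real// ler_wpM2l ?sqr_ge0.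
have := lsi_exp pW dWx gW.
rewrite (KL_density mW pW) -EFin_expectation// -EFin_expectation; last first.
  exact: integrable_scale.
have -> : \int[p]_x W x = s * \int[p]_x F x - u.
  rewrite RintegralB//; [|exact: integrable_scale|exact: integrable_cst_prob].
  by rewrite expectation_cst RintegralZl.
rewrite -EFinM lee_fin RintegralZl//.
by rewrite (tiltE _ _ mF FM) (tiltE _ _ mH HK) => /le_trans; apply; rewrite -[in leRHS]mulrA.
Qed.

Lemma log_mgf_herbst_ge0 (G s : R) : 0 <= G -> 0 <= s ->
  (forall x u, 'D_u F x <= G * enorm u) ->
  log_mgf rho F s <= s * (\int[rho]_x F x) + C * G ^+ 2 / 2 * s ^+ 2.
Proof.
move=> G0; rewrite le_eqVlt => /orP[/eqP <- _|s0 FG].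
  rewrite /log_mgf /mgf; under eq_Rintegral do rewrite mul0r expR0.
  by rewrite expectation_cst ln1 mul0r expr0n mulr0 addr0.
have Mp : 0 < (2 * (M + 1))^-1 by rewrite invr_gt0 mulr_gt0// ltr_wpDl.
have := @log_mgf_ode R (log_mgf rho F) (fun s => mgf' s / mgf rho F s) s
  (C * G ^+ 2 / 2) 0 (\int[rho]_x F x) (2 * M ^+ 2) (2 * (M + 1))^-1 s0 (lexx _).
rewrite !mul0r subr0 mulr1 ler01 => /(_ isT).
have -> : 0 <= 2 * M ^+ 2 by rewrite mulr_ge0// sqr_ge0.
move=> /(_ isT Mp) H; apply: H.
- by move=> t; exact: (is_derive_log_mgf rho M0 mF FM).
- move=> t /andP[t0 ts]; rewrite !mul0r addr0.
  have FG2 x : enorm (grad F x) ^+ 2 <= G ^+ 2.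
    rewrite ler_sqr ?nnegrE ?enorm_ge0//.
    by apply: enorm_grad_le => // u.
  have hh : forall x : V, `|cst (G ^+ 2) x| <= G ^+ 2 by move=> x; rewrite ger0_norm ?sqr_ge0.
  have := @lsi_tilt (cst (G ^+ 2)) (G ^+ 2) t (measurable_cst _) hh FG2.
  move=> /le_trans; apply.
  rewrite RintegralZl//; last exact: (integrable_exp rho mF FM _).
  rewrite -/(mgf rho F t) mulfK ?gt_eqF//; last exact: (mgf_gt0 rho mF FM).
  by rewrite le_eqVlt; apply/orP; left; apply/eqP; field.
- by move=> t ht; exact: (log_mgf_le_small rho M0 mF FM).
Qed.

End bounded.

(** Herbst's argument: Lipschitz functions are sub-Gaussian. *)
Lemma lsi_herbst (F : V -> R) (M G s : R) : 0 <= M -> 0 <= G ->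
  (forall x, differentiable F x) -> (forall x, `|F x| <= M) ->
  (forall x u, 'D_u F x <= G * enorm u) ->
  mgf rho F s <= expR (s * (\int[rho]_x F x) + C * G ^+ 2 / 2 * s ^+ 2).
Proof.
move=> M0 G0 dF FM FG.
have mF : measurable_fun setT F := differentiable_measurable_rV dF.
rewrite -[leLHS]lnK; last by rewrite posrE; exact: (mgf_gt0 rho mF FM s).
rewrite ler_expR -/(log_mgf rho F s).
have [s0|s0] := leP 0 s; first exact: (log_mgf_herbst_ge0 M0 dF FM G0 s0 FG).
have dNF x : differentiable (\- F) x by exact: differentiableN.
have NFM x : `|(\- F) x| <= M by rewrite /= normrN.
have := @log_mgf_herbst_ge0 _ _ M0 dNF NFM G (- s) G0.
rewrite oppr_ge0 => /(_ (ltW s0)) H.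
have -> : log_mgf rho F s = log_mgf rho (\- F) (- s).
  by rewrite /log_mgf /mgf; under [in RHS]eq_Rintegral do rewrite /= mulrNN.
apply: (le_trans (H _)).
  move=> x u; rewrite deriveN; last exact: diff_derivable.
  have := FG x (- u); rewrite enormN !deriveE// linearN.
  by [].
rewrite sqrrN.
have -> : \int[rho]_x (\- F) x = - \int[rho]_x F x.
  rewrite -mulN1r -RintegralZl//; last exact: integrable_bounded FM.
  by apply: eq_Rintegral => x _; rewrite mulN1r.
by rewrite mulrNN.
Qed.

End lsi.

(** * Variances under tilted measures *)

Section lsi_variance.
Context {R : realType} {d : nat}.
Local Notation V := 'rV[R]_d.
Variables (X : set V) (rho : probability V R) (C : R).
Hypotheses (oX : open X) (rhoX : rho X = 1%E) (C0 : 0 <= C) (lsi : LSI X rho C).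

Section bounded.
Variables (F : V -> R) (M G : R).
Hypotheses (M0 : 0 <= M) (G0 : 0 <= G) (dF : forall x, differentiable F x)
  (FM : forall x, `|F x| <= M) (FG : forall x u, `|'D_u F x| <= G * enorm u).

Let mF : measurable_fun setT F := differentiable_measurable_rV dF.
Let e : R := \int[rho]_x F x.
Let g (x : V) : R := (F x - e) ^+ 2.
Let N : R := (M + `|e|) ^+ 2.

Let gN x : `|g x| <= N.
Proof.
rewrite /g normrX ler_sqr ?nnegrE ?addr_ge0//.
by rewrite (le_trans (ler_normB _ _))// lerD2r.
Qed.

Let dg x : differentiable g x /\ forall u, 'D_u g x = 2 * (F x - e) * 'D_u F x.
Proof.
apply: (differentiable_compR (g := fun t => (t - e) ^+ 2) (dF x)).
by apply: is_derive_eq; rewrite /GRing.scale /=; ring.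
Qed.

Let mg : measurable_fun setT g.
Proof. by apply: differentiable_measurable_rV => x; case: (dg x). Qed.

(** Adding the sub-Gaussian bounds for l and - l gives
   2 + l^2 Var F <= 2 exp(C G^2 l^2 / 2), to be expanded to order two in l. *)
Lemma lsi_poincare : \int[rho]_x ((F x - e) ^+ 2) <= C * G ^+ 2.
Proof.
pose A := C * G ^+ 2 / 2.
have A0 : 0 <= A by rewrite divr_ge0// mulr_ge0// sqr_ge0.
have ig : rho.-integrable setT (EFin \o g) by exact: integrable_bounded gN.
apply: (@ler_small_error _ _ _ (4 * A ^+ 2) (2 * (A + 1))^-1).
  by rewrite invr_gt0 mulr_gt0// ltr_wpDl.
move=> e1 /andP[e10 e1A].
(* the expansion parameter; e1 is its square *)
pose l := Num.sqrt e1; have l0 : 0 < l by rewrite sqrtr_gt0.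
have l2 : l ^+ 2 = e1 by rewrite sqr_sqrtr// ltW.
have FG' x u : 'D_u F x <= G * enorm u by rewrite (le_trans (ler_norm _)).
have herbst s := lsi_herbst oX rhoX C0 lsi s M0 G0 dF FM FG'.
have iexp s := integrable_exp rho mF FM s.
have key s : \int[rho]_x expR (s * (F x - e)) <= expR (A * s ^+ 2).
  have -> : \int[rho]_x expR (s * (F x - e)) = expR (- (s * e)) * mgf rho F s.
    rewrite -RintegralZl//; apply: eq_Rintegral => x _.
    by rewrite -expRD; congr expR; ring.
  have -> : expR (A * s ^+ 2) = expR (- (s * e)) * expR (s * e + A * s ^+ 2).
    by rewrite -expRD; congr expR; ring.
  by rewrite ler_pM2l ?expR_gt0//; exact: herbst.
have iexp' s : rho.-integrable setT (EFin \o (fun x => expR (s * (F x - e)))).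
  have -> : (fun x => expR (s * (F x - e))) = fun x => expR (- (s * e)) * expR (s * F x).
    by apply/funext => x; rewrite -expRD; congr expR; ring.
  exact: integrable_scale.
have cosh_int : 2 + e1 * \int[rho]_x g x <=
    \int[rho]_x expR (l * (F x - e)) + \int[rho]_x expR (- l * (F x - e)).
  rewrite -RintegralD// -(RintegralZl e1 measurableT ig) -[X in X + _](expectation_cst rho).
  rewrite -RintegralD//; last 2 first.
  - exact: integrable_cst_prob.
  - exact: integrable_scale.
  apply: le_Rintegral => //.
  - by apply: integrable_add; [exact: integrable_cst_prob|exact: integrable_scale].
  - exact: integrable_add.
  by move=> x _; rewrite mulNr -l2 -exprMn; exact: cosh_ge.
have Ae1 : A * e1 <= 2^-1.
  have : e1 * (2 * (A + 1)) < 1 by rewrite -ltr_pdivlMr ?mul1r// mulr_gt0// ltr_wpDl.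
  by lra.
have h1 := key l; have h2 := key (- l); rewrite sqrrN l2 in h2; rewrite l2 in h1.
have h3 := expR_le_quad Ae1.
have h4 : e1 * \int[rho]_x g x <= e1 * (2 * A + 4 * A ^+ 2 * e1).
  rewrite exprMn in h3; nra.
move: h4; rewrite ler_pM2l// => h4.
have -> : C * G ^+ 2 = 2 * A by rewrite /A; field.
exact: h4.
Qed.

(** The squared gradient of g is at most 4 G^2 g, so the tilt by exp(s g) satisfies
   s u' - u <= 2 D s^2 u'. The value s = 1 / (4 D) makes 1 - 2 D s equal to 1/2, and
   the Poincare inequality bounds the mean of g by D. A positive majorant D of
   C G^2 allows for C G^2 = 0. *)
Lemma lsi_exp_square D : 0 < D -> C * G ^+ 2 <= D ->
  log_mgf rho g (4 * D)^-1 <= 2^-1.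
Proof.
move=> D0 CGD.
have N0 : 0 <= N by exact: sqr_ge0.
have dg1 x : differentiable g x by case: (dg x).
pose mgf' s := \int[rho]_x (g x * expR (s * g x)).
have mgf0 s := mgf_gt0 rho mg gN s.
have D40 : 0 < (4 * D)^-1 by rewrite invr_gt0 mulr_gt0.
have Np : 0 < (2 * (N + 1))^-1 by rewrite invr_gt0 mulr_gt0// ltr_wpDl.
have BT : 2 * D * (4 * D)^-1 = 2^-1 by field; rewrite gt_eqF.
have := @log_mgf_ode R (log_mgf rho g) (fun s => mgf' s / mgf rho g s) (4 * D)^-1
  0 (2 * D) (\int[rho]_x g x) (2 * N ^+ 2) (2 * (N + 1))^-1 D40.
have -> : 0 <= 2 * D by rewrite mulr_ge0// ltW.
rewrite BT; have -> : 2^-1 <= 1 :> R by lra.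
have -> : 0 <= 2 * N ^+ 2 by rewrite mulr_ge0// sqr_ge0.
move=> /(_ isT isT isT Np (is_derive_log_mgf rho N0 mg gN)) H.
have {H} : log_mgf rho g (4 * D)^-1 * (1 - 2^-1) <=
   (4 * D)^-1 * \int[rho]_x g x + 0 * (4 * D)^-1 ^+ 2.
  apply: H; last by move=> s hs; exact: (log_mgf_le_small rho N0 mg gN).
  move=> s /andP[s0 sD].
  have HK x : `|4 * G ^+ 2 * g x| <= 4 * G ^+ 2 * N.
    by rewrite normrM ger0_norm ?mulr_ge0 ?sqr_ge0// ler_wpM2l// mulr_ge0// sqr_ge0.
  have gH x : enorm (grad g x) ^+ 2 <= 4 * G ^+ 2 * g x.
    have -> : 4 * G ^+ 2 * g x = (2 * `|F x - e| * G) ^+ 2.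
      by rewrite !exprMn real_normK ?num_real// /g; ring.
    rewrite ler_sqr ?nnegrE ?enorm_ge0 ?mulr_ge0//.
    apply: enorm_grad_le => //; first by rewrite !mulr_ge0.
    move=> u; rewrite (dg x).2 (le_trans (ler_norm _))// !normrM normr_nat.
    by rewrite -[leRHS]mulrA ler_wpM2l// mulr_ge0.
  have mH : measurable_fun setT (fun x => 4 * G ^+ 2 * g x).
    exact: measurable_funM.
  have := lsi_tilt oX rhoX C0 lsi dg1 gN s mH HK gH.
  rewrite -/(mgf' s) mul0r add0r => /le_trans; apply.
  have -> : \int[rho]_x (4 * G ^+ 2 * g x * expR (s * g x)) = 4 * G ^+ 2 * mgf' s.
    rewrite -RintegralZl//; last exact: (integrable_expM rho mg gN _ mg gN).
    by apply: eq_Rintegral => x _; rewrite mulrA.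
  have u0 : 0 <= mgf' s / mgf rho g s.
    rewrite divr_ge0 ?(ltW (mgf0 s))//; apply: Rintegral_ge0 => x _.
    by rewrite mulr_ge0 ?expR_ge0// sqr_ge0.
  have -> : C / 2 * s ^+ 2 * (4 * G ^+ 2 * mgf' s / mgf rho g s) =
    2 * (C * G ^+ 2) * s ^+ 2 * (mgf' s / mgf rho g s) by field; rewrite gt_eqF.
  by rewrite ler_wpM2r// ler_wpM2r ?sqr_ge0// ler_pM2l.
rewrite mul0r addr0 => H.
have h : (4 * D)^-1 * \int[rho]_x g x <= 4^-1.
  rewrite invfM -mulrA -[leRHS]mulr1 ler_pM2l// mulrC ler_pdivrMr// mul1r.
  exact: le_trans lsi_poincare CGD.
lra.
Qed.

(** Entropy duality: the variance under q costs the relative entropy of q,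
   which the logarithmic Sobolev inequality bounds by the slope of log dq/drho,
   plus the exponential square moment under rho. *)
Lemma lsi_variance_bounded (q : probability V R) (W : V -> R) K D :
  0 < D -> C * G ^+ 2 <= D -> 0 <= K ->
  has_density q rho (expR \o W) -> (forall x, differentiable W x) ->
  (forall x u, `|'D_u W x| <= K * enorm u) ->
  \int[q]_x (F x ^+ 2) - (\int[q]_x F x) ^+ 2 <= 2 * D * (1 + C * K ^+ 2).
Proof.
move=> D0 CGD K0 qW dW WK.
have mW := differentiable_measurable_rV dW.
have iF2 : q.-integrable setT (EFin \o (fun x => F x ^+ 2)).
  apply: (@integrable_bounded _ _ _ _ _ (M ^+ 2)); first exact: measurable_funX.
  by move=> x; rewrite normrX ler_sqr ?nnegrE.
have iF : q.-integrable setT (EFin \o F) by exact: integrable_bounded FM.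
have ig : q.-integrable setT (EFin \o g) by exact: integrable_bounded gN.
have Eg : \int[q]_x g x = \int[q]_x (F x ^+ 2) - 2 * e * (\int[q]_x F x) + e ^+ 2.
  rewrite -(expectation_cst q (e ^+ 2)) -RintegralZl// -RintegralB//; last exact: integrable_scale.
  rewrite -RintegralD//; [|by apply: integrable_sub => //; exact: integrable_scale|exact: integrable_cst_prob].
  by apply: eq_Rintegral => x _; rewrite /g; ring.
suff : \int[q]_x g x <= 2 * D * (1 + C * K ^+ 2).
  by rewrite Eg; have := sqr_ge0 (\int[q]_x F x - e); nra.
pose s := (4 * D)^-1; have s0 : 0 < s by rewrite invr_gt0 mulr_gt0.
pose u := log_mgf rho g s.
have u_le : u <= 2^-1 := lsi_exp_square D0 CGD.
have Z0 := mgf_gt0 rho mg gN s.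
have expu : expR u = mgf rho g s by rewrite /u /log_mgf lnK// posrE.
have KLle : (KL q rho <= (C / 2 * K ^+ 2)%:E)%E.
  have := lsi_exp oX rhoX C0 lsi qW dW (H := cst (K ^+ 2)).
  rewrite /cst integral_cst//= probability_setT mule1 -EFinM; apply => x.
  rewrite ler_sqr ?nnegrE ?enorm_ge0//; apply: enorm_grad_le => // v.
  by rewrite (le_trans (ler_norm _)).
rewrite (KL_density mW qW) in KLle.
(* exp t is the q-density of the tilt of rho by exp(s g) *)
pose t x := s * g x - u - W x.
have it : \int[q]_x expR (t x) = 1.
  rewrite (expectation_density _ qW)//; last 2 first.
  - by move=> x; exact: expR_ge0.
  - apply: measurableT_comp => //; apply: measurable_funB => //.
    by apply: measurable_funB => //; exact: measurable_funM.
  have -> : \int[rho]_x (expR (t x) * (expR \o W) x) =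
      \int[rho]_x (expR (- u) * expR (s * g x)).
    by apply: eq_Rintegral => x _; rewrite /= -!expRD /t; congr expR; ring.
  rewrite RintegralZl//; last exact: (integrable_exp rho mg gN).
  by rewrite -/(mgf rho g s) -expu -expRD addNr expR0.
have mt : measurable_fun setT t.
  apply: measurable_funB => //; apply: measurable_funB => //.
  exact: measurable_funM.
have iexpt : q.-integrable setT (EFin \o (expR \o t)).
  apply/(integrable_density _ qW); first by move=> x; exact: expR_ge0.
    exact: measurableT_comp.
  have -> : (fun x => ((expR \o t) x * (expR \o W) x)%:E) =
      EFin \o (fun x => expR (- u) * expR (s * g x)).
    by apply/funext => x /=; congr EFin; rewrite -!expRD /t; congr expR; ring.
  by apply: integrable_scale; exact: (integrable_exp rho mg gN).
have isg : q.-integrable setT (EFin \o (fun x => s * g x)) by exact: integrable_scale.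
have isgu : q.-integrable setT (EFin \o (fun x => s * g x - (u - 1))).
  by apply: integrable_sub => //; exact: integrable_cst_prob.
have H : (\int[q]_x (s * g x - (u - 1) - expR (t x))%:E <= (C / 2 * K ^+ 2)%:E)%E.
  apply: le_trans KLle; apply: le_integral_gen.
  - by apply/measurable_EFinP; apply: measurable_funB;
      [apply: measurable_funB => //; exact: measurable_funM|exact: measurableT_comp].
  - exact/measurable_EFinP.
  - by move=> x; rewrite lee_fin; have := expR_ge1Dx (t x); rewrite /t; lra.
rewrite -EFin_expectation in H; last exact: integrable_sub.
rewrite lee_fin RintegralB// RintegralB// in H; last exact: integrable_cst_prob.
rewrite expectation_cst it RintegralZl// in H.
have : s * \int[q]_x g x <= C / 2 * K ^+ 2 + 2^-1 by lra.
rewrite mulrC /s ler_pdivrMr ?mulr_gt0// => /le_trans; apply.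
by rewrite le_eqVlt; apply/orP; left; apply/eqP; field.
Qed.

End bounded.
End lsi_variance.

(** * Image measures and exponential moments *)

Section image_measure.
Context {d1 d2 : measure_display} {S : measurableType d1}
  {T : measurableType d2} {R : realType}.
Variables (g : probability S R) (m : probability T R) (phi : S -> T).
Hypotheses (mphi : measurable_fun setT phi)
  (gm : forall A, measurable A -> g (phi @^-1` A) = m A).

Lemma ge0_integral_image (f : T -> \bar R) : measurable_fun setT f ->
  (forall x, 0 <= f x)%E -> (\int[m]_x f x = \int[g]_x f (phi x))%E.
Proof.
move=> mf f0; have := @ge0_integral_pushforward _ _ _ _ R phi mphi g setT f
  measurableT mf (fun x _ => f0 x).
rewrite preimage_setT => <-; apply: eq_measure_integral => A mA _.
exact: (esym (gm mA)).
Qed.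

Lemma integral_image (f : T -> R) : measurable_fun setT f ->
  (\int[m]_x (f x)%:E = \int[g]_x (f (phi x))%:E)%E.
Proof.
move=> mf; have mfE : measurable_fun setT (EFin \o f) by exact/measurable_EFinP.
rewrite [LHS]integralE [RHS]integralE.
rewrite (ge0_integral_image (measurable_funepos mfE))//.
rewrite (ge0_integral_image (measurable_funeneg mfE))//.
by congr (_ - _)%E; apply: eq_integral => x _; rewrite ?funeposE ?funenegE.
Qed.

Lemma integrable_image (f : T -> R) : measurable_fun setT f ->
  m.-integrable setT (EFin \o f) <->
  g.-integrable setT (EFin \o (fun x => f (phi x))).
Proof.
move=> mf; have mfE : measurable_fun setT (EFin \o f) by exact/measurable_EFinP.
have E : (\int[m]_x `|(f x)%:E| = \int[g]_x `|(f (phi x))%:E|)%E.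
  rewrite (@ge0_integral_image (fun x => `|(f x)%:E|%E))//.
  by apply: measurableT_comp mfE; exact: abse_measurable.
split=> /integrableP[_ H]; apply/integrableP; split => //=.
- by apply/measurable_EFinP; exact: measurableT_comp.
- by rewrite -E.
- by rewrite E.
Qed.

Lemma expectation_image (f : T -> R) : measurable_fun setT f ->
  \int[m]_x f x = \int[g]_x f (phi x).
Proof. by move=> mf; rewrite /Rintegral integral_image. Qed.

End image_measure.

Section convergence_lemmas.
Context {disp : measure_display} {T : measurableType disp} {R : realType}.
Variable m : probability T R.

Lemma cvg_EFin_seq (u : nat -> R) l : u n @[n --> \oo] --> l ->
  (u n)%:E @[n --> \oo] --> l%:E.
Proof. by move=> ul; apply/fine_cvgP; split => //; exact: nearW. Qed.

Lemma expectation_dominated_cvg (h_ : nat -> T -> R) (h g : T -> R) :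
  (forall n, measurable_fun setT (h_ n)) -> measurable_fun setT h ->
  (forall x, h_ n x @[n --> \oo] --> h x) ->
  m.-integrable setT (EFin \o g) -> (forall n x, `|h_ n x| <= g x) ->
  \int[m]_x h_ n x @[n --> \oo] --> \int[m]_x h x.
Proof.
move=> mh_ mh h_h ig hg.
have [ih _] := @dominated_convergence _ _ _ m setT measurableT
  (fun n => EFin \o h_ n) (EFin \o h) (EFin \o g)
  (fun n => (measurable_EFinP _ _).2 (mh_ n)) ((measurable_EFinP _ _).2 mh)
  (aeW _ (fun x _ => cvg_EFin_seq (h_h x))) ig
  (aeW _ (fun x n _ => hg n x)).
rewrite -EFin_expectation// => /fine_cvg.
exact.
Qed.

Lemma expectation_exp_gt0 (f : T -> R) :
  measurable_fun setT f -> (0 < \int[m]_x (expR (f x))%:E)%E.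
Proof.
move=> mf; rewrite lt0e; apply/andP; split; last first.
  by apply: integral_ge0 => x _; rewrite lee_fin expR_ge0.
apply/eqP => E0.
have mE : measurable_fun setT (fun x => (expR (f x))%:E).
  by apply/measurable_EFinP; exact: measurableT_comp.
have : (\int[m]_(x in setT) `|(expR (f x))%:E| = 0)%E.
  by rewrite -[RHS]E0; apply: eq_integral => x _; rewrite gee0_abs// lee_fin expR_ge0.
move/(ae_eq_integral_abs m measurableT mE) => [N [mN N0 subN]].
have : N = setT.
  apply/seteqP; split => // x _; apply: subN => /= /(_ I) [].
  by move=> /eqP; rewrite gt_eqF// expR_gt0.
move=> NT; have := probability_setT m; rewrite -NT => mN1.
by have /eqP := etrans (esym mN1) N0; rewrite onee_eq0.
Qed.

Lemma fatou_bound (f_ : nat -> T -> R) (f : T -> R) (B : R) :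
  (forall n, measurable_fun setT (f_ n)) -> (forall n x, 0 <= f_ n x) ->
  (forall x, f_ n x @[n --> \oo] --> f x) ->
  (forall n, \int[m]_x (f_ n x)%:E <= B%:E)%E ->
  (\int[m]_x (f x)%:E <= B%:E)%E.
Proof.
move=> mf_ f0 f_f fB.
have := @fatou _ _ _ m setT measurableT (fun n => EFin \o f_ n)
  (fun n => (measurable_EFinP _ _).2 (mf_ n)) _.
have -> : (\int[m]_x limn_einf ((fun n => EFin \o f_ n)^~ x) = \int[m]_x (f x)%:E)%E.
  apply: eq_integral => x _.
  exact: (cvg_limn_einf_sup (cvg_EFin_seq (f_f x))).1.
move=> H; apply: (le_trans (H _)); first by move=> n x _; rewrite lee_fin.
rewrite limn_einf_lim; apply: lime_le; first exact: is_cvg_einfs.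
apply: nearW => n; apply: le_trans (fB n).
by apply: ereal_inf_lbound; exists n => /=.
Qed.

(** Sub-Gaussian truncations have bounded means, because exp(- f) has positive
   mean; the exponential moments of f then follow from Fatou's lemma. *)
Lemma subgaussian_exp_moment (f : T -> R) (sigma s : R) :
  measurable_fun setT f -> (forall x, 0 <= f x) ->
  (forall n s, mgf m (trunc n \o f) s <=
     expR (s * (\int[m]_x trunc n (f x)) + sigma * s ^+ 2)) ->
  m.-integrable setT (EFin \o (fun x => expR (s * f x))).
Proof.
move=> mf f0 sg.
have mF n : measurable_fun setT (trunc n \o f).
  apply: measurableT_comp => //; apply: continuous_measurable_fun.
  exact: is_derive_continuous (is_derive_trunc n).
have Fb n x : `|(trunc n \o f) x| <= n.+1%:R by exact: trunc_bounded.
have iF n : m.-integrable setT (EFin \o (trunc n \o f)) by exact: integrable_bounded (Fb n).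
pose a := \int[m]_x expR (- f x).
have ia : m.-integrable setT (EFin \o (fun x => expR (- f x))).
  apply: (@integrable_bounded _ _ _ _ _ 1).
    by apply: measurableT_comp => //; exact: measurableT_comp.
  by move=> x; rewrite ger0_norm ?expR_ge0// -expR0 ler_expR oppr_le0.
have a0 : 0 < a.
  rewrite -lte_fin EFin_expectation//.
  by apply: expectation_exp_gt0; exact: measurableT_comp.
pose b := sigma - ln a.
have Eb n : \int[m]_x trunc n (f x) <= b.
  have h : a <= expR (- (\int[m]_x trunc n (f x)) + sigma).
    apply: (@le_trans _ _ (mgf m (trunc n \o f) (- 1))).
      apply: le_Rintegral => //; first exact: (integrable_exp m (mF n) (Fb n)).
      move=> x _; rewrite mulN1r ler_expR lerN2 /=.
      by rewrite (le_trans (ler_norm _))// (le_trans (trunc_le _ _))// ger0_norm.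
    by rewrite (le_trans (sg n (- 1)))// mulN1r sqrrN expr1n mulr1.
  have : ln a <= - (\int[m]_x trunc n (f x)) + sigma.
    by rewrite -[leRHS]expRK ler_ln// posrE// expR_gt0.
  by rewrite /b; lra.
have E0 n : 0 <= \int[m]_x trunc n (f x).
  by apply: Rintegral_ge0 => x _; exact: trunc_ge0.
apply/integrableP; split.
  by apply/measurable_EFinP; apply: measurableT_comp => //; exact: measurable_funM.
apply: (@le_lt_trans _ _ (expR (`|s| * b + sigma * s ^+ 2))%:E); last exact: ltry.
under eq_integral do rewrite /= ger0_norm ?expR_ge0//.
apply: (@fatou_bound (fun n x => expR (s * (trunc n \o f) x))).
- by move=> n; apply: measurableT_comp => //; exact: measurable_funM.
- by move=> n x; exact: expR_ge0.
- move=> x; have H : s * trunc n (f x) @[n --> \oo] --> s * f x.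
    by apply: cvgM; [exact: cvg_cst|exact: cvg_trunc].
  by apply: (cvg_comp _ _ H); exact: continuous_expR.
move=> n; rewrite -EFin_expectation; last exact: (integrable_exp m (mF n) (Fb n)).
rewrite lee_fin (le_trans (sg n s))// ler_expR lerD2r.
by rewrite (le_trans (ler_norm _))// normrM ler_wpM2l// ger0_norm.
Qed.

End convergence_lemmas.

(** * Couplings and transport inequalities *)

Section smooth_norm.
Context {R : realType} {d : nat}.
Local Notation V := 'rV[R]_d.

(** The Euclidean norm is not differentiable at 0. *)
Definition smooth_norm (x : V) : R := Num.sqrt (1 + dot x x).


Lemma dot_ge0 (x : V) : 0 <= dot x x.
Proof. by rewrite -sqr_enorm sqr_ge0. Qed.

Lemma enorm_le_smooth (x : V) : enorm x <= smooth_norm x.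
Proof.
rewrite -[leLHS]ger0_norm ?enorm_ge0// -sqrtr_sqr sqr_enorm.
by rewrite ler_wsqrtr// lerDr.
Qed.

Lemma smooth_norm_gt0 (x : V) : 0 < smooth_norm x.
Proof. by rewrite sqrtr_gt0 ltr_pwDl// dot_ge0. Qed.

Lemma is_derive_coord (x u : V) i :
  is_derive x u (fun v : V => v 0 i : R) (u 0 i).
Proof.
have H : h^-1 *: (((fun v : V => v 0 i : R) \o shift x) (h *: u) - x 0 i)
    @[h --> (0 : R)^'] --> u 0 i.
  apply: cvg_near_cst; near=> h.
  have h0 : h != 0 by near: h; exact: nbhs_dnbhs_neq.
  by rewrite /= !mxE addrK /GRing.scale /= mulKf.
by split; [apply/cvg_ex; exists (u 0 i)|exact: cvg_lim H].
Unshelve. all: by end_near. Qed.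

Lemma differentiable_sqr_coord (x : V) i :
  differentiable (fun v : V => v 0 i ^+ 2 : R) x /\
  forall u, 'D_u (fun v : V => v 0 i ^+ 2 : R) x = 2 * (x 0 i * u 0 i).
Proof.
have dsq : is_derive (x 0 i) (1 : R) (fun t : R => t ^+ 2) (2 * x 0 i).
  by apply: is_derive_eq; rewrite /GRing.scale /=; ring.
have [dc Dc] := differentiable_compR (differentiable_coord x 0 i) dsq.
split=> // u; have := Dc u; rewrite /comp => ->.
by rewrite (@derive_val _ _ _ _ _ _ _ (is_derive_coord x u i)) mulrA.
Qed.

Lemma differentiable_dotxx (x : V) : differentiable (fun x : V => 1 + dot x x) x.
Proof.
apply: differentiableD => //.
rewrite (_ : (fun x : V => dot x x) = \sum_i (fun x : V => x 0 i ^+ 2)).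
  by apply: differentiable_sum => i; case: (differentiable_sqr_coord x i).
by apply/funext => v; rewrite fct_sumE /dot; apply: eq_bigr => i _; rewrite expr2.
Qed.

Lemma derive_dotxx (x u : V) : 'D_u (fun x : V => 1 + dot x x) x = 2 * dot x u.
Proof.
rewrite (_ : (fun x : V => 1 + dot x x) = cst 1 + \sum_i (fun x : V => x 0 i ^+ 2)).
  have ds i : derivable (fun x : V => x 0 i ^+ 2 : R) x u.
    by apply: diff_derivable; case: (differentiable_sqr_coord x i).
  rewrite deriveD ?derive_cst ?add0r//; last exact: derivable_sum.
  rewrite derive_sum => [|i]; last exact: ds.
  rewrite /dot mulr_sumr; apply: eq_bigr => i _.
  by have [_ ->] := differentiable_sqr_coord x i.
apply/funext => v; rewrite /GRing.add /= fct_sumE /dot; congr (_ + _).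
Qed.

Lemma differentiable_smooth_norm (x : V) : differentiable smooth_norm x /\
  forall u, `|'D_u smooth_norm x| <= enorm u.
Proof.
have p0 : 0 < 1 + dot x x by rewrite ltr_pwDl// dot_ge0.
have [df Df] := differentiable_compR (differentiable_dotxx x) (is_derive1_sqrt p0).
split=> // u; rewrite /smooth_norm.
have := Df u; rewrite /comp => ->.
rewrite derive_dotxx -/(smooth_norm x) invfM -mulrA [X in 2^-1 * X]mulrCA mulKf//.
rewrite normrM normfV (gtr0_norm (smooth_norm_gt0 x)) mulrC.
rewrite ler_pdivrMr ?smooth_norm_gt0//.
apply: (@le_trans _ _ (enorm u * enorm x)); last by rewrite ler_wpM2l ?enorm_ge0 ?enorm_le_smooth.
rewrite [leRHS]mulrC ler_norml lerNl cauchy_schwarz andbT.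
rewrite -[enorm u]enormN; apply: le_trans (cauchy_schwarz x (- u)).
by rewrite /dot -sumrN; apply: ler_sum => i _; rewrite mxE mulrN.
Qed.

Lemma trunc_smooth_norm n (x : V) : differentiable (trunc n \o smooth_norm) x /\
  forall u, `|'D_u (trunc n \o smooth_norm) x| <= enorm u.
Proof.
have [df Df] := differentiable_smooth_norm x.
have [dt Dt] := differentiable_compR df (is_derive_trunc n (smooth_norm x)).
split=> // u; rewrite Dt normrM -[leRHS]mul1r ler_pM//; exact: trunc'_le.
Qed.

Lemma measurable_smooth_norm : measurable_fun setT smooth_norm.
Proof. by apply: differentiable_measurable_rV => x; case: (differentiable_smooth_norm x). Qed.

Lemma lipschitz_of_derive (f : V -> R) K : (forall x, differentiable f x) ->
  (forall x u, `|'D_u f x| <= K * enorm u) ->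
  forall y z, f y - f z <= K * enorm (y - z).
Proof.
move=> df fK y z; pose v := y - z.
have dl t := is_derive_line (diff_derivable (df (z + t *: v)) (v := v)).
have [c _] := mvt ltr01 dl.
rewrite scale1r scale0r addr0 subr0 mulr1 (_ : z + v = y) => [->|].
  by rewrite (le_trans (ler_norm _)).
by rewrite /v addrC subrK.
Qed.

Lemma exp_moment_enorm (m : probability V R) (s : R) :
  (forall s : R, m.-integrable setT (EFin \o (fun x => expR (s * smooth_norm x)))) ->
  m.-integrable setT (EFin \o (fun x => expR (s * enorm x))).
Proof.
move=> H; apply: (integrable_dominated _ (H `|s|)).
  apply: measurableT_comp => //; apply: measurable_funM => //; exact: measurable_enorm.
move=> x; rewrite ger0_norm ?expR_ge0// ler_expR (le_trans (ler_norm _))// normrM.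
by rewrite ler_wpM2l// ger0_norm ?enorm_ge0// enorm_le_smooth.
Qed.

End smooth_norm.

Section transport.
Context {R : realType} {d : nat}.
Local Notation V := 'rV[R]_d.

Lemma coupling_fst (mu nu : probability V R) (g : probability (V * V)%type R) :
  coupling mu nu g -> forall A, measurable A -> g (fst @^-1` A) = mu A.
Proof.
move=> [h _] A mA; rewrite -h//; congr (g _).
by apply/seteqP; split => [[x y] /= ?|[x y] /= [] //].
Qed.

Lemma coupling_snd (mu nu : probability V R) (g : probability (V * V)%type R) :
  coupling mu nu g -> forall A, measurable A -> g (snd @^-1` A) = nu A.
Proof.
move=> [_ h] A mA; rewrite -h//; congr (g _).
by apply/seteqP; split => [[x y] /= ?|[x y] /= [] //].
Qed.

(** The slack e replaces the existence of an optimal coupling. *)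
Lemma W2_coupling (mu nu : probability V R) (k e : R) : 0 < e ->
  (W2 mu nu ^+ 2 <= k%:E)%E ->
  exists2 g : probability (V * V)%type R, coupling mu nu g &
    (\int[g]_z (enorm (z.1 - z.2) ^+ 2)%:E <= (k + e)%:E)%E.
Proof.
move=> e0; rewrite /W2 sqr_sqrte; last first.
  by apply/ereal_infP => _ [g _ <-]; apply: integral_ge0 => z _; rewrite lee_fin sqr_ge0.
move=> H; have : (ereal_inf [set \int[g]_z (enorm (z.1 - z.2)%R ^+ 2)%:E |
    g in @coupling R d mu nu] < (k + e)%:E)%E.
  by apply: le_lt_trans H _; rewrite lte_fin ltrDl.
by move/ereal_inf_lt => [_ [g cg <-] /ltW lt]; exists g.
Qed.

Section ti.
Variables (Y : set V) (nu : probability V R) (tau : R).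
Hypotheses (oY : open Y) (nuY : nu Y = 1%E) (tau0 : 0 < tau) (ti : TI Y nu tau).

(** Bobkov-Goetze duality: test the transport inequality on the exponential
   tilts of nu by F. *)
Lemma ti_subgaussian (F : V -> R) (M s : R) :
  (forall x, differentiable F x) -> (forall x, `|F x| <= M) ->
  (forall x u, `|'D_u F x| <= enorm u) ->
  mgf nu F s <= expR (s * (\int[nu]_x F x) + tau / 2 * s ^+ 2).
Proof.
move=> dF FM FL.
have mF := differentiable_measurable_rV dF.
have Z0 := mgf_gt0 nu mF FM s.
pose u := log_mgf nu F s.
have expu : expR u = mgf nu F s by rewrite /u /log_mgf lnK// posrE.
rewrite -expu ler_expR.
pose W x := s * F x - u.
have mW : measurable_fun setT W.
  by apply: measurable_funB => //; exact: measurable_funM.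
have WE : expR \o W = fun x => expR (- u) * expR (s * F x).
  by apply/funext => x; rewrite /= -expRD addrC.
have iE := integrable_exp nu mF FM s.
have [p pW] : exists p : probability V R, has_density p nu (expR \o W).
  apply: exists_density => [|x|]; first exact: measurableT_comp.
    exact: expR_ge0.
  rewrite -EFin_expectation; last by rewrite WE; exact: integrable_scale.
  by rewrite WE RintegralZl// -/(mgf nu F s) -expu -expRD addNr expR0.
have pY := density_full_set oY nuY pW.
have iFp : p.-integrable setT (EFin \o F) by exact: integrable_bounded FM.
have iFn : nu.-integrable setT (EFin \o F) by exact: integrable_bounded FM.
have KLE : KL p nu = (s * (\int[p]_x F x) - u)%:E.
  rewrite (KL_density mW pW) -EFin_expectation; last first.
    by apply: integrable_sub; [exact: integrable_scale|exact: integrable_cst_prob].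
  rewrite RintegralB//; [|exact: integrable_scale|exact: integrable_cst_prob].
  by rewrite expectation_cst RintegralZl.
have := ti pY; rewrite KLE -EFinM => tip.
apply: (@ler_small_error _ _ _ (2 * tau)^-1 1) => // e /andP[e0 _].
have [g cg gle] := W2_coupling e0 tip.
have E1 : \int[p]_x F x = \int[g]_z F z.1.
  exact: (expectation_image measurable_fst (coupling_fst cg) mF).
have E2 : \int[nu]_x F x = \int[g]_z F z.2.
  exact: (expectation_image measurable_snd (coupling_snd cg) mF).
have iFg1 : g.-integrable setT (EFin \o (fun z => F z.1)).
  exact: (integrable_image measurable_fst (coupling_fst cg) mF).1.
have iFg2 : g.-integrable setT (EFin \o (fun z => F z.2)).
  exact: (integrable_image measurable_snd (coupling_snd cg) mF).1.
have iD : g.-integrable setT (EFin \o (fun z => enorm (z.1 - z.2) ^+ 2)).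
  apply/integrableP; split; first by apply/measurable_EFinP; exact: measurable_sqr_enorm_sub.
  apply: le_lt_trans (ltry (2 * tau * (s * \int[p]_x F x - u) + e)).
  apply: le_trans gle; apply: ge0_le_integral_nomeas => z _; first exact: abse_ge0.
  by rewrite gee0_abs// lee_fin sqr_ge0.
have H : \int[g]_z (s * (F z.1 - F z.2)) <=
    \int[g]_z ((2 * tau)^-1 * enorm (z.1 - z.2) ^+ 2 + tau / 2 * s ^+ 2).
  apply: le_Rintegral => //.
  - by apply: integrable_scale; exact: integrable_sub.
  - by apply: integrable_add; [exact: integrable_scale|exact: integrable_cst_prob].
  move=> z _; set r := enorm _.
  have r0 : 0 <= r by exact: enorm_ge0.
  have FL' x w : `|'D_w F x| <= 1 * enorm w by rewrite mul1r.
  have Fr : `|F z.1 - F z.2| <= r.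
    rewrite ler_norml lerNl opprB -[r]mul1r; apply/andP; split.
      by rewrite /r -enormN opprB; exact: lipschitz_of_derive.
    exact: lipschitz_of_derive.
  apply: (@le_trans _ _ (`|s| * r)).
    by rewrite (le_trans (ler_norm _))// normrM ler_wpM2l.
  (* Young's inequality for |s| r *)
  rewrite -subr_ge0 -[s ^+ 2]real_normK ?num_real//.
  have -> : (2 * tau)^-1 * r ^+ 2 + tau / 2 * `|s| ^+ 2 - `|s| * r =
    (2 * tau)^-1 * (r - tau * `|s|) ^+ 2 by field; rewrite gt_eqF.
  by rewrite mulr_ge0 ?sqr_ge0// invr_ge0 mulr_ge0// ltW.
rewrite RintegralZl// in H; last exact: integrable_sub.
rewrite RintegralB// -E1 -E2 RintegralD// in H; [|exact: integrable_scale|exact: integrable_cst_prob].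
rewrite (RintegralZl (2 * tau)^-1 measurableT iD) expectation_cst in H.
rewrite -EFin_expectation// lee_fin in gle.
have h2 : (2 * tau)^-1 * \int[g]_z (enorm (z.1 - z.2) ^+ 2) <=
    s * \int[p]_x F x - u + (2 * tau)^-1 * e.
  rewrite -[leRHS](@mulKf _ (2 * tau)); last by rewrite gt_eqF// mulr_gt0.
  rewrite ler_pM2l ?invr_gt0 ?mulr_gt0//; apply: (le_trans gle).
  by rewrite le_eqVlt; apply/orP; left; apply/eqP; field; rewrite gt_eqF.
lra.
Qed.

Lemma ti_exp_moment (s : R) :
  nu.-integrable setT (EFin \o (fun x => expR (s * enorm x))).
Proof.
apply: exp_moment_enorm => {}s.
apply: (subgaussian_exp_moment (sigma := tau / 2)).
- exact: measurable_smooth_norm.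
- by move=> x; exact/ltW/smooth_norm_gt0.
- move=> n t; apply: (@ti_subgaussian _ n.+1%:R).
  + by move=> x; case: (trunc_smooth_norm n x).
  + by move=> x; exact: trunc_bounded.
  + by move=> x u; case: (trunc_smooth_norm n x).
Qed.

End ti.
End transport.

(** * Consequences of the logarithmic Sobolev inequality *)

Section entropy_ge0.
Context {disp : measure_display} {T : measurableType disp} {R : realType}.

Lemma expectation_exp_opp (p q : probability T R) (w : T -> R) :
  measurable_fun setT w -> has_density p q (expR \o w) ->
  p.-integrable setT (EFin \o (fun x => expR (- w x))) /\
  \int[p]_x expR (- w x) = 1.
Proof.
move=> mw pw; have e0 x : 0 <= (expR \o w) x by exact: expR_ge0.
have mE : measurable_fun setT (fun x => expR (- w x)).
  by apply: measurableT_comp => //; exact: measurableT_comp.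
have E x : expR (- w x) * (expR \o w) x = 1 by rewrite /= -expRD addNr expR0.
split.
  apply/(integrable_density e0 pw mE).
  rewrite (_ : (fun x => _) = EFin \o cst 1); first exact: integrable_cst_prob.
  by apply/funext => x; rewrite E.
rewrite (expectation_density e0 pw mE).
under eq_Rintegral do rewrite E.
exact: expectation_cst.
Qed.

(** Integrate w >= 1 - exp(- w), whose right side has mean 0. *)
Lemma KL_density_ge0 (p q : probability T R) (w : T -> R) :
  measurable_fun setT w -> has_density p q (expR \o w) -> (0 <= KL p q)%E.
Proof.
move=> mw pw; have [ie E1] := expectation_exp_opp mw pw.
rewrite (KL_density mw pw).
have H : \int[p]_x (1 - expR (- w x)) = 0.
  rewrite RintegralB//; last exact: integrable_cst_prob.
  by rewrite expectation_cst E1 subrr.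
have HE : (\int[p]_x (1 - expR (- w x))%:E = 0)%E.
  rewrite -EFin_expectation ?H//; apply: integrable_sub => //.
  exact: integrable_cst_prob.
rewrite -HE.
apply: le_integral_gen; [apply/measurable_EFinP|exact/measurable_EFinP|].
  apply: measurable_funB => //; apply: measurableT_comp => //.
  exact: measurableT_comp.
by move=> x; rewrite lee_fin; have := expR_ge1Dx (- w x); lra.
Qed.

End entropy_ge0.

Section lsi_consequences.
Context {R : realType} {d : nat}.
Local Notation V := 'rV[R]_d.
Variables (X : set V) (rho : probability V R) (C : R).
Hypotheses (oX : open X) (rhoX : rho X = 1%E) (lsi : LSI X rho C).

(** A negative constant would force the Fisher information of every positive
   density to vanish, but a tilt by the arctangent of a coordinate has nowhere
   vanishing logarithmic gradient. *)
Lemma lsi_constant_ge0 : (0 < d)%N -> 0 <= C.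
Proof.
move=> d0; pose i := Ordinal d0; rewrite leNgt; apply/negP => C0.
pose F (x : V) : R := atan (x 0 i).
have dF x : differentiable F x /\ forall u, 'D_u F x = (1 + x 0 i ^+ 2)^-1 * u 0 i.
  have [df Df] := differentiable_compR (differentiable_coord x 0 i) (is_derive1_atan (x 0 i)).
  split=> // u; have := Df u; rewrite /comp => ->.
  by rewrite (@derive_val _ _ _ _ _ _ _ (is_derive_coord x u i)).
have FM x : `|F x| <= pi / 2.
  by rewrite ler_norml -mulNr; apply/andP; split;
    [rewrite mulNr; exact/ltW/atan_gtNpi2|exact/ltW/atan_ltpi2].
have mF : measurable_fun setT F by apply: differentiable_measurable_rV => x; case: (dF x).
pose W x := F x - log_mgf rho F 1.
have mW : measurable_fun setT W by exact: measurable_funB.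
have Z0 := mgf_gt0 rho mF FM 1.
have WE : expR \o W = fun x => expR (- log_mgf rho F 1) * expR (1 * F x).
  by apply/funext => x; rewrite /= -expRD addrC mul1r.
have [p pW] : exists p : probability V R, has_density p rho (expR \o W).
  apply: exists_density => [|x|]; first exact: measurableT_comp.
    exact: expR_ge0.
  rewrite -EFin_expectation; last by rewrite WE; apply: integrable_scale; exact: (integrable_exp rho mF FM).
  rewrite WE RintegralZl//; last exact: (integrable_exp rho mF FM).
  by rewrite -/(mgf rho F 1) expRN /log_mgf lnK ?posrE// mulVf// gt_eqF.
have pX := density_full_set oX rhoX pW.
have mX := open_measurable_rV oX.
have pXC : p (~` X) = 0%E by rewrite probability_setC// pX subee.
have dW x : differentiable W x by apply: differentiableB => //; case: (dF x).
have lnW : @ln R \o (expR \o W) = W by apply/funext => x; exact: expRK.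
have KLle := lsi pX pW (fun x _ => conj (expR_ge0 (W x))
  (differentiable_compR (dW x) (is_derive_expR (W x))).1).
have KL0 := KL_density_ge0 mW pW.
(* exp r is the squared i-th component of the gradient of F *)
pose r (x : V) : R := ln ((1 + x 0 i ^+ 2)^-1 ^+ 2).
have d1 (x : V) : 0 < 1 + x 0 i ^+ 2 by rewrite ltr_pwDl// sqr_ge0.
have mr : measurable_fun setT r.
  apply: (measurableT_comp (@measurable_ln R)); apply: measurable_funX.
  rewrite (_ : (fun x => _) = (fun t : R => (1 + t ^+ 2)^-1) \o (fun x : V => x 0 i))//.
  apply: measurableT_comp; last exact: measurable_coord.
  apply: continuous_measurable_fun => t; apply: cvgV.
    by rewrite gt_eqF// ltr_pwDl// sqr_ge0.
  by apply: cvgD; [exact: cvg_cst|exact: exprn_continuous].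
have er x : expR (r x) = (1 + x 0 i ^+ 2)^-1 ^+ 2.
  by rewrite /r lnK// posrE exprn_gt0// invr_gt0.
have I0 : (0 < \int[p]_(x in X) (enorm (grad (@ln R \o (expR \o W)) x) ^+ 2)%:E)%E.
  rewrite lnW; apply: (lt_le_trans (expectation_exp_gt0 p mr)).
  have mE : measurable_fun setT (fun x => (expR (r x))%:E).
    by apply/measurable_EFinP; exact: measurableT_comp.
  have -> : (\int[p]_x (expR (r x))%:E = \int[p]_(x in X) (expR (r x))%:E)%E.
    have := @ge0_negligible_integral _ _ _ p setT (~` X) (fun x => (expR (r x))%:E)
      (measurableC mX) measurableT mE (fun x _ => expR_ge0 (r x)) pXC.
    by rewrite setTD setCK.
  apply: ge0_le_integral_nomeas => x _.
    by rewrite lee_fin expR_ge0.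
  rewrite lee_fin er sqr_enorm /dot (bigD1 i)//= -expr2 -[leLHS]addr0.
  apply: lerD; last by apply: sumr_ge0 => j _; rewrite -expr2 sqr_ge0.
  rewrite mxE /W deriveB; [|by apply: diff_derivable; case: (dF x)|exact: derivable_cst].
  by rewrite derive_cst subr0 (dF x).2 /basis mxE !eqxx mulr1.
have := le_trans KL0 KLle; rewrite leNgt => /negP; apply.
rewrite -lteN2 oppe0 -mulNe; apply: mule_gt0 => //.
by rewrite -EFinN lte_fin oppr_gt0 pmulr_llt0.
Qed.

Lemma lsi_exp_moment (s : R) : 0 <= C ->
  rho.-integrable setT (EFin \o (fun x => expR (s * enorm x))).
Proof.
move=> C0; apply: exp_moment_enorm => {}s.
apply: (subgaussian_exp_moment (sigma := C / 2)).
- exact: measurable_smooth_norm.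
- by move=> x; exact/ltW/smooth_norm_gt0.
- move=> n t.
  have := @lsi_herbst _ _ X rho C oX rhoX C0 lsi (trunc n \o smooth_norm) n.+1%:R 1 t.
  rewrite expr1n mulr1; apply => //.
  + by move=> x; case: (trunc_smooth_norm n x).
  + by move=> x; exact: trunc_bounded.
  + move=> x u; rewrite mul1r (le_trans (ler_norm _))//.
    by case: (trunc_smooth_norm n x).
Qed.

(** The bounded case, applied to smooth truncations of f. *)
Lemma lsi_variance (q : probability V R) (W f : V -> R) (K G : R) :
  0 <= C -> 0 <= K -> 0 <= G ->
  has_density q rho (expR \o W) -> (forall x, differentiable W x) ->
  (forall x u, `|'D_u W x| <= K * enorm u) ->
  (forall x, differentiable f x) -> (forall x u, `|'D_u f x| <= G * enorm u) ->
  q.-integrable setT (EFin \o f) ->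
  q.-integrable setT (EFin \o (fun x => f x ^+ 2)) ->
  \int[q]_x (f x ^+ 2) - (\int[q]_x f x) ^+ 2 <=
    2 * (C * G ^+ 2) * (1 + C * K ^+ 2).
Proof.
move=> C0 K0 G0 qW dW WK df fG fi f2i.
have CG0 : 0 <= C * G ^+ 2 by rewrite mulr_ge0// sqr_ge0.
have mf := differentiable_measurable_rV df.
apply: (@ler_small_error _ _ _ (2 * (1 + C * K ^+ 2)) 1) => // e /andP[e0 _].
have -> : 2 * (C * G ^+ 2) * (1 + C * K ^+ 2) + 2 * (1 + C * K ^+ 2) * e =
  2 * (C * G ^+ 2 + e) * (1 + C * K ^+ 2) by ring.
have dt n x : differentiable (trunc n \o f) x /\
    forall u, 'D_u (trunc n \o f) x = trunc' n (f x) * 'D_u f x.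
  exact: differentiable_compR (df x) (is_derive_trunc n (f x)).
have mt n : measurable_fun setT (trunc n \o f).
  by apply: differentiable_measurable_rV => x; case: (dt n x).
have ft x : trunc n (f x) @[n --> \oo] --> f x by exact: cvg_trunc.
have c1 : \int[q]_x trunc n (f x) @[n --> \oo] --> \int[q]_x f x.
  apply: (@expectation_dominated_cvg _ _ _ q (fun n => trunc n \o f) f (fun x => `|f x|)) => //.
  - exact: integrable_norm.
  - by move=> n x; exact: trunc_le.
have c2 : \int[q]_x (trunc n (f x) ^+ 2) @[n --> \oo] --> \int[q]_x (f x ^+ 2).
  apply: (@expectation_dominated_cvg _ _ _ q (fun n x => trunc n (f x) ^+ 2)
    (fun x => f x ^+ 2) (fun x => f x ^+ 2)) => //.
  - by move=> n; apply: measurable_funX; exact: mt.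
  - exact: measurable_funX.
  - by move=> x; rewrite expr2; under eq_fun do rewrite expr2; exact: cvgM.
  - move=> n x; rewrite ger0_norm ?sqr_ge0// -[leLHS]real_normK ?num_real//.
    by rewrite -[leRHS]real_normK ?num_real// ler_sqr ?nnegrE// trunc_le.
have c3 : \int[q]_x (trunc n (f x) ^+ 2) - (\int[q]_x trunc n (f x)) ^+ 2
    @[n --> \oo] --> \int[q]_x (f x ^+ 2) - (\int[q]_x f x) ^+ 2.
  apply: cvgB => //; under eq_fun do rewrite expr2.
  by rewrite expr2; exact: cvgM.
apply: (cvgr_to_le c3); apply: nearW => n.
apply: (lsi_variance_bounded oX rhoX C0 lsi (F := trunc n \o f) (M := n.+1%:R) _ G0 _ _ _ _ _ K0 qW dW WK) => //.
- by move=> x; case: (dt n x).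
- by move=> x; exact: trunc_bounded.
- move=> x u; rewrite (dt n x).2 normrM -[leRHS]mul1r ler_pM//; exact: trunc'_le.
- by rewrite ltr_wpDl.
- by rewrite lerDl ltW.
Qed.

End lsi_consequences.

(** * One Sinkhorn step *)

Section integral_extra.
Context {disp : measure_display} {T : measurableType disp} {R : realType}.
Variable m : probability T R.

Lemma le_integral_shift (u v S : T -> R) :
  measurable_fun setT u -> measurable_fun setT v ->
  (forall x, 0 <= u x) ->
  m.-integrable setT (EFin \o S) -> (forall x, v x <= u x + S x) ->
  (\int[m]_x (v x)%:E <= \int[m]_x (u x)%:E + (\int[m]_x S x)%:E)%E.
Proof.
move=> mu mv u0 iS vuS.
have [uoo|uoo] := eqVneq (\int[m]_x (u x)%:E)%E +oo%E.
  by rewrite uoo addye// leey.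
have iu : m.-integrable setT (EFin \o u).
  apply/integrableP; split; first exact/measurable_EFinP.
  by under eq_integral do rewrite /= ger0_norm//; rewrite ltey.
have mS : measurable_fun setT S by apply/measurable_EFinP; exact: measurable_int iS.
rewrite -(EFin_expectation iu) -EFinD -RintegralD// EFin_expectation; last exact: integrable_add.
apply: le_integral_gen; [exact/measurable_EFinP| |].
  by apply/measurable_EFinP; exact: measurable_funD.
by move=> x; rewrite lee_fin.
Qed.

Lemma expectation_posneg (u : T -> R) : measurable_fun setT u ->
  m.-integrable setT (EFin \o u) ->
  [/\ m.-integrable setT (EFin \o (fun x => Num.max (u x) 0)),
      m.-integrable setT (EFin \o (fun x => Num.max (- u x) 0)) &
      \int[m]_x u x = \int[m]_x Num.max (u x) 0 - \int[m]_x Num.max (- u x) 0].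
Proof.
move=> mu iu; have inu := integrable_norm iu.
have ip : m.-integrable setT (EFin \o (fun x => Num.max (u x) 0)).
  apply: (integrable_dominated _ inu) => [|x /=]; first exact: measurable_maxr.
  by rewrite ger0_norm ?le_max ?lexx ?orbT// ge_max ler_norm normr_ge0.
have im : m.-integrable setT (EFin \o (fun x => Num.max (- u x) 0)).
  apply: (integrable_dominated _ inu) => [|x /=].
    by apply: measurable_maxr => //; exact: measurableT_comp.
  by rewrite ger0_norm ?le_max ?lexx ?orbT// ge_max normr_ge0 -normrN ler_norm.
split=> //; rewrite -RintegralB//; apply: eq_Rintegral => x _.
by case: (leP (u x) 0) => h; rewrite /Num.max; case: ltP; case: ltP; lra.
Qed.

Lemma integral_restrict_indic (D : set T) (u : T -> R) :
  (\int[m]_(x in D) (u x)%:E = \int[m]_x ((\1_D x)%:E * (u x)%:E))%E.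
Proof.
rewrite integral_mkcond; apply: eq_integral => x _.
by rewrite patchE indicE; case: ifPn => _; rewrite ?mul1e ?mul0e.
Qed.

End integral_extra.

Section step.
Context {R : realType} {d : nat}.
Local Notation V := 'rV[R]_d.
Variables (rho nu : probability V R) (c : V -> V -> R) (eps : R).
Hypotheses (eps0 : 0 < eps)
  (mc : measurable_fun setT (fun z : V * V => c z.1 z.2)).
Local Notation G := (gibbs c eps).

Lemma gibbs_ge0 phi psi z : 0 <= G phi psi z.
Proof. exact: expR_ge0. Qed.

Lemma gibbsE phi psi z :
  G phi psi z = expR (- (c z.1 z.2 + phi z.1 + psi z.2) / eps).
Proof. by []. Qed.

Lemma measurable_gibbs_exponent (phi psi : V -> R) :
  measurable_fun setT phi -> measurable_fun setT psi ->
  measurable_fun setT (fun z : V * V => - (c z.1 z.2 + phi z.1 + psi z.2) / eps).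
Proof.
move=> mphi mpsi; apply: measurable_funM => //; apply: measurableT_comp => //.
apply: measurable_funD; last exact: measurableT_comp.
by apply: measurable_funD => //; exact: measurableT_comp.
Qed.

Lemma measurable_gibbs (phi psi : V -> R) :
  measurable_fun setT phi -> measurable_fun setT psi ->
  measurable_fun setT (G phi psi).
Proof. by move=> mphi mpsi; apply: measurableT_comp => //; exact: measurable_gibbs_exponent. Qed.

Lemma tonelli_snd (phi psi : V -> R) (u : V -> \bar R) :
  measurable_fun setT phi -> measurable_fun setT psi ->
  measurable_fun setT u -> (forall y, 0 <= u y)%E ->
  (forall y, \int[rho]_x (G phi psi (x, y))%:E = 1)%E ->
  (\int[(rho \x nu)%E]_z (u z.2 * (G phi psi z)%:E) = \int[nu]_y u y)%E.
Proof.
move=> mphi mpsi mu u0 h1.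
have mg := measurable_gibbs mphi mpsi.
have mgE : measurable_fun setT (EFin \o G phi psi) by exact/measurable_EFinP.
have mf : measurable_fun setT (fun z : V * V => (u z.2 * (G phi psi z)%:E)%E).
  by apply: emeasurable_funM => //; exact: measurableT_comp.
have f0 z : (0 <= u z.2 * (G phi psi z)%:E)%E.
  by rewrite mule_ge0// lee_fin gibbs_ge0.
rewrite fubini_tonelli2// /fubini_G; apply: eq_integral => y _ /=.
rewrite ge0_integralZl//; last first.
- by move=> x _; rewrite lee_fin gibbs_ge0.
- apply: (measurableT_comp mgE); exact: pair2_measurable.
by rewrite h1 mule1.
Qed.

Lemma tonelli_fst (phi psi : V -> R) (u : V -> \bar R) :
  measurable_fun setT phi -> measurable_fun setT psi ->
  measurable_fun setT u -> (forall y, 0 <= u y)%E ->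
  (forall x, \int[nu]_y (G phi psi (x, y))%:E = 1)%E ->
  (\int[(rho \x nu)%E]_z (u z.1 * (G phi psi z)%:E) = \int[rho]_x u x)%E.
Proof.
move=> mphi mpsi mu u0 h1.
have mg := measurable_gibbs mphi mpsi.
have mgE : measurable_fun setT (EFin \o G phi psi) by exact/measurable_EFinP.
have mf : measurable_fun setT (fun z : V * V => (u z.1 * (G phi psi z)%:E)%E).
  by apply: emeasurable_funM => //; exact: measurableT_comp.
have f0 z : (0 <= u z.1 * (G phi psi z)%:E)%E.
  by rewrite mule_ge0// lee_fin gibbs_ge0.
rewrite fubini_tonelli1// /fubini_F; apply: eq_integral => x _ /=.
rewrite ge0_integralZl//; last first.
- by move=> y _; rewrite lee_fin gibbs_ge0.
- apply: (measurableT_comp mgE); exact: pair1_measurable.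
by rewrite h1 mule1.
Qed.

Lemma gibbs_density_ratio (p q : probability (V * V)%type R) (phi psi phi' psi' : V -> R) :
  measurable_fun setT phi -> measurable_fun setT psi ->
  measurable_fun setT phi' -> measurable_fun setT psi' ->
  has_density p (rho \x nu)%E (G phi psi) ->
  has_density q (rho \x nu)%E (G phi' psi') ->
  has_density p q (expR \o (fun z : V * V =>
    (phi' z.1 - phi z.1) / eps + (psi' z.2 - psi z.2) / eps)).
Proof.
move=> mphi mpsi mphi' mpsi' pG qG.
have := has_density_div (measurable_gibbs_exponent mphi mpsi)
  (measurable_gibbs_exponent mphi' mpsi') pG qG.
congr has_density; apply/funext => z /=; congr expR; ring.
Qed.

Section one_step.
Variables (phi psi phi' psi' phis psis : V -> R).
Hypotheses (mphi : measurable_fun setT phi) (mpsi : measurable_fun setT psi)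
  (mphi' : measurable_fun setT phi') (mpsi' : measurable_fun setT psi')
  (mphis : measurable_fun setT phis) (mpsis : measurable_fun setT psis).
Hypotheses
  (nrm : forall y, (\int[rho]_x (G phi psi (x, y))%:E = 1)%E)
  (nrm_mid : forall x, (\int[nu]_y (G phi' psi (x, y))%:E = 1)%E)
  (nrm' : forall y, (\int[rho]_x (G phi' psi' (x, y))%:E = 1)%E).
Variables (pi Q Q' : probability (V * V)%type R).
Hypotheses (cpi : coupling rho nu pi)
  (piG : has_density pi (rho \x nu)%E (G phis psis))
  (QG : has_density Q (rho \x nu)%E (G phi psi))
  (Q'G : has_density Q' (rho \x nu)%E (G phi' psi')).
Hypotheses (ia : rho.-integrable setT (EFin \o (fun x => (phi' x - phis x) / eps)))
  (ib : nu.-integrable setT (EFin \o (fun y => (psi' y - psis y) / eps))).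

Let f x := (phi x - phi' x) / eps.
Let g y := (psi' y - psi y) / eps.
Let a x := (phi' x - phis x) / eps.
Let b y := (psi' y - psis y) / eps.

Let measurable_quot (u v : V -> R) : measurable_fun setT u ->
  measurable_fun setT v -> measurable_fun setT (fun x => (u x - v x) / eps).
Proof. by move=> mu mv; apply: measurable_funM => //; exact: measurable_funB. Qed.

Let mf : measurable_fun setT f. Proof. exact: measurable_quot. Qed.
Let mg : measurable_fun setT g. Proof. exact: measurable_quot. Qed.
Let ma : measurable_fun setT a. Proof. exact: measurable_quot. Qed.
Let mb : measurable_fun setT b. Proof. exact: measurable_quot. Qed.

Let mexp (u : V -> R) : measurable_fun setT u ->
  measurable_fun setT (fun x => (expR (u x))%:E).
Proof. by move=> mu; apply/measurable_EFinP; exact: measurableT_comp. Qed.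

Let mass_one (p q : V -> R) : measurable_fun setT p -> measurable_fun setT q ->
  (forall y, \int[rho]_x (G p q (x, y))%:E = 1)%E ->
  (\int[(rho \x nu)%E]_z (G p q z)%:E = 1)%E.
Proof.
move=> mp mq h; have := tonelli_snd mp mq (measurable_cst (1%E : \bar R)) (fun=> lee01) h.
under eq_integral do rewrite mul1e.
by move=> ->; rewrite integral_cst//= probability_setT mule1.
Qed.

Let int_expg : (\int[nu]_y (expR (g y))%:E = 1)%E.
Proof.
rewrite -(tonelli_snd mphi' mpsi' (mexp mg) (fun y => expR_ge0 _) nrm').
have := tonelli_fst mphi' mpsi (measurable_cst (1%E : \bar R)) (fun=> lee01) nrm_mid.
rewrite integral_cst//= probability_setT mule1 => <-.
apply: eq_integral => z _; rewrite mul1e -EFinM; congr EFin.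
by rewrite !gibbsE -expRD /g; congr expR; ring.
Qed.

Let int_expNf : (\int[rho]_x (expR (- f x))%:E = 1)%E.
Proof.
rewrite -(tonelli_fst mphi' mpsi (mexp (measurableT_comp (@oppr_measurable _ _) mf)) (fun y => expR_ge0 _) nrm_mid).
rewrite -(mass_one mphi mpsi nrm).
apply: eq_integral => z _; rewrite -EFinM; congr EFin.
by rewrite !gibbsE -expRD /f; congr expR => /=; ring.
Qed.

Let mfst (u : V -> R) : measurable_fun setT u ->
  measurable_fun setT (fun z : V * V => u z.1).
Proof. by move=> mu; exact: measurableT_comp. Qed.

Let msnd (u : V -> R) : measurable_fun setT u ->
  measurable_fun setT (fun z : V * V => u z.2).
Proof. by move=> mu; exact: measurableT_comp. Qed.

Let prob_integrable (m : probability V R) (u : V -> R) : measurable_fun setT u ->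
  (\int[m]_x (expR (u x))%:E = 1)%E ->
  m.-integrable setT (EFin \o (expR \o u)) /\ \int[m]_x expR (u x) = 1.
Proof.
move=> mu h1; split; last by rewrite /Rintegral h1.
apply/integrableP; split; first exact: mexp.
by under eq_integral do rewrite /= ger0_norm ?expR_ge0//; rewrite h1 ltry.
Qed.

Let ifst (u : V -> R) : measurable_fun setT u ->
  rho.-integrable setT (EFin \o u) ->
  pi.-integrable setT (EFin \o (fun z => u z.1)) /\
  \int[pi]_z u z.1 = \int[rho]_x u x.
Proof.
move=> mu iu; split; last first.
  by rewrite (expectation_image measurable_fst (coupling_fst cpi) mu).
exact: (integrable_image measurable_fst (coupling_fst cpi) mu).1.
Qed.

Let isnd (u : V -> R) : measurable_fun setT u ->
  nu.-integrable setT (EFin \o u) ->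
  pi.-integrable setT (EFin \o (fun z => u z.2)) /\
  \int[pi]_z u z.2 = \int[nu]_x u x.
Proof.
move=> mu iu; split; last first.
  by rewrite (expectation_image measurable_snd (coupling_snd cpi) mu).
exact: (integrable_image measurable_snd (coupling_snd cpi) mu).1.
Qed.

(** The log-density ratio of pi to Q' is a(x) + b(y), so that only the marginals of
   pi matter. *)
Lemma KL_next : KL pi Q' = (\int[rho]_x a x + \int[nu]_y b y)%:E.
Proof.
have [ia1 Ea] := ifst ma ia; have [ib1 Eb] := isnd mb ib.
rewrite (KL_density _ (gibbs_density_ratio mphis mpsis mphi' mpsi' piG Q'G)).
  rewrite -EFin_expectation; last exact: integrable_add.
  by rewrite RintegralD// Ea Eb.
by apply: measurable_funD; [exact: (mfst ma)|exact: (msnd mb)].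
Qed.

(** The log-density ratio of pi to Q is (a + f)(x) + (b - g)(y), and
   - g >= 1 - exp g, where exp g has nu-mean 1. The function u is f itself when f is
   integrable; in general it can be 1 - exp(- f). *)
Lemma KL_curr_ge (u : V -> R) : measurable_fun setT u ->
  rho.-integrable setT (EFin \o u) -> (forall x, u x <= f x) ->
  (KL pi Q' + (\int[rho]_x u x)%:E <= KL pi Q)%E.
Proof.
move=> mu iu uf.
have [ia1 Ea] := ifst ma ia; have [ib1 Eb] := isnd mb ib.
have [iu1 Eu] := ifst mu iu.
have [ieg Eeg] := prob_integrable mg int_expg.
have [ieg1 Eeg1] := isnd (measurableT_comp (@measurable_expR R) mg) ieg.
rewrite [in leRHS](KL_density _ (gibbs_density_ratio mphis mpsis mphi mpsi piG QG)); last first.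
  by apply: measurable_funD; [exact: (mfst (measurable_quot mphi mphis))|exact: (msnd (measurable_quot mpsi mpsis))].
have iab : pi.-integrable setT (EFin \o (fun z => a z.1 + b z.2)).
  exact: integrable_add.
have iabu : pi.-integrable setT (EFin \o (fun z => a z.1 + b z.2 + u z.1)).
  exact: integrable_add.
have ie1 : pi.-integrable setT (EFin \o (fun z => 1 - (expR \o g) z.2)).
  by apply: integrable_sub => //; exact: integrable_cst_prob.
have -> : (KL pi Q' + (\int[rho]_x u x)%:E =
   \int[pi]_z (a z.1 + b z.2 + u z.1 + (1 - expR (g z.2)))%:E)%E.
  rewrite KL_next -EFinD -EFin_expectation; last exact: integrable_add.
  congr EFin; rewrite RintegralD// RintegralD// RintegralD// RintegralB//; last exact: integrable_cst_prob.
  by rewrite expectation_cst Ea Eb Eu Eeg1 Eeg subrr addr0.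
apply: le_integral_gen.
- apply/measurable_EFinP; apply: measurable_funD.
    apply: measurable_funD; last exact: (mfst mu).
    by apply: measurable_funD; [exact: (mfst ma)|exact: (msnd mb)].
  apply: measurable_funB => //; apply: (@msnd (expR \o g)).
  exact: measurableT_comp.
- apply/measurable_EFinP; apply: measurable_funD.
    exact: (mfst (measurable_quot mphi mphis)).
  exact: (msnd (measurable_quot mpsi mpsis)).
- move=> z; rewrite lee_fin; have := uf z.1; have := expR_ge1Dx (g z.2).
  have -> : (phi z.1 - phis z.1) / eps = a z.1 + f z.1 by rewrite /a /f; ring.
  have -> : (psi z.2 - psis z.2) / eps = b z.2 - g z.2 by rewrite /b /g; ring.
  lra.
Qed.

(** The minorant 1 - exp(- f) of f has rho-mean 0. *)
Lemma KL_nonincreasing : (KL pi Q' <= KL pi Q)%E.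
Proof.
have [ief Eef] := prob_integrable (measurableT_comp (@oppr_measurable _ _) mf) int_expNf.
have := @KL_curr_ge (fun x => 1 - expR (- f x)).
rewrite RintegralB//; last exact: integrable_cst_prob.
rewrite expectation_cst Eef subrr adde0; apply.
- apply: measurable_funB => //; apply: measurableT_comp => //.
  exact: measurableT_comp.
- by apply: integrable_sub => //; exact: integrable_cst_prob.
- by move=> x; have := expR_ge1Dx (- f x); lra.
Qed.

Section second_marginal.
Variable M : probability V R.
Hypothesis Mg : has_density M nu (expR \o g).

(** The plan with density gibbs(phi', psi) has marginals rho and M; log of its
   density ratio to Q is f, and that of M to nu is g, so this is the data
   processing inequality. *)
Lemma KL_second_marginal : rho.-integrable setT (EFin \o f) ->
  (KL M nu <= (\int[rho]_x f x)%:E)%E.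
Proof.
move=> iff.
have mG := measurable_gibbs mphi' mpsi.
have [P PG] : exists P : probability (V * V)%type R,
    has_density P (rho \x nu)%E (G phi' psi).
  apply: exists_density => //; first exact: gibbs_ge0.
  have := tonelli_fst mphi' mpsi (measurable_cst (1%E : \bar R)) (fun=> lee01) nrm_mid.
  rewrite integral_cst//= probability_setT mule1 => <-.
  by apply: eq_integral => z _; rewrite mul1e.
have P1 A : measurable A -> P (fst @^-1` A) = rho A.
  move=> mA; have [_ ->] := PG; last by rewrite -[X in measurable X]setTI; exact: measurable_fst.
  rewrite integral_restrict_indic.
  rewrite (tonelli_fst mphi' mpsi (u := fun x => (\1_A x)%:E))//.
  - by rewrite integral_indic// setIT.
  - by apply/measurable_EFinP; exact: measurable_indic.
have P2 A : measurable A -> P (snd @^-1` A) = M A.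
  move=> mA; have [_ ->] := PG; last by rewrite -[X in measurable X]setTI; exact: measurable_snd.
  have [_ ->//] := Mg.
  rewrite [LHS]integral_restrict_indic [RHS]integral_restrict_indic.
  have mu : measurable_fun setT (fun y => ((\1_A y)%:E * (expR (g y))%:E)%E).
    by apply: emeasurable_funM; [apply/measurable_EFinP; exact: measurable_indic|exact: mexp].
  have u0 y : (0 <= (\1_A y)%:E * (expR (g y))%:E)%E.
    by rewrite mule_ge0// lee_fin expR_ge0.
  rewrite -[RHS](tonelli_snd mphi' mpsi' mu u0 nrm').
  apply: eq_integral => z _; rewrite -!EFinM -mulrA; congr (EFin (_ * _)).
  by rewrite !gibbsE -expRD /g; congr expR; ring.
rewrite (KL_density mg Mg) (integral_image measurable_snd P2 mg).
(* exp t is the ratio of gibbs(phi, psi) times exp g to the density of P *)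
pose t (z : V * V) := g z.2 - f z.1.
have mt : measurable_fun setT t by apply: measurable_funB; [exact: (msnd mg)|exact: (mfst mf)].
have It : (\int[P]_z (expR (t z))%:E = 1)%E.
  rewrite (ge0_integral_density (gibbs_ge0 _ _) PG)//; last first.
    by apply/measurable_EFinP; exact: measurableT_comp.
  rewrite -int_expg -(tonelli_snd mphi mpsi (mexp mg) (fun y => expR_ge0 _) nrm).
  apply: eq_integral => z _; rewrite -!EFinM; congr EFin.
  by rewrite !gibbsE -!expRD /t /f; congr expR; ring.
have it : P.-integrable setT (EFin \o (fun z => expR (t z))).
  apply/integrableP; split; first by apply/measurable_EFinP; exact: measurableT_comp.
  by under eq_integral do rewrite /= ger0_norm ?expR_ge0//; rewrite It ltry.
have if1 : P.-integrable setT (EFin \o (fun z => f z.1)).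
  exact: (integrable_image measurable_fst P1 mf).1.
have if2 : P.-integrable setT (EFin \o (fun z => f z.1 - 1)).
  by apply: integrable_sub => //; exact: integrable_cst_prob.
have -> : (\int[rho]_x f x)%:E = (\int[P]_z (f z.1 - 1 + expR (t z))%:E)%E.
  rewrite -EFin_expectation; last exact: integrable_add.
  rewrite RintegralD// RintegralB//; last exact: integrable_cst_prob.
  rewrite expectation_cst (expectation_image measurable_fst P1 mf).
  by rewrite {3}/Rintegral It subrK.
apply: le_integral_gen.
- by apply/measurable_EFinP; exact: (msnd mg).
- apply/measurable_EFinP; apply: measurable_funD; last exact: measurableT_comp.
  by apply: measurable_funB => //; exact: (mfst mf).
- by move=> z; rewrite lee_fin; have := expR_ge1Dx (t z); rewrite /t; lra.
Qed.

Section transport_bound.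
(** [Tl y z x] stands for the first-order term at y of the function
   c(x, .) + psi', in the direction z - y. *)
Variables (Tl : V -> V -> V -> R) (Lam : R).
Hypotheses (Lam0 : 0 <= Lam)
  (iT : forall y z, rho.-integrable setT
     (EFin \o (fun x => Tl y z x * G phi' psi' (x, y))))
  (T0 : forall y z, \int[rho]_x (Tl y z x * G phi' psi' (x, y)) = 0)
  (sc : forall x y z, c x z + psi' z <=
     c x y + psi' y + Tl y z x + Lam / 2 * enorm (y - z) ^+ 2).

Let ks := G phis psis.
Let k := G phi' psi'.
Let h z := (\int[rho]_x (ks (x, z))%:E)%E.
Let A (u : V -> R) y := (\int[rho]_x (u x * k (x, y))%:E)%E.

Let mks : measurable_fun setT (EFin \o ks).
Proof. by apply/measurable_EFinP; exact: measurable_gibbs. Qed.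

Let muk (u : V -> R) : measurable_fun setT u ->
  measurable_fun setT (fun z : V * V => (u z.1 * k z)%:E).
Proof.
move=> mu; apply/measurable_EFinP; apply: measurable_funM; first exact: (mfst mu).
exact: measurable_gibbs.
Qed.

Let uk0 (u : V -> R) : (forall x, 0 <= u x) ->
  forall z : V * V, (0 <= (u z.1 * k z)%:E)%E.
Proof. by move=> u0 z; rewrite lee_fin mulr_ge0// gibbs_ge0. Qed.

Let mA (u : V -> R) : measurable_fun setT u -> (forall x, 0 <= u x) ->
  measurable_fun setT (A u).
Proof. by move=> mu u0; exact: (measurable_fun_fubini_tonelli_G (m1 := rho) _ (muk mu) (uk0 u0)). Qed.

Let A0 (u : V -> R) y : (forall x, 0 <= u x) -> (0 <= A u y)%E.
Proof. by move=> u0; apply: integral_ge0 => x _; exact: (uk0 u0 (x, y)). Qed.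

Let mh : measurable_fun setT h.
Proof.
exact: (measurable_fun_fubini_tonelli_G (m1 := rho) _ mks (fun z => gibbs_ge0 _ _ z)).
Qed.

Let h0 z : (0 <= h z)%E.
Proof. by apply: integral_ge0 => x _; rewrite lee_fin gibbs_ge0. Qed.

(** The density exp g of M turns the conditional law k of x given y into
   gibbs(phi', psi), whose first marginal is rho. *)
Let int_A (u : V -> R) : measurable_fun setT u -> (forall x, 0 <= u x) ->
  (\int[M]_y A u y = \int[rho]_x (u x)%:E)%E.
Proof.
move=> mu u0.
rewrite (ge0_integral_density _ Mg); last 3 first.
- by move=> y; exact: expR_ge0.
- exact: mA.
- by move=> y; exact: A0.
have muE : measurable_fun setT (EFin \o u) by exact/measurable_EFinP.
rewrite -(tonelli_fst mphi' mpsi (u := EFin \o u) _ _ nrm_mid)//.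
rewrite fubini_tonelli2 /fubini_G; last 2 first.
- apply: emeasurable_funM; first exact: measurableT_comp.
  by apply/measurable_EFinP; exact: measurable_gibbs.
- by move=> z; rewrite mule_ge0// lee_fin// gibbs_ge0.
apply: eq_integral => y _.
have muky : measurable_fun setT (fun x => (u x * k (x, y))%:E).
  exact: (measurableT_comp (muk mu) (pair2_measurable y)).
rewrite /A -[LHS](ge0_integralZr rho measurableT muky) => [|x _|]; last 2 first.
- exact: (uk0 u0 (x, y)).
- by rewrite lee_fin expR_ge0.
apply: eq_integral => x _; rewrite -!EFinM -mulrA; congr (EFin (_ * _)).
by rewrite /k !gibbsE -expRD /g /=; congr expR; ring.
Qed.

Let int_h : (\int[nu]_z h z = 1)%E.
Proof.
have [_ piE] := piG.
have := piE setT measurableT; rewrite probability_setT => ->.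
by rewrite fubini_tonelli2// => z; rewrite lee_fin gibbs_ge0.
Qed.

Let ap x : R := Num.max (a x) 0.
Let am x : R := Num.max (- a x) 0.
Let bp x : R := Num.max (b x) 0.
Let bm x : R := Num.max (- b x) 0.

Let pos0 (u : V -> R) x : 0 <= Num.max (u x) 0. Proof. by rewrite le_max lexx orbT. Qed.

Let am0 x : 0 <= am x. Proof. exact: (pos0 (\- a)). Qed.
Let bm0 x : 0 <= bm x. Proof. exact: (pos0 (\- b)). Qed.

Let map : measurable_fun setT ap. Proof. exact: measurable_maxr. Qed.
Let mbp : measurable_fun setT bp. Proof. exact: measurable_maxr. Qed.
Let mam : measurable_fun setT am.
Proof. by apply: measurable_maxr => //; exact: measurableT_comp. Qed.
Let mbm : measurable_fun setT bm.
Proof. by apply: measurable_maxr => //; exact: measurableT_comp. Qed.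

Let posneg (u : R) : u = Num.max u 0 - Num.max (- u) 0.
Proof. by case: (leP u 0) => ?; rewrite /Num.max; case: ltP; case: ltP; lra. Qed.

Let ik y : rho.-integrable setT (EFin \o (fun x => k (x, y))).
Proof.
have mk : measurable_fun setT (EFin \o k).
  by apply/measurable_EFinP; exact: measurable_gibbs.
apply/integrableP; split; first exact: (measurableT_comp mk (pair2_measurable y)).
by under eq_integral do rewrite /= ger0_norm ?gibbs_ge0//; rewrite nrm' ltry.
Qed.

(** Entropy duality between the two conditional laws of x given y and x given
   z under Q', tested against a + b(z), whose exponential turns the second
   conditional law into the one of pi; semiconcavity bounds their relative
   entropy by Lam / (2 eps) times the squared distance of y and z. *)
Let dual_bound y z :
  (A ap y + (bp z + 1)%:E <=
    h z + A am y + (bm z + Lam / (2 * eps) * enorm (y - z) ^+ 2)%:E)%E.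
Proof.
set r := Lam / (2 * eps) * enorm (y - z) ^+ 2.
pose S x := (Tl y z x * k (x, y)) / eps + (r - 1 - b z) * k (x, y).
have iS1 : rho.-integrable setT (EFin \o (fun x => Tl y z x * k (x, y) / eps)).
  by under eq_fun do rewrite mulrC; exact: integrable_scale.
have iS : rho.-integrable setT (EFin \o S).
  by apply: integrable_add => //; exact: integrable_scale.
have ES : \int[rho]_x S x = r - 1 - b z.
  rewrite RintegralD//; last exact: integrable_scale.
  rewrite RintegralZr// T0 mul0r add0r RintegralZl//.
  by rewrite /Rintegral nrm' mulr1.
have mkx : measurable_fun setT (fun x => k (x, y)).
  by apply/measurable_EFinP; exact: measurable_int (ik y).
have mksz : measurable_fun setT (fun x => ks (x, z)).
  by apply/measurable_EFinP; exact: (measurableT_comp mks (pair2_measurable z)).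
have := @le_integral_shift _ _ _ rho (fun x => ks (x, z) + am x * k (x, y))
  (fun x => ap x * k (x, y)) S.
have -> : (\int[rho]_x (ks (x, z) + am x * k (x, y))%:E = h z + A am y)%E.
  rewrite /h /A -ge0_integralD//.
  - by move=> x _; rewrite lee_fin gibbs_ge0.
  - exact: (measurableT_comp mks (pair2_measurable z)).
  - by move=> x _; exact: (@uk0 am (pos0 (\- a)) (x, y)).
  - by apply/measurable_EFinP; exact: measurable_funM.
rewrite ES => H.
have {}H : (A ap y <= h z + A am y + (r - 1 - b z)%:E)%E.
  apply: H => //.
  - by apply: measurable_funD => //; exact: measurable_funM.
  - exact: measurable_funM.
  - by move=> x; rewrite addr_ge0 ?gibbs_ge0// mulr_ge0 ?gibbs_ge0//; exact: (pos0 (\- a)).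
  move=> x.
  (* log-density ratio of the laws of x given y and of x given z *)
  pose th := (c x z + psi' z - c x y - psi' y) / eps.
  have thle : th <= Tl y z x / eps + r.
    have -> : Tl y z x / eps + r = (Tl y z x + Lam / 2 * enorm (y - z) ^+ 2) / eps.
      by rewrite /r; field; rewrite gt_eqF.
    by rewrite ler_pM2r ?invr_gt0//; have := sc x y z; lra.
  have -> : ks (x, z) = k (x, y) * expR (a x + b z - th).
    rewrite /ks /k !gibbsE -expRD /=; congr expR.
    by rewrite /a /b /th; ring.
  have k0 : 0 <= k (x, y) by exact: gibbs_ge0.
  have e1 := expR_ge1Dx (a x + b z - th).
  have -> : ap x = a x + am x by rewrite /ap /am {2}[a x]posneg; lra.
  have -> : S x = (Tl y z x / eps + r - 1 - b z) * k (x, y) by rewrite /S; ring.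
  have : k (x, y) * (1 + (a x + b z - (Tl y z x / eps + r))) <=
      k (x, y) * expR (a x + b z - th).
    by rewrite ler_wpM2l//; lra.
  lra.
apply: (le_trans (leeD2r _ H)).
rewrite -[leLHS]addeA -EFinD le_eqVlt; apply/orP; left; apply/eqP; congr (_ + EFin _)%E.
by rewrite {1}[b z]posneg -/(bp z) -/(bm z); ring.
Qed.

(** Integrate the pointwise bound over the coupling. Positive and negative parts
   are kept apart, so that Tonelli's theorem suffices. *)
Lemma KL_next_le_transport (gam : probability (V * V)%type R) :
  coupling M nu gam ->
  (KL pi Q' <= (Lam / (2 * eps))%:E * \int[gam]_z (enorm (z.1 - z.2) ^+ 2)%:E)%E.
Proof.
move=> cg; rewrite KL_next.
have [iap iam ->] := expectation_posneg ma ia.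
have [ibp ibm ->] := expectation_posneg mb ib.
have K0 : 0 <= Lam / (2 * eps) by rewrite divr_ge0// mulr_ge0// ltW.
have mr : measurable_fun setT (fun z : V * V => (enorm (z.1 - z.2) ^+ 2)%:E).
  by apply/measurable_EFinP; exact: measurable_sqr_enorm_sub.
have I0 : (0 <= \int[gam]_z (enorm (z.1 - z.2) ^+ 2)%:E)%E.
  by apply: integral_ge0 => z _; rewrite lee_fin sqr_ge0.
pose Kr (z : V * V) := ((Lam / (2 * eps))%:E * (enorm (z.1 - z.2) ^+ 2)%:E)%E.
have Kr0 z : (0 <= Kr z)%E by rewrite mule_ge0// lee_fin// sqr_ge0.
have mKr : measurable_fun setT Kr by exact: emeasurable_funM.
have gfst (u : V -> \bar R) : measurable_fun setT u -> (forall x, 0 <= u x)%E ->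
    (\int[gam]_z u z.1 = \int[M]_y u y)%E.
  by move=> mu u0; rewrite (ge0_integral_image measurable_fst (coupling_fst cg) mu u0).
have gsnd (u : V -> \bar R) : measurable_fun setT u -> (forall x, 0 <= u x)%E ->
    (\int[gam]_z u z.2 = \int[nu]_y u y)%E.
  by move=> mu u0; rewrite (ge0_integral_image measurable_snd (coupling_snd cg) mu u0).
have pE (u : V -> R) x : (0 <= (Num.max (u x) 0)%:E)%E by rewrite lee_fin pos0.
have mA1 (u : V -> R) : measurable_fun setT u -> (forall x, 0 <= u x) ->
    measurable_fun setT (fun z : V * V => A u z.1).
  by move=> mu u0; exact: (measurableT_comp (mA mu u0)).
have mE2 (u : V -> R) : measurable_fun setT u ->
    measurable_fun setT (fun z : V * V => (u z.2)%:E).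
  by move=> mu; apply/measurable_EFinP; exact: (msnd mu).
have mh2 : measurable_fun setT (fun z : V * V => h z.2) by exact: (measurableT_comp mh).
have LE : (\int[gam]_z (A ap z.1 + (bp z.2 + 1)%:E) =
    (\int[rho]_x ap x + (\int[nu]_x bp x + 1))%:E)%E.
  rewrite ge0_integralD//; last 4 first.
  - by move=> z _; apply: A0 => x; exact: pos0.
  - by apply: mA1 => // x; exact: pos0.
  - by move=> z _; rewrite lee_fin addr_ge0// pos0.
  - by apply/measurable_EFinP; apply: measurable_funD => //; exact: (msnd mbp).
  rewrite (gfst (A ap)); [|by apply: mA => // x; exact: pos0|by move=> x; apply: A0 => ?; exact: pos0].
  rewrite int_A//; last by move=> x; exact: pos0.
  rewrite (gsnd (fun y => (bp y + 1)%:E)); last 2 first.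
  - by apply/measurable_EFinP; exact: measurable_funD.
  - by move=> x; rewrite lee_fin addr_ge0// pos0.
  rewrite -EFin_expectation// -EFin_expectation; last first.
    by apply: integrable_add => //; exact: integrable_cst_prob.
  by rewrite RintegralD// ?expectation_cst//; exact: integrable_cst_prob.
have RE : (\int[gam]_z (h z.2 + A am z.1 + ((bm z.2)%:E + Kr z)) =
    (1 + \int[rho]_x am x + \int[nu]_x bm x)%:E + \int[gam]_z Kr z)%E.
  rewrite ge0_integralD//; last 4 first.
  - by move=> z _; rewrite adde_ge0//; apply: A0 => x; exact: am0.
  - by apply: emeasurable_funD => //; apply: mA1 => // x; exact: am0.
  - by move=> z _; rewrite adde_ge0// lee_fin bm0.
  - by apply: emeasurable_funD => //; exact: mE2.
  rewrite [X in (_ + X)%E]ge0_integralD//; last 2 first.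
  - by move=> z _; rewrite lee_fin bm0.
  - exact: mE2.
  rewrite ge0_integralD//; last 2 first.
  - by move=> z _; apply: A0 => x; exact: am0.
  - by apply: mA1 => // x; exact: am0.
  rewrite (gsnd h)// int_h.
  rewrite (gfst (A am)); [|by apply: mA => // x; exact: am0|by move=> x; apply: A0 => ?; exact: am0].
  rewrite int_A//.
  rewrite (gsnd (fun y => (bm y)%:E)) => [||x]; last 2 first.
  - exact/measurable_EFinP.
  - by rewrite lee_fin bm0.
  by rewrite -EFin_expectation// -EFin_expectation// addeA -!EFinD.
have : ((\int[rho]_x ap x + (\int[nu]_x bp x + 1))%:E <=
    (1 + \int[rho]_x am x + \int[nu]_x bm x)%:E + \int[gam]_z Kr z)%E.
  rewrite -LE -RE; apply: ge0_le_integral_nomeas => z _.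
    by rewrite adde_ge0//; [apply: A0 => x; exact: pos0|rewrite lee_fin addr_ge0// pos0].
  by rewrite /Kr -EFinM -EFinD; exact: dual_bound.
have -> : (\int[gam]_z Kr z = (Lam / (2 * eps))%:E * \int[gam]_z (enorm (z.1 - z.2) ^+ 2)%:E)%E.
  by rewrite /Kr ge0_integralZl// => z _; rewrite lee_fin sqr_ge0.
move: (_ * _)%E => [r| |]; rewrite ?leey// -?EFinD ?lee_fin//.
by rewrite /ap /am /bp /bm; lra.
Qed.

End transport_bound.
End second_marginal.

(** Two consecutive relative entropies: their difference dominates the relative
   entropy of the second marginal of the half step, which controls the second
   of them through the transport inequality. *)
Lemma step_contraction (Y : set V) (tau Lam : R) (Tl : V -> V -> V -> R) :
  open Y -> nu Y = 1%E -> 0 < tau -> TI Y nu tau -> 0 <= Lam ->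
  (forall y z, rho.-integrable setT
     (EFin \o (fun x => Tl y z x * G phi' psi' (x, y)))) ->
  (forall y z, \int[rho]_x (Tl y z x * G phi' psi' (x, y)) = 0) ->
  (forall x y z, c x z + psi' z <=
     c x y + psi' y + Tl y z x + Lam / 2 * enorm (y - z) ^+ 2) ->
  rho.-integrable setT (EFin \o f) ->
  exists F : R, (KL pi Q' + F%:E <= KL pi Q)%E /\
    (KL pi Q' <= (tau * Lam / eps * F)%:E)%E.
Proof.
move=> oY nuY tau0 ti Lam0 iT T0 sc iff.
exists (\int[rho]_x f x); split; first exact: KL_curr_ge.
have [M Mg] : exists M : probability V R, has_density M nu (expR \o g).
  apply: exists_density => [|x|]; [exact: measurableT_comp|exact: expR_ge0|].
  exact: int_expg.
have MY := density_full_set oY nuY Mg.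
have W2le : (W2 M nu ^+ 2 <= (2 * tau * \int[rho]_x f x)%:E)%E.
  apply: (le_trans (ti M MY)); rewrite [in leRHS]EFinM.
  apply: lee_wpmul2l; first by rewrite lee_fin mulr_ge0// ltW.
  exact: KL_second_marginal.
rewrite KL_next lee_fin.
apply: (@ler_small_error _ _ _ (Lam / (2 * eps)) 1) => // e /andP[e0 _].
have [gam cg gle] := W2_coupling e0 W2le.
have := KL_next_le_transport Mg Lam0 iT T0 sc cg.
rewrite KL_next => H; rewrite -lee_fin; apply: (le_trans H).
apply: (@le_trans _ _ ((Lam / (2 * eps))%:E * (2 * tau * \int[rho]_x f x + e)%:E)%E).
  by apply: lee_wpmul2l => //; rewrite lee_fin divr_ge0// mulr_ge0// ltW.
rewrite -EFinM lee_fin le_eqVlt; apply/orP; left; apply/eqP.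
by field; rewrite gt_eqF.
Qed.

End one_step.
End step.

(** * Derivatives of the cost *)

Section cost_calculus.
Context {R : realType} {d : nat}.
Local Notation V := 'rV[R]_d.
Variable c : V -> V -> R.
Hypothesis dc : twice_differentiable c.

Let f (z : V * V) := c z.1 z.2.

Lemma derive_snd x y v : 'D_(0, v) f (x, y) = 'D_v (c x) y.
Proof.
have E : (fun h : R => h^-1 *: ((f \o shift (x, y)) (h *: ((0, v) : V * V)) - f (x, y))) =
    (fun h : R => h^-1 *: ((c x \o shift y) (h *: v) - c x y)).
  by apply/funext => h; rewrite /f /= scaler0 add0r.
by rewrite /derive E.
Qed.

Let dpair_snd (x y : V) : differentiable (fun y : V => (x, y) : V * V) y.
Proof. by apply: differentiable_pair => //; exact: differentiable_cst. Qed.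

Let dpair_fst (x y : V) : differentiable (fun x : V => (x, y) : V * V) x.
Proof. by apply: differentiable_pair => //; exact: differentiable_cst. Qed.

Lemma differentiable_snd x y : differentiable (c x) y.
Proof. exact: (differentiable_comp (dpair_snd x y) (dc.1 (x, y))). Qed.

Lemma differentiable_fst x y : differentiable (c^~ y) x.
Proof. exact: (differentiable_comp (dpair_fst x y) (dc.1 (x, y))). Qed.

Lemma differentiable_derive_snd v x y : differentiable ('D_v (c x)) y.
Proof.
rewrite (_ : 'D_v (c x) = ('D_(0, v) f) \o (fun y : V => (x, y) : V * V)).
  exact: (differentiable_comp (dpair_snd x y) (dc.2 (0, v) (x, y))).
by apply/funext => y' /=; rewrite derive_snd.
Qed.

Lemma differentiable_derive_snd1 v y x : differentiable (fun x => 'D_v (c x) y) x.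
Proof.
rewrite (_ : (fun x => _) = ('D_(0, v) f) \o (fun x : V => (x, y) : V * V)).
  exact: (differentiable_comp (dpair_fst x y) (dc.2 (0, v) (x, y))).
by apply/funext => x' /=; rewrite derive_snd.
Qed.

Lemma measurable_cost : measurable_fun setT f.
Proof.
apply: (@measurable_caratheodory _ _ c) => [x|y x].
  by apply: differentiable_measurable_rV => y; exact: differentiable_snd.
by apply: differentiable_continuous; exact: differentiable_fst.
Qed.

Lemma quadratic_formE (A : 'M[R]_d) (u v : V) :
  (u *m A *m v^T) 0 0 = \sum_j v 0 j * \sum_i u 0 i * A i j.
Proof.
by rewrite mxE; apply: eq_bigr => j _; rewrite !mxE mulrC.
Qed.

Lemma derive_snd2 x y v : 'D_v ('D_v (c x)) y = (v *m hess2 c x y *m v^T) 0 0.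
Proof.
rewrite quadratic_formE.
rewrite (_ : 'D_v (c x) = \sum_j (v 0 j *: (fun y : V => 'D_(Defs.basis j) (c x) y : R))); last first.
  apply/funext => y'; rewrite derive_dot; last exact: differentiable_snd.
  rewrite fct_sumE /dot; apply: eq_bigr => j _; rewrite mxE mulrC.
  by [].
have dj j : derivable ('D_(Defs.basis j) (c x)) y v.
  by apply: diff_derivable; exact: differentiable_derive_snd.
rewrite derive_sum => [|j]; last exact: derivableZ.
apply: eq_bigr => j _; rewrite deriveZ//; congr (_ * _).
rewrite derive_dot; last exact: differentiable_derive_snd.
by rewrite /dot; apply: eq_bigr => i _; rewrite !mxE mulrC.
Qed.

Lemma derive_cross x y u v :
  'D_u (fun x => 'D_v (c x) y) x = (u *m hess12 c x y *m v^T) 0 0.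
Proof.
rewrite quadratic_formE.
rewrite (_ : (fun x => 'D_v (c x) y) =
    \sum_j (v 0 j *: (fun x : V => 'D_(Defs.basis j) (c x) y : R))); last first.
  apply/funext => x'; rewrite derive_dot; last exact: differentiable_snd.
  rewrite fct_sumE /dot; apply: eq_bigr => j _; rewrite mxE mulrC.
  by [].
have dj j : derivable (fun x => 'D_(Defs.basis j) (c x) y) x u.
  by apply: diff_derivable; exact: differentiable_derive_snd1.
rewrite derive_sum => [|j]; last exact: derivableZ.
apply: eq_bigr => j _; rewrite deriveZ//; congr (_ * _).
rewrite derive_dot; last exact: differentiable_derive_snd1.
by rewrite /dot; apply: eq_bigr => i _; rewrite !mxE mulrC.
Qed.

Lemma quadratic_form_scalar (a : R) (v : V) :
  (v *m a%:M *m v^T) 0 0 = a * enorm v ^+ 2.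
Proof.
rewrite mul_mx_scalar -scalemxAl mxE sqr_enorm; congr (_ * _).
by rewrite mxE; apply: eq_bigr => i _; rewrite mxE.
Qed.

Lemma opnorm2_ge (A : 'M[R]_d) (u : V) : enorm (u *m A) <= opnorm2 A * enorm u.
Proof.
pose S := [set enorm (v *m A) | v in [set v : V | enorm v <= 1]].
have ubS : has_ubound S.
  exists (\sum_j \sum_i `|A i j|) => _ [w /= w1 <-].
  apply: (le_trans (le_enorm_sum _)); apply: ler_sum => j _; rewrite mxE.
  apply: (le_trans (ler_norm_sum _ _ _)); apply: ler_sum => i _.
  by rewrite normrM ler_piMl// (le_trans (coord_le_enorm _ _)).
have [u0|u0] := eqVneq (enorm u) 0.
  have -> : u = 0.
    apply/rowP => i; apply/eqP; rewrite mxE -normr_eq0.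
    by have := coord_le_enorm u i; rewrite u0 normr_le0 normr_eq0.
  rewrite mul0mx; have -> : enorm (0 : V) = 0; last by rewrite mulr0.
  by rewrite -(scale0r (0 : V)) enormZ normr0 mul0r.
have up : 0 < enorm u by rewrite lt0r u0 enorm_ge0.
have : enorm (((enorm u)^-1 *: u) *m A) <= opnorm2 A.
  apply: (ub_le_sup ubS); exists ((enorm u)^-1 *: u) => //=.
  by rewrite enormZ ger0_norm ?invr_ge0 ?enorm_ge0// mulVf.
by rewrite -scalemxAl enormZ ger0_norm ?invr_ge0 ?enorm_ge0// mulrC ler_pdivrMr.
Qed.

Lemma derive_cross_le (Lam : R) x y u v : opnorm2 (hess12 c x y) <= Lam ->
  `|'D_u (fun x => 'D_v (c x) y) x| <= Lam * enorm v * enorm u.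
Proof.
move=> opL; rewrite derive_cross.
have E (w : V) : (w *m hess12 c x y *m v^T) 0 0 = dot (w *m hess12 c x y) v.
  by rewrite mxE; apply: eq_bigr => j _; rewrite [in LHS]mxE [in RHS]mxE !mxE.
have H (w : V) : dot (w *m hess12 c x y) v <= Lam * enorm v * enorm w.
  apply: (le_trans (cauchy_schwarz _ _)).
  rewrite mulrAC ler_wpM2r ?enorm_ge0// (le_trans (opnorm2_ge _ _))//.
  by rewrite ler_wpM2r ?enorm_ge0.
rewrite E ler_norml H andbT lerNl.
have -> : - dot (u *m hess12 c x y) v = dot (- u *m hess12 c x y) v.
  by rewrite mulNmx /dot -sumrN; apply: eq_bigr => j _; rewrite [in RHS]mxE mulNr.
by rewrite -(enormN u).
Qed.

End cost_calculus.

(** * Semiconcavity of the Sinkhorn potentials *)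

Section log_partition.
Context {R : realType} {d : nat}.
Local Notation V := 'rV[R]_d.
Variables (rho nu : probability V R) (c : V -> V -> R) (eps : R).
Hypothesis eps0 : 0 < eps.

Lemma partition_gt0 (m : probability V R) (u : V -> R) :
  m.-integrable setT (EFin \o (fun x => expR (u x))) ->
  0 < \int[m]_x expR (u x).
Proof.
move=> iu; rewrite -lte_fin EFin_expectation//.
apply: expectation_exp_gt0.
have mu : measurable_fun setT (fun x => expR (u x)).
  by apply/measurable_EFinP; exact: measurable_int iu.
rewrite (_ : u = @ln R \o (fun x => expR (u x))); first exact: measurableT_comp.
by apply/funext => x; rewrite /= expRK.
Qed.

Lemma normalized_by_partition (m : probability V R) (u : V -> R) (b : R) :
  m.-integrable setT (EFin \o (fun x => expR (u x))) ->
  b = eps * ln (\int[m]_x expR (u x)) ->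
  (\int[m]_x (expR (u x - b / eps))%:E = 1)%E.
Proof.
move=> iu ->; have Z0 := partition_gt0 iu.
set Z := \int[m]_x expR (u x).
have E : eps * ln Z / eps = ln Z by rewrite mulrAC mulfV ?mul1r// gt_eqF.
under eq_integral do rewrite E expRB lnK ?posrE// mulrC.
rewrite -EFin_expectation; last exact: integrable_scale.
by rewrite RintegralZl// mulVf// gt_eqF.
Qed.

Lemma psi_step_normalized (phi : V -> R) (y : V) :
  diff_under_integral rho (psi_kernel c eps phi) ->
  (\int[rho]_x (gibbs c eps phi (psi_step rho c eps phi) (x, y))%:E = 1)%E.
Proof.
move=> /(_ y)[iy _ _ _ _]; rewrite -[RHS](normalized_by_partition iy (erefl _)).
apply: eq_integral => x _; congr (EFin (expR _)).
by rewrite /= /psi_step /psi_kernel; ring.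
Qed.

Lemma phi_step_normalized (psi : V -> R) (x : V) :
  diff_under_integral nu (phi_kernel c eps psi) ->
  (\int[nu]_y (gibbs c eps (phi_step nu c eps psi) psi (x, y))%:E = 1)%E.
Proof.
move=> /(_ x)[ix _ _ _ _]; rewrite -[RHS](normalized_by_partition ix (erefl _)).
apply: eq_integral => y _; congr (EFin (expR _)).
by rewrite /= /phi_step /phi_kernel; ring.
Qed.

Lemma differentiable_log_partition (m : probability V R) (F : V -> V -> R) a :
  (forall a, 0 < \int[m]_b F a b) -> diff_under_integral m F ->
  differentiable (fun a => eps * ln (\int[m]_b F a b)) a /\
  forall u, 'D_u (fun a => eps * ln (\int[m]_b F a b)) a =
    eps * ((\int[m]_b F a b)^-1 * 'D_u (fun a => \int[m]_b F a b) a).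
Proof.
move=> Z0 dZ; have [_ dZa _ _ _] := dZ a.
have dln := is_derive1_ln (Z0 a).
have deln : is_derive (\int[m]_b F a b) (1 : R) (fun t => eps * ln t)
    (eps * (\int[m]_b F a b)^-1).
  by apply: is_derive_eq; rewrite /GRing.scale /=; ring.
have [df Df] := differentiable_compR (f := fun a => \int[m]_b F a b) dZa deln.
by split=> // u; have := Df u; rewrite /comp => ->; rewrite mulrA.
Qed.

Lemma differentiable_psi_step (phi : V -> R) y :
  diff_under_integral rho (psi_kernel c eps phi) ->
  differentiable (psi_step rho c eps phi) y.
Proof.
move=> dZ; apply: (differentiable_log_partition y _ dZ).1 => a.
by have [ia _ _ _ _] := dZ a; exact: partition_gt0 ia.
Qed.

Lemma differentiable_phi_step (psi : V -> R) x :
  diff_under_integral nu (phi_kernel c eps psi) ->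
  differentiable (phi_step nu c eps psi) x.
Proof.
move=> dZ; apply: (differentiable_log_partition x _ dZ).1 => a.
by have [ia _ _ _ _] := dZ a; exact: partition_gt0 ia.
Qed.

Lemma derive_scaled_product (A B : V -> R) y v (e : R) :
  derivable A y v -> derivable B y v ->
  'D_v (fun y => e * (A y * B y)) y = e * (A y * 'D_v B y + B y * 'D_v A y).
Proof.
move=> dA dB.
have h : is_derive y v (A * B) (A y *: 'D_v B y + B y *: 'D_v A y).
  exact: is_deriveM (derivableP dA) (derivableP dB).
exact: (@derive_val _ _ _ _ _ _ _ (is_deriveZ e h)).
Qed.
Lemma derive_scaled_quotient (A B : V -> R) y v (e : R) :
  A y != 0 -> derivable A y v -> derivable B y v ->
  'D_v (fun y => e * ((A y)^-1 * B y)) y =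
    e * ((A y)^-1 * 'D_v B y - B y * ((A y) ^- 2 * 'D_v A y)).
Proof.
move=> A0 dA dB.
have h : is_derive y v (fun y => (A y)^-1) (- (A y) ^- 2 *: 'D_v A y).
  apply: DeriveDef; first exact: (derivableV A0 dA).
  exact: (deriveV A0 dA).
rewrite (derive_scaled_product e (@ex_derive _ _ _ _ _ _ _ h) dB).
by rewrite (@derive_val _ _ _ _ _ _ _ h) /GRing.scale /= mulNr mulrN.
Qed.

Section semiconcavity.
Variables (phi : V -> R) (ell Lam Vb : R).
Hypotheses (dc : twice_differentiable c)
  (hess2P : forall x y, psd_le ell%:M (hess2 c x y) /\ psd_le (hess2 c x y) Lam%:M)
  (dZ : diff_under_integral rho (psi_kernel c eps phi)).

Let psi := psi_step rho c eps phi.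
Let k (x y : V) := gibbs c eps phi psi (x, y).
Let F := psi_kernel c eps phi.
Let Z y := \int[rho]_x F y x.

(** The variances of the directional derivatives of the cost under the
   conditional laws of x given y. *)
Hypothesis variance_le : forall y v,
  rho.-integrable setT (EFin \o (fun x => 'D_v (c x) y * k x y)) ->
  rho.-integrable setT (EFin \o (fun x => 'D_v (c x) y ^+ 2 * k x y)) ->
  \int[rho]_x ('D_v (c x) y ^+ 2 * k x y) - (\int[rho]_x ('D_v (c x) y * k x y)) ^+ 2
    <= Vb * enorm v ^+ 2.

Let iF y : rho.-integrable setT (EFin \o (F y)).
Proof. by have [] := dZ y. Qed.

Let Z0 y : 0 < Z y.
Proof. exact: partition_gt0 (iF y). Qed.

Let kE x y : k x y = (Z y)^-1 * F y x.
Proof.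
rewrite /k /gibbs /psi /psi_step /F /psi_kernel /=.
rewrite -[(Z y)^-1]lnK ?posrE ?invr_gt0// -expRD lnV ?posrE//; congr expR.
by rewrite /Z /F /psi_kernel; field; rewrite gt_eqF.
Qed.

Let DF y x u : 'D_u (F^~ x) y = - eps^-1 * ('D_u (c x) y * F y x).
Proof.
have dex : is_derive (c x y) (1 : R) (fun t => expR (- (t + phi x) / eps)) (- eps^-1 * F y x).
  by apply: is_derive_eq; rewrite /GRing.scale /= /F /psi_kernel; ring.
have [_] := differentiable_compR (differentiable_snd dc x y) dex.
by move=> /(_ u); rewrite /comp /F /psi_kernel => ->; ring.
Qed.

Let dF y x : differentiable (F^~ x) y.
Proof.
have dex : is_derive (c x y) (1 : R) (fun t => expR (- (t + phi x) / eps)) (- eps^-1 * F y x).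
  by apply: is_derive_eq; rewrite /GRing.scale /= /F /psi_kernel; ring.
by have [] := differentiable_compR (differentiable_snd dc x y) dex.
Qed.

Let DDF y x u : 'D_u ('D_u (F^~ x)) y =
  (eps^-1) ^+ 2 * ('D_u (c x) y ^+ 2 * F y x) - eps^-1 * ('D_u ('D_u (c x)) y * F y x).
Proof.
rewrite (_ : 'D_u (F^~ x) = fun y => - eps^-1 * ('D_u (c x) y * F y x)); last first.
  by apply/funext => y'; rewrite DF.
have d1 : derivable ('D_u (c x)) y u.
  by apply: diff_derivable; exact: differentiable_derive_snd.
have d2 : derivable (F^~ x) y u by exact: diff_derivable.
rewrite (derive_scaled_product (- eps^-1) d1 d2) DF.
by move: ('D_u (c x) y) ('D_u ('D_u (c x)) y) (F y x) => a b z; ring.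
Qed.

Let scale_k (g : V -> R) y : (fun x => g x * k x y) = fun x => (Z y)^-1 * (g x * F y x).
Proof. by apply/funext => x; rewrite kE; ring. Qed.

Let iDc y u : rho.-integrable setT (EFin \o (fun x => 'D_u (c x) y * k x y)).
Proof.
have [_ _ _ /(_ u)[iD _] _] := dZ y.
rewrite scale_k; apply: integrable_scale.
rewrite (_ : (fun x => _) = fun x => - eps * 'D_u (F^~ x) y); first exact: integrable_scale.
by apply/funext => x; rewrite DF mulrA mulrNN mulfV ?mul1r// gt_eqF.
Qed.

Let hess_bound y x v :
  ell * enorm v ^+ 2 <= 'D_v ('D_v (c x)) y <= Lam * enorm v ^+ 2.
Proof.
have [h1 h2] := hess2P x y; rewrite derive_snd2//.
by have := h1 v; have := h2 v; rewrite !quadratic_form_scalar => -> ->.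
Qed.

Let ik y : rho.-integrable setT (EFin \o (k^~ y)).
Proof.
rewrite (_ : k^~ y = fun x => (Z y)^-1 * F y x); first exact: integrable_scale.
by apply/funext => x; rewrite kE.
Qed.

Let int_k y : \int[rho]_x k x y = 1.
Proof. by rewrite /Rintegral (psi_step_normalized y dZ). Qed.

Let mDc y u : measurable_fun setT (fun x => 'D_u (c x) y).
Proof. by apply: differentiable_measurable_rV => x; exact: differentiable_derive_snd1. Qed.

Let mk y : measurable_fun setT (k^~ y).
Proof. by apply/measurable_EFinP; exact: measurable_int (ik y). Qed.

Let k0 x y : 0 <= k x y. Proof. exact: expR_ge0. Qed.

Let iDDF y v : rho.-integrable setT (EFin \o (fun x =>
  eps^-1 * ('D_v (c x) y ^+ 2 * k x y) - 'D_v ('D_v (c x)) y * k x y)).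
Proof.
have [_ _ _ _ /(_ v v)[iDD _]] := dZ y.
rewrite (_ : (fun x => _) = fun x => (eps / Z y) * 'D_v ('D_v (F^~ x)) y).
  exact: integrable_scale.
apply/funext => x; rewrite DDF !kE; field.
by rewrite !gt_eqF.
Qed.

Let iD2k y v : rho.-integrable setT (EFin \o (fun x => 'D_v ('D_v (c x)) y * k x y)).
Proof.
have mD2 : measurable_fun setT (fun x => 'D_v ('D_v (c x)) y * k x y).
  rewrite (_ : (fun x => _) = fun x => eps^-1 * ('D_v (c x) y ^+ 2 * k x y) -
    (eps^-1 * ('D_v (c x) y ^+ 2 * k x y) - 'D_v ('D_v (c x)) y * k x y)).
    apply: measurable_funB.
      by apply: measurable_funM => //; apply: measurable_funM => //; exact: measurable_funX.
    by apply/measurable_EFinP; exact: measurable_int (iDDF y v).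
  by apply/funext => x; ring.
apply: (integrable_dominated mD2 (integrable_scale ((`|ell| + `|Lam|) * enorm v ^+ 2) (ik y))).
move=> x /=; rewrite normrM (ger0_norm (k0 _ _)) ler_wpM2r//.
have /andP[h1 h2] := hess_bound y x v.
have e0 : 0 <= enorm v ^+ 2 by exact: sqr_ge0.
have l1 : - (`|ell| * enorm v ^+ 2) <= ell * enorm v ^+ 2.
  by rewrite -mulNr ler_wpM2r// lerNl -normrN ler_norm.
have l2 : Lam * enorm v ^+ 2 <= `|Lam| * enorm v ^+ 2 by rewrite ler_wpM2r// ler_norm.
have l3 : 0 <= `|ell| * enorm v ^+ 2 by rewrite mulr_ge0.
have l4 : 0 <= `|Lam| * enorm v ^+ 2 by rewrite mulr_ge0.
by rewrite ler_norml mulrDl; apply/andP; split; lra.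
Qed.

Let iDc2 y v : rho.-integrable setT (EFin \o (fun x => 'D_v (c x) y ^+ 2 * k x y)).
Proof.
rewrite (_ : (fun x => _) = fun x => eps *
   ((eps^-1 * ('D_v (c x) y ^+ 2 * k x y) - 'D_v ('D_v (c x)) y * k x y)
     + 'D_v ('D_v (c x)) y * k x y)).
  by apply: integrable_scale; apply: integrable_add.
by apply/funext => x; field; rewrite gt_eqF.
Qed.

Let Dpsi y u : 'D_u psi y = - \int[rho]_x ('D_u (c x) y * k x y).
Proof.
have [_ ->] := differentiable_log_partition y Z0 dZ.
have [_ _ _ /(_ u)[iD ->] _] := dZ y; rewrite -/(Z y).
rewrite -RintegralZl// -RintegralZl; last 2 first.
- by [].
- exact: integrable_scale.
rewrite -mulN1r -RintegralZl//; apply: eq_Rintegral => x _.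
by rewrite DF kE; field; rewrite !gt_eqF.
Qed.

Let DDpsi y v : 'D_v ('D_v psi) y =
  - (\int[rho]_x ('D_v ('D_v (c x)) y * k x y)) + eps^-1 *
   (\int[rho]_x ('D_v (c x) y ^+ 2 * k x y) - (\int[rho]_x ('D_v (c x) y * k x y)) ^+ 2).
Proof.
have [_ dZy dDZ /(_ v)[_ DZ] /(_ v v)[iDD DDZ]] := dZ y.
rewrite (_ : 'D_v psi = fun y => eps * ((Z y)^-1 * 'D_v Z y)); last first.
  by apply/funext => y'; have [_ ->] := differentiable_log_partition y' Z0 dZ.
have d1 : derivable Z y v by exact: diff_derivable.
have d2 : derivable (fun y => 'D_v Z y) y v by exact: (diff_derivable (dDZ v)).
have Zn0 : Z y != 0 by rewrite gt_eqF.
rewrite (derive_scaled_quotient eps Zn0 d1 d2).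
have E1 : 'D_v Z y = - (eps^-1 * Z y) * \int[rho]_x ('D_v (c x) y * k x y).
  have := Dpsi y v; have [_ ->] := differentiable_log_partition y Z0 dZ.
  rewrite -/(Z y) => h; rewrite mulNr -mulrN -h.
  by field; rewrite !gt_eqF.
have E2 : 'D_v ('D_v Z) y = Z y * eps^-1 * (eps^-1 * \int[rho]_x ('D_v (c x) y ^+ 2 * k x y)
    - \int[rho]_x ('D_v ('D_v (c x)) y * k x y)).
  have H : \int[rho]_x (Z y * eps^-1 *
        (eps^-1 * ('D_v (c x) y ^+ 2 * k x y) - 'D_v ('D_v (c x)) y * k x y)) =
      Z y * eps^-1 * (eps^-1 * \int[rho]_x ('D_v (c x) y ^+ 2 * k x y) -
        \int[rho]_x ('D_v ('D_v (c x)) y * k x y)).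
    rewrite (RintegralZl _ measurableT (iDDF y v)); congr (_ * _).
    rewrite (RintegralB measurableT (integrable_scale eps^-1 (iDc2 y v)) (iD2k y v)).
    by congr (_ - _); rewrite (RintegralZl _ measurableT (iDc2 y v)).
  rewrite -H DDZ; apply: eq_Rintegral => x _; rewrite DDF !kE.
  move: ('D_v (c x) y) ('D_v ('D_v (c x)) y) (F y x) => a b z.
  by move: (Z y) Zn0 => Zy Zy0; field; rewrite Zy0 gt_eqF.
rewrite E1 E2; have eps_neq0 : eps != 0 by rewrite gt_eqF.
move: (\int[rho]_x _) (\int[rho]_x _) (\int[rho]_x _) => I1 I2 I3.
by move: (Z y) Zn0 => Zy Zy0; field; rewrite ?Zy0 ?eps_neq0.
Qed.

Lemma psi_step_linear_integrable y z : rho.-integrable setT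
  (EFin \o (fun x => ('D_(z - y) (c x) y + 'D_(z - y) psi y) * gibbs c eps phi psi (x, y))).
Proof.
have := integrable_add (iDc y (z - y)) (integrable_scale ('D_(z - y) psi y) (ik y)).
by under eq_fun do rewrite -mulrDl.
Qed.

Lemma psi_step_linear_mean0 y z :
  \int[rho]_x (('D_(z - y) (c x) y + 'D_(z - y) psi y) * gibbs c eps phi psi (x, y)) = 0.
Proof.
under eq_Rintegral do rewrite mulrDl.
rewrite (RintegralD measurableT (iDc y (z - y))
  (integrable_scale ('D_(z - y) psi y) (ik y))).
rewrite (RintegralZl _ measurableT (ik y)).
by rewrite int_k mulr1 Dpsi subrr.
Qed.

(** The Hessian of psi is minus the mean of the Hessian of the cost plus 1/eps
   times the covariance of its gradient, under the law of x given y. *)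
Lemma psi_step_semiconcave x y z :
  c x z + psi z <= c x y + psi y + ('D_(z - y) (c x) y + 'D_(z - y) psi y) +
    (Lam - ell + Vb / eps) / 2 * enorm (y - z) ^+ 2.
Proof.
pose v := z - y.
have -> : enorm (y - z) = enorm v by rewrite /v -enormN opprB.
have dpsi a := differentiable_psi_step a dZ.
have dDpsi a : differentiable ('D_v psi) a.
  rewrite (_ : 'D_v psi = fun y => eps * ((Z y)^-1 * 'D_v Z y)); last first.
    by apply/funext => y'; have [_ ->] := differentiable_log_partition y' Z0 dZ.
  have [_ dZy dDZ _ _] := dZ a.
  apply: (@differentiableZ _ _ _ (fun y => (Z y)^-1 * 'D_v Z y)).
  apply: differentiableM; last exact: dDZ.
  by apply: differentiableV => //; rewrite gt_eqF.
pose g (t : R) := c x (y + t *: v) + psi (y + t *: v).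
pose g' (t : R) := 'D_v (c x) (y + t *: v) + 'D_v psi (y + t *: v).
pose g'' (t : R) := 'D_v ('D_v (c x)) (y + t *: v) + 'D_v ('D_v psi) (y + t *: v).
have dg (t : R) : is_derive t (1 : R) g (g' t).
  have h1 := is_derive_line (diff_derivable (v := v) (differentiable_snd dc x (y + t *: v))).
  have h2 := is_derive_line (diff_derivable (v := v) (dpsi (y + t *: v))).
  exact: is_deriveD.
have dg' (t : R) : is_derive t (1 : R) g' (g'' t).
  have h1 := is_derive_line (diff_derivable (v := v) (differentiable_derive_snd dc v x (y + t *: v))).
  have h2 := is_derive_line (diff_derivable (v := v) (dDpsi (y + t *: v))).
  exact: is_deriveD.
have g''le (t : R) : g'' t <= (Lam - ell + Vb / eps) * enorm v ^+ 2.
  rewrite /g''; set w := y + t *: v.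
  have /andP[_ h1] := hess_bound w x v.
  rewrite DDpsi.
  have h2 : ell * enorm v ^+ 2 <= \int[rho]_x ('D_v ('D_v (c x)) w * k x w).
    rewrite -[leLHS]mulr1 -(int_k w) -(RintegralZl _ measurableT (ik w)).
    apply: le_Rintegral => //; first by apply: integrable_scale; exact: ik.
    by move=> x' _; rewrite ler_wpM2r//; have /andP[] := hess_bound w x' v.
  have h3 := variance_le (iDc w v) (iDc2 w v).
  have h4 : eps^-1 * (\int[rho]_x ('D_v (c x) w ^+ 2 * k x w) -
      (\int[rho]_x ('D_v (c x) w * k x w)) ^+ 2) <= Vb / eps * enorm v ^+ 2.
    by rewrite [leRHS]mulrAC mulrC ler_wpM2r// invr_ge0 ltW.
  rewrite [leRHS](_ : _ = Lam * enorm v ^+ 2 +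
    (- (ell * enorm v ^+ 2) + Vb / eps * enorm v ^+ 2)); last by ring.
  by apply: lerD h1 _; apply: lerD h4; rewrite lerN2.
have := taylor2_le dg dg' g''le.
rewrite /g /g' scale1r scale0r addr0 (_ : y + v = z); last by rewrite /v addrC subrK.
by move=> H; rewrite [X in _ <= _ + X]mulrAC; exact: H.
Qed.

End semiconcavity.
End log_partition.

(** * Conditional variances and bounds on potentials *)

Section basis_vectors.
Context {R : realType} {d : nat}.
Local Notation V := 'rV[R]_d.

Lemma enorm_basis (i : 'I_d) : enorm (Defs.basis i : V) = 1.
Proof.
rewrite /enorm /Defs.basis (bigD1 i)//= big1 => [|j ji].
  by rewrite mxE !eqxx expr1n addr0 sqrtr1.
by rewrite mxE (negbTE ji) andbF expr0n.
Qed.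

Lemma lipschitz_const_ge0 (f : V -> R) (L : R) : (0 < d)%N ->
  (forall x x', `|f x - f x'| <= L * enorm (x - x')) -> 0 <= L.
Proof.
move=> d0 fL; have := fL (Defs.basis (Ordinal d0)) 0.
by rewrite subr0 enorm_basis mulr1; apply: le_trans.
Qed.

Lemma opnorm2_bound_ge0 (A : 'M[R]_d) (Lam : R) : (0 < d)%N ->
  opnorm2 A <= Lam -> 0 <= Lam.
Proof.
move=> d0; apply: le_trans.
have := opnorm2_ge A (Defs.basis (Ordinal d0)).
by rewrite enorm_basis mulr1; apply: le_trans; exact: enorm_ge0.
Qed.

Lemma psd_le_scalar (a b : R) (A : 'M[R]_d) : (0 < d)%N ->
  psd_le a%:M A -> psd_le A b%:M -> a <= b.
Proof.
move=> d0 aA Ab; have := le_trans (aA (Defs.basis (Ordinal d0))) (Ab _).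
by rewrite !quadratic_form_scalar enorm_basis expr1n !mulr1.
Qed.

End basis_vectors.

Section conditional_variance.
Context {R : realType} {d : nat}.
Local Notation V := 'rV[R]_d.
Variables (rho : probability V R) (c : V -> V -> R) (eps : R) (phi psi : V -> R).
Hypotheses (eps0 : 0 < eps) (dc : twice_differentiable c)
  (nrm : forall y, (\int[rho]_x (gibbs c eps phi psi (x, y))%:E = 1)%E).
Let k (x y : V) := gibbs c eps phi psi (x, y).

(** The variance is at most the second moment, and the derivative of the cost in
   the direction v is at most L |v|. *)
Lemma conditional_variance_lipschitz (L : R) y v :
  (forall y y' x, `|c x y - c x y'| <= L * enorm (y - y')) ->
  rho.-integrable setT (EFin \o (k^~ y)) ->
  rho.-integrable setT (EFin \o (fun x => 'D_v (c x) y ^+ 2 * k x y)) ->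
  \int[rho]_x ('D_v (c x) y ^+ 2 * k x y) - (\int[rho]_x ('D_v (c x) y * k x y)) ^+ 2
    <= L ^+ 2 * enorm v ^+ 2.
Proof.
move=> cL ik i2.
suff : \int[rho]_x ('D_v (c x) y ^+ 2 * k x y) <= L ^+ 2 * enorm v ^+ 2.
  by have := sqr_ge0 (\int[rho]_x ('D_v (c x) y * k x y)); lra.
have -> : L ^+ 2 * enorm v ^+ 2 = \int[rho]_x (L ^+ 2 * enorm v ^+ 2 * k x y).
  by rewrite RintegralZl// /Rintegral nrm mulr1.
apply: le_Rintegral => //; first exact: integrable_scale.
move=> x _; rewrite ler_wpM2r ?expR_ge0// -exprMn -[leLHS]real_normK ?num_real//.
have h : `|'D_v (c x) y| <= L * enorm v.
  apply: derive_le_lipschitz; first by apply: diff_derivable; exact: differentiable_snd.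
  by move=> y1 y2; exact: cL.
by rewrite ler_sqr ?nnegrE// (le_trans _ h).
Qed.

(** The law of x given y has log-density - (c + phi + psi) / eps relative to rho, of
   slope at most 2 L / eps, and the derivative of the cost in the direction v, as a
   function of x, has slope at most Lam |v|. *)
Lemma conditional_variance_lsi (X : set V) (C L Lam : R) y v :
  open X -> rho X = 1%E -> LSI X rho C -> 0 <= C -> 0 <= L -> 0 <= Lam ->
  (forall x x' y, `|c x y - c x' y| <= L * enorm (x - x')) ->
  (forall x x', `|phi x - phi x'| <= L * enorm (x - x')) ->
  (forall x, differentiable phi x) ->
  (forall x y, opnorm2 (hess12 c x y) <= Lam) ->
  rho.-integrable setT (EFin \o (fun x => 'D_v (c x) y * k x y)) ->
  rho.-integrable setT (EFin \o (fun x => 'D_v (c x) y ^+ 2 * k x y)) ->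
  \int[rho]_x ('D_v (c x) y ^+ 2 * k x y) - (\int[rho]_x ('D_v (c x) y * k x y)) ^+ 2
    <= 2 * C * Lam ^+ 2 * (1 + 4 * C * L ^+ 2 / eps ^+ 2) * enorm v ^+ 2.
Proof.
move=> oX rhoX lsi C0 L0 Lam0 cL phiL dphi opL i1 i2.
pose W (x : V) := - (c x y + phi x + psi y) / eps.
have dcy x : differentiable (c^~ y) x by exact: differentiable_fst.
have dW x : differentiable W x.
  rewrite (_ : W = - eps^-1 *: ((c^~ y) + phi + cst (psi y))); last first.
    apply/funext => x'; rewrite /W mulNr mulrC -mulNr.
    by [].
  apply: differentiableZ; apply: differentiableD => //.
  by apply: differentiableD.
have WK x u : `|'D_u W x| <= (2 * L / eps) * enorm u.
  apply: derive_le_lipschitz; first exact: diff_derivable.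
  move=> x1 x2; rewrite /W.
  have -> : - (c x1 y + phi x1 + psi y) / eps - - (c x2 y + phi x2 + psi y) / eps =
     - eps^-1 * ((c x1 y - c x2 y) + (phi x1 - phi x2)) by ring.
  have i0 : 0 < eps^-1 by rewrite invr_gt0.
  rewrite normrM normrN (gtr0_norm i0).
  have -> : 2 * L / eps * enorm (x1 - x2) =
    eps^-1 * (L * enorm (x1 - x2) + L * enorm (x1 - x2)) by ring.
  by rewrite ler_pM2l// (le_trans (ler_normD _ _))// lerD.
have mW := differentiable_measurable_rV dW.
have [q qW] : exists q : probability V R, has_density q rho (expR \o W).
  by apply: exists_density => [|x|]; [exact: measurableT_comp|exact: expR_ge0|exact: nrm].
have e0 x : 0 <= (expR \o W) x by exact: expR_ge0.
pose f x := 'D_v (c x) y.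
have df x : differentiable f x by exact: differentiable_derive_snd1.
have mf := differentiable_measurable_rV df.
have mf2 : measurable_fun setT (fun x => f x ^+ 2) by exact: measurable_funX.
have := @lsi_variance _ _ X rho C oX rhoX lsi q W f (2 * L / eps) (Lam * enorm v) C0.
rewrite (expectation_density e0 qW mf) (expectation_density e0 qW mf2) => H.
have {}H := H _ _ qW dW WK df _ _ _.
apply: (le_trans (H _ _ _ _ _)).
- by rewrite divr_ge0 ?mulr_ge0// ltW.
- by rewrite mulr_ge0// enorm_ge0.
- move=> x u; apply: derive_cross_le => //; exact: opL.
- exact/(integrable_density e0 qW mf).
- exact/(integrable_density e0 qW mf2).
rewrite le_eqVlt; apply/orP; left; apply/eqP; field.
by rewrite gt_eqF.
Qed.

End conditional_variance.

Section potentials.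
Context {R : realType} {d : nat}.
Local Notation V := 'rV[R]_d.
Variables (c : V -> V -> R) (eps L : R).
Hypotheses (eps0 : 0 < eps)
  (mc1 : forall x, measurable_fun setT (c x))
  (mc2 : forall y, measurable_fun setT (c^~ y))
  (cL : forall y y' x, `|c x y - c x y'| <= L * enorm (y - y')).

(** Moving from y to y' changes the cost by at most L |y - y'| uniformly in x, hence
   also the logarithm of the normalizing constant that psi equals. *)
Lemma potential_lipschitz (m : probability V R) (phi psi : V -> R) y y' :
  measurable_fun setT phi ->
  (\int[m]_x (gibbs c eps phi psi (x, y))%:E = 1)%E ->
  (\int[m]_x (gibbs c eps phi psi (x, y'))%:E = 1)%E ->
  `|psi y - psi y'| <= L * enorm (y - y').
Proof.
move=> mphi n1 n2.
suff H a b : (\int[m]_x (gibbs c eps phi psi (x, a))%:E = 1)%E ->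
    (\int[m]_x (gibbs c eps phi psi (x, b))%:E = 1)%E ->
    psi b - psi a <= L * enorm (b - a).
  rewrite ler_norml lerNl opprB; apply/andP; split; last exact: H.
  by rewrite -enormN opprB; exact: H.
move=> na nb.
pose K := expR ((L * enorm (b - a) + psi a - psi b) / eps).
have : (\int[m]_x (gibbs c eps phi psi (x, b))%:E <=
    \int[m]_x (K%:E * (gibbs c eps phi psi (x, a))%:E))%E.
  apply: ge0_le_integral_nomeas => x _; first by rewrite lee_fin expR_ge0.
  rewrite -EFinM lee_fin /K /gibbs /= -expRD ler_expR -mulrDl ler_pM2r ?invr_gt0//.
  by have := cL a b x; rewrite ler_norml -enormN opprB => /andP[_]; lra.
have mg : measurable_fun setT (fun x => (gibbs c eps phi psi (x, a))%:E).
  have mW : measurable_fun setT (fun x => - (c x a + phi x + psi a) / eps).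
    apply: measurable_funM => //; apply: measurableT_comp => //.
    by apply: measurable_funD => //; exact: measurable_funD.
  by apply/measurable_EFinP; exact: (measurableT_comp (@measurable_expR R) mW).
rewrite ge0_integralZl//; [|by move=> x _; rewrite lee_fin expR_ge0|by rewrite lee_fin expR_ge0].
rewrite na nb mule1 lee_fin /K -{1}expR0 ler_expR pmulr_lge0 ?invr_gt0//; lra.
Qed.

(** Normalization writes exp(phi(x) / eps) as the m-mean of
   exp(- (c(x,y) + psi(y)) / eps), whose exponent differs from - c(x,0) / eps by at
   most a linear function of |y|. *)
Lemma potential_bounded (m : probability V R) (psi : V -> R) (B : R) :
  (forall s : R, m.-integrable setT (EFin \o (fun y => expR (s * enorm y)))) ->
  measurable_fun setT psi ->
  {ae m, forall y, `|psi y| <= B + L * enorm y} ->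
  exists K : R, forall (phi : V -> R) x,
    (\int[m]_y (gibbs c eps phi psi (x, y))%:E = 1)%E -> `|phi x + c x 0| <= K.
Proof.
have scale (p q : R) : eps * (p / eps + q) = p + eps * q.
  by rewrite mulrDr mulrCA mulfV ?gt_eqF// mulr1.
have up_bound (t l : R) : 0 <= (B - t) / eps + l -> t <= B + eps * l.
  by rewrite -(pmulr_rge0 _ eps0) scale -addrAC subr_ge0.
have dn_bound (t l : R) : (- B - t) / eps + l <= 0 -> - B + eps * l <= t.
  by rewrite -(pmulr_rle0 _ eps0) scale addrAC subr_le0.
have final_bound (t p q P Q : R) : t <= B + p -> - B + q <= t ->
    p <= eps * P -> - q <= eps * Q -> 0 <= eps * P -> 0 <= eps * Q ->
    `|t| <= B + eps * (P + Q).
  by clear; move=> *; rewrite ler_norml mulrDr; apply/andP; split; lra.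
move=> mexp mpsi psiB.
pose s := 2 * L / eps.
pose E1 := \int[m]_y expR (s * enorm y); pose E2 := \int[m]_y expR (- s * enorm y).
have E10 : 0 < E1 by exact: partition_gt0 (mexp s).
have E20 : 0 < E2 by exact: partition_gt0 (mexp (- s)).
exists (B + eps * (`|ln E1| + `|ln E2|)) => phi x nx.
pose t := phi x + c x 0.
have mg : measurable_fun setT (fun y => (gibbs c eps phi psi (x, y))%:E).
  have mW : measurable_fun setT (fun y => - (c x y + phi x + psi y) / eps).
    apply: measurable_funM => //; apply: measurableT_comp => //.
    by apply: measurable_funD => //; exact: measurable_funD.
  by apply/measurable_EFinP; exact: (measurableT_comp (@measurable_expR R) mW).
have me u : measurable_fun setT (fun y : V => (expR (u * enorm y))%:E).
  apply/measurable_EFinP; apply: measurableT_comp => //; apply: measurable_funM => //.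
  exact: measurable_enorm.
have me0 u (y : V) : (0 <= (expR (u * enorm y))%:E)%E by rewrite lee_fin expR_ge0.
have cy y : `|c x y - c x 0| <= L * enorm y by have := cL y 0 x; rewrite subr0.
have up : 1 <= expR ((B - t) / eps) * E1.
  rewrite -lee_fin -[leLHS]nx EFinM EFin_expectation//.
  rewrite -(ge0_integralZl_EFin m measurableT (fun y _ => me0 _ y) (me _)) ?expR_ge0//.
  apply: ae_ge0_le_integral => //.
  - by move=> y _; rewrite lee_fin expR_ge0.
  - by apply: emeasurable_funM => //; exact: me.
  case: psiB => N [mN N0 subN]; exists N; split => //.
  apply: subset_trans subN; apply: subsetC => y /= hy _.
  rewrite -EFinM lee_fin /gibbs /= -expRD ler_expR /s mulrAC -mulrDl ler_pM2r ?invr_gt0//.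
  have := cy y; rewrite ler_norml => /andP[h1 _].
  by move: hy; rewrite ler_norml => /andP[h2 _]; rewrite /t; lra.
have dn : expR ((- B - t) / eps) * E2 <= 1.
  rewrite -lee_fin -[leRHS]nx EFinM EFin_expectation//.
  rewrite -(ge0_integralZl_EFin m measurableT (fun y _ => me0 _ y) (me _)) ?expR_ge0//.
  apply: ae_ge0_le_integral => //.
  - by apply: emeasurable_funM => //; exact: me.
  - by move=> y _; rewrite lee_fin expR_ge0.
  case: psiB => N [mN N0 subN]; exists N; split => //.
  apply: subset_trans subN; apply: subsetC => y /= hy _.
  rewrite -EFinM lee_fin /gibbs /= -expRD ler_expR /s mulNr mulrAC -mulNr -mulrDl ler_pM2r ?invr_gt0//.
  have := cy y; rewrite ler_norml => /andP[_ h1].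
  by move: hy; rewrite ler_norml => /andP[_ h2]; rewrite /t; lra.
have up' : t <= B + eps * ln E1.
  by apply: up_bound; rewrite -ler_expR expR0 expRD lnK// posrE.
have dn' : - B + eps * ln E2 <= t.
  by apply: dn_bound; rewrite -ler_expR expR0 expRD lnK// posrE.
apply: (final_bound _ _ _ _ _ up' dn').
- by rewrite ler_pM2l// ler_norm.
- by rewrite -mulrN ler_pM2l// -normrN ler_norm.
- by rewrite mulr_ge0// ltW.
- by rewrite mulr_ge0// ltW.
Qed.

End potentials.

Section ae_integrable.
Context {disp : measure_display} {T : measurableType disp} {R : realType}.

Lemma integrable_ae_dominated (m : probability T R) (f g : T -> R) :
  measurable_fun setT f -> m.-integrable setT (EFin \o g) ->
  {ae m, forall x, `|f x| <= g x} -> m.-integrable setT (EFin \o f).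
Proof.
move=> mf ig fg; apply/integrableP; split; first exact/measurable_EFinP.
have mg : measurable_fun setT (EFin \o g) := measurable_int _ ig.
move/integrableP : ig => [_]; apply: le_lt_trans.
apply: ae_ge0_le_integral => //.
- by apply: measurableT_comp => //; exact/measurable_EFinP.
- exact: measurableT_comp.
case: fg => N [mN N0 subN]; exists N; split => //.
apply: subset_trans subN; apply: subsetC => x /= fgx _.
by rewrite lee_fin (le_trans fgx)// ler_norm.
Qed.

End ae_integrable.

(** * Integrability of the differences of potentials *)

Section marginals.
Context {d1 d2 : measure_display} {T1 : measurableType d1} {T2 : measurableType d2} {R : realType}.
Variables (P : probability T1 R) (Q : probability T2 R) (p : probability (T1 * T2)%type R)
  (g : T1 * T2 -> R).
Hypotheses (g0 : forall z, 0 <= g z) (pg : has_density p (P \x Q)%E g).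

Let mg : measurable_fun setT (EFin \o g).
Proof. by apply/measurable_EFinP; exact: pg.1. Qed.

Let g0E z : (0 <= (EFin \o g) z)%E.
Proof. by rewrite lee_fin. Qed.

(** By Tonelli's theorem the partial integral of g is a density of the marginal,
   and so is the constant 1. *)
Lemma marginal_density_snd : (forall B, measurable B -> p (snd @^-1` B) = Q B) ->
  {ae Q, forall y, (\int[P]_x (g (x, y))%:E = 1)%E}.
Proof.
move=> marg; have [_ pE] := pg.
have mG := measurable_fun_fubini_tonelli_G (m1 := P) _ mg g0E.
have i1 : Q.-integrable setT (cst 1%E : T2 -> \bar R) := integrable_cst_prob Q 1.
suff H E : E `<=` setT -> measurable E ->
    (\int[Q]_(y in E) (cst 1%E y) = \int[Q]_(y in E) fubini_G P (EFin \o g) y)%E.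
  have := integral_ae_eq measurableT i1 mG H.
  by apply: filterS => y /(_ I) h; exact/esym/h.
move=> _ mE; have mE' : measurable ((@snd T1 T2) @^-1` E).
  by rewrite -[_ @^-1` _]setTI; exact: measurable_snd.
rewrite integral_cst//= mul1e.
transitivity (p (@snd T1 T2 @^-1` E)); first exact/esym/marg.
rewrite pE// [LHS]integral_mkcond [RHS]integral_mkcond.
rewrite fubini_tonelli2; last 2 first.
- apply/(measurable_restrictT _ mE'); apply: measurable_funTS; apply/measurable_EFinP; exact: pg.1.
- by move=> z; rewrite patchE; case: ifP => _ //; exact: g0E.
apply: eq_integral => y _; rewrite /fubini_G patchE.
case: ifPn => yE.
  by apply: eq_integral => x _; rewrite patchE mem_set//=; rewrite inE in yE.
rewrite integral0_eq// => x _; rewrite patchE memNset//=.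
by move=> /mem_set; rewrite (negbTE yE).
Qed.

Lemma marginal_density_fst : (forall A, measurable A -> p (fst @^-1` A) = P A) ->
  {ae P, forall x, (\int[Q]_y (g (x, y))%:E = 1)%E}.
Proof.
move=> marg; have [_ pE] := pg.
have mF := measurable_fun_fubini_tonelli_F (m2 := Q) _ mg g0E.
have i1 : P.-integrable setT (cst 1%E : T1 -> \bar R) := integrable_cst_prob P 1.
suff H E : E `<=` setT -> measurable E ->
    (\int[P]_(x in E) (cst 1%E x) = \int[P]_(x in E) fubini_F Q (EFin \o g) x)%E.
  have := integral_ae_eq measurableT i1 mF H.
  by apply: filterS => x /(_ I) h; exact/esym/h.
move=> _ mE; have mE' : measurable ((@fst T1 T2) @^-1` E).
  by rewrite -[_ @^-1` _]setTI; exact: measurable_fst.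
rewrite integral_cst//= mul1e.
transitivity (p (@fst T1 T2 @^-1` E)); first exact/esym/marg.
rewrite pE// [LHS]integral_mkcond [RHS]integral_mkcond.
rewrite fubini_tonelli1; last 2 first.
- apply/(measurable_restrictT _ mE'); apply: measurable_funTS; apply/measurable_EFinP; exact: pg.1.
- by move=> z; rewrite patchE; case: ifP => _ //; exact: g0E.
apply: eq_integral => x _; rewrite /fubini_F patchE.
case: ifPn => xE.
  by apply: eq_integral => y _; rewrite patchE mem_set//=; rewrite inE in xE.
rewrite integral0_eq// => y _; rewrite patchE memNset//=.
by move=> /mem_set; rewrite (negbTE xE).
Qed.

End marginals.

Section potentials_integrable.
Context {R : realType} {d : nat}.
Local Notation V := 'rV[R]_d.

Lemma enorm_triangle (u v : V) : enorm (u - v) <= enorm u + enorm v.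
Proof.
rewrite -ler_sqr ?nnegrE ?addr_ge0 ?enorm_ge0// sqrrD.
have -> : enorm (u - v) ^+ 2 = enorm u ^+ 2 - dot u v *+ 2 + enorm v ^+ 2.
  rewrite !sqr_enorm /dot -sumrMnl -sumrN -!big_split /=; apply: eq_bigr => i _.
  by rewrite !mxE; ring.
have := cauchy_schwarz u (- v); rewrite enormN.
have -> : dot u (- v) = - dot u v.
  by rewrite /dot -sumrN; apply: eq_bigr => i _; rewrite mxE mulrN.
by move=> h; rewrite lerD2r lerD2l -mulNrn lerMn2r.
Qed.

Lemma ae_exists {disp} {T : measurableType disp} (m : probability T R) (A : T -> Prop) :
  {ae m, forall x, A x} -> exists x, A x.
Proof.
move=> [N [mN N0 subN]]; apply: contrapT => nA.
have : m setT = 0%E.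
  apply/eqP; rewrite -measure_le0 -N0 le_measure ?inE// => x _.
  by apply: subN => Ax; apply: nA; exists x.
by rewrite probability_setT => /eqP; rewrite onee_eq0.
Qed.

Variables (c : V -> V -> R) (eps L : R) (m1 m2 : probability V R).
Hypotheses (eps0 : 0 < eps) (L0 : 0 <= L)
  (mc1 : forall x, measurable_fun setT (c x))
  (mc2 : forall y, measurable_fun setT (c^~ y))
  (cL : forall y y' x, `|c x y - c x y'| <= L * enorm (y - y'))
  (mexp : forall s : R, m2.-integrable setT (EFin \o (fun y => expR (s * enorm y)))).
Variables (phis psis : V -> R).
Hypotheses (mphis : measurable_fun setT phis) (mpsis : measurable_fun setT psis)
  (ns1 : {ae m2, forall y, (\int[m1]_x (gibbs c eps phis psis (x, y))%:E = 1)%E})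
  (ns2 : {ae m1, forall x, (\int[m2]_y (gibbs c eps phis psis (x, y))%:E = 1)%E}).

Lemma lipschitz_linear_growth (psi : V -> R) (y0 y : V) :
  `|psi y - psi y0| <= L * enorm (y - y0) ->
  `|psi y| <= (`|psi y0| + L * enorm y0) + L * enorm y.
Proof.
move=> h; have := ler_normD (psi y - psi y0) (psi y0); rewrite subrK.
have := ler_wpM2l L0 (enorm_triangle y y0); rewrite mulrDr; lra.
Qed.

(** The second potentials grow at most linearly, which is integrable, and the
   first ones differ by a bounded function since each is the opposite of the
   same section of the cost up to a bounded term. *)
Lemma potential_gaps_integrable (phi psi psi' : V -> R) :
  measurable_fun setT phi -> measurable_fun setT psi -> measurable_fun setT psi' ->
  (forall y y', `|psi y - psi y'| <= L * enorm (y - y')) ->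
  (forall y y', `|psi' y - psi' y'| <= L * enorm (y - y')) ->
  (forall x, (\int[m2]_y (gibbs c eps phi psi (x, y))%:E = 1)%E) ->
  m1.-integrable setT (EFin \o (fun x => (phi x - phis x) / eps)) /\
  m2.-integrable setT (EFin \o (fun y => (psi' y - psis y) / eps)).
Proof.
move=> mphi mpsi mpsi' psiL psi'L nphi.
have [y0 ny0] := ae_exists ns1.
pose B1 := `|psis y0| + L * enorm y0.
have gs : {ae m2, forall y, `|psis y| <= B1 + L * enorm y}.
  apply: filterS ns1 => y ny; apply: lipschitz_linear_growth.
  exact: (potential_lipschitz eps0 mc2 cL mphis ny ny0).
have g1 : {ae m2, forall y, `|psi y| <= (`|psi 0| + L * enorm (0 : V)) + L * enorm y}.
  by apply: aeW => y; exact: lipschitz_linear_growth.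
have [K1 HK1] := potential_bounded eps0 mc1 cL mexp mpsis gs.
have [K2 HK2] := potential_bounded eps0 mc1 cL mexp mpsi g1.
have ieps : 0 < eps^-1 by rewrite invr_gt0.
split.
  apply: (integrable_ae_dominated (g := fun=> (K1 + K2) / eps)).
  - by apply: measurable_funM => //; exact: measurable_funB.
  - exact: integrable_cst_prob.
  apply: filterS ns2 => x /HK1 h1; have h2 := HK2 _ _ (nphi x).
  rewrite normrM (gtr0_norm ieps) ler_pM2r//.
  have := ler_normB (phi x + c x 0) (phis x + c x 0).
  rewrite (_ : phi x + c x 0 - (phis x + c x 0) = phi x - phis x); last by ring.
  lra.
pose B2 := `|psi' 0| + L * enorm (0 : V).
apply: (integrable_ae_dominated
  (g := fun y => (B1 + B2) / eps + (2 * L / eps) * expR (1 * enorm y))).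
- by apply: measurable_funM => //; exact: measurable_funB.
- by apply: integrable_add; [exact: integrable_cst_prob|exact: integrable_scale].
apply: filterS gs => y h1; have h2 := lipschitz_linear_growth (psi'L y 0).
rewrite normrM (gtr0_norm ieps).
have -> : (B1 + B2) / eps + (2 * L / eps) * expR (1 * enorm y) =
  (B1 + B2 + 2 * (L * expR (1 * enorm y))) / eps by ring.
rewrite ler_pM2r//.
have := ler_wpM2l L0 (expR_ge1Dx (enorm y)).
rewrite mulrDr mulr1 mul1r => h3.
rewrite -/B2 in h2; apply: (le_trans (ler_normB _ _)); apply: (le_trans (lerD h2 h1)).
have E : B2 + L * enorm y + (B1 + L * enorm y) = B1 + B2 + 2 * (L * enorm y) by ring.
by rewrite E lerD2l ler_pM2l// (le_trans _ h3)// lerDr.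
Qed.

End potentials_integrable.

(** * Geometric decay of the entropy *)

Section rates.
Context {R : realType} {d : nat}.
Local Notation V := 'rV[R]_d.
Variables (pi : probability (V * V)%type R) (piN : nat -> probability (V * V)%type R).

(** The rate kappa can be 1, whereas exponential convergence asks for less: halve it. *)
Lemma rate_converges_exponentially (kappa : R) : 0 < kappa <= 1 ->
  (0 <= KL pi (piN 0%N))%E -> sinkhorn_rate pi piN kappa ->
  converges_exponentially pi piN.
Proof.
move=> /andP[k0 k1] H0 rate; exists (kappa / 2); split; first by apply/andP; split; lra.
move=> n n1; apply: (le_trans (rate n n1)).
apply: lee_wpmul2r => //; rewrite lee_fin.
by apply: lerXn2r; rewrite ?nnegrE; lra.
Qed.

(** If every step loses at least a fixed multiple of the new entropy, the entropies
   decay geometrically. *)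
Lemma geometric_rate (h : nat -> R) (a eps : R) : 0 < eps -> 0 <= a ->
  (forall n, 0 <= h n) ->
  (forall n, exists F : R, h n.+1 + F <= h n /\ h n.+1 <= a / eps * F) ->
  forall n, h n <= (1 - eps / (eps + a)) ^+ n * h 0%N.
Proof.
move=> eps0 a0 h0 step; have ea : 0 < eps + a by rewrite ltr_pwDl.
have E : 1 - eps / (eps + a) = a / (eps + a) by field; rewrite gt_eqF.
rewrite E; elim => [|n IH]; first by rewrite expr0 mul1r.
rewrite exprS -mulrA.
apply: (@le_trans _ _ (a / (eps + a) * h n)); last first.
  by rewrite ler_wpM2l// divr_ge0// ltW.
have [F [h1 h2]] := step n.
have h3 : eps * h n.+1 <= a * F.
  by move: h2; rewrite mulrAC ler_pdivlMr// mulrC.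
rewrite mulrAC ler_pdivlMr//.
have := ler_wpM2l a0 h1; rewrite mulrDr => h4.
by rewrite mulrDr ![h n.+1 * _]mulrC; apply: le_trans h4; rewrite addrC lerD2l.
Qed.

End rates.

Section assembly.
Context {R : realType} {d : nat}.
Local Notation V := 'rV[R]_d.
Variables (rho nu : probability V R) (c : V -> V -> R) (eps : R) (phi0 : V -> R).
Hypotheses (eps0 : 0 < eps) (dc : twice_differentiable c)
  (adm : admissible_init rho nu c eps phi0).
Local Notation phi := (sinkhorn_phi rho nu c eps phi0).
Local Notation psi := (sinkhorn_psi rho nu c eps phi0).

Lemma measurable_sinkhorn_psi n : measurable_fun setT (psi n).
Proof.
apply: differentiable_measurable_rV => y.
exact: (differentiable_psi_step y (adm.2 n).1).
Qed.

Lemma differentiable_sinkhorn_phi n x : differentiable (phi n.+1) x.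
Proof. exact: (differentiable_phi_step x (adm.2 n).2). Qed.

Lemma measurable_sinkhorn_phi n : measurable_fun setT (phi n).
Proof.
case: n => [|n]; first exact: adm.1.
by apply: differentiable_measurable_rV => x; exact: differentiable_sinkhorn_phi.
Qed.

Lemma sinkhorn_psi_normalized n y :
  (\int[rho]_x (gibbs c eps (phi n) (psi n) (x, y))%:E = 1)%E.
Proof. exact: (psi_step_normalized eps0 y (adm.2 n).1). Qed.

Lemma integrable_gibbs_section n y :
  rho.-integrable setT (EFin \o (fun x => gibbs c eps (phi n) (psi n) (x, y))).
Proof.
apply/integrableP; split.
  apply/measurable_EFinP.
  have := measurableT_comp (measurable_gibbs eps (measurable_cost dc)
    (measurable_sinkhorn_phi n) (measurable_sinkhorn_psi n)) (pair2_measurable y).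
  exact.
under eq_integral do rewrite /= ger0_norm ?expR_ge0//.
by rewrite sinkhorn_psi_normalized ltry.
Qed.

Lemma sinkhorn_phi_normalized n x :
  (\int[nu]_y (gibbs c eps (phi n.+1) (psi n) (x, y))%:E = 1)%E.
Proof. exact: (phi_step_normalized eps0 x (adm.2 n).2). Qed.

Variables (Y : set V) (ell Lam Vb tau : R) (phis psis : V -> R)
  (pi : probability (V * V)%type R) (piN : nat -> probability (V * V)%type R).
Hypotheses
  (hess2P : forall x y, psd_le ell%:M (hess2 c x y) /\ psd_le (hess2 c x y) Lam%:M)
  (oY : open Y) (nuY : nu Y = 1%E) (tau0 : 0 < tau) (ti : TI Y nu tau)
  (cpi : coupling rho nu pi)
  (mphis : measurable_fun setT phis) (mpsis : measurable_fun setT psis)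
  (piG : has_density pi (rho \x nu)%E (gibbs c eps phis psis))
  (plans : sinkhorn_plans rho nu c eps phi0 piN).

Lemma KL_plans_ge0 n : (0 <= KL pi (piN n))%E.
Proof.
have mc := measurable_cost dc.
have mphi := measurable_sinkhorn_phi n; have mpsi := measurable_sinkhorn_psi n.
apply: (KL_density_ge0 _ (gibbs_density_ratio mc mphis mpsis mphi mpsi piG (plans n))).
apply: measurable_funD; apply: measurable_funM => //.
  by apply: measurable_funB; exact: measurableT_comp.
by apply: measurable_funB; exact: measurableT_comp.
Qed.

Hypotheses (gap : forall n,
    rho.-integrable setT (EFin \o (fun x => (phi n.+1 x - phis x) / eps)) /\
    nu.-integrable setT (EFin \o (fun y => (psi n.+1 y - psis y) / eps)))
  (Lam0 : 0 <= Lam - ell + Vb / eps)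
  (variance_le : forall n y v,
    rho.-integrable setT (EFin \o (fun x =>
      'D_v (c x) y * gibbs c eps (phi n.+1) (psi n.+1) (x, y))) ->
    rho.-integrable setT (EFin \o (fun x =>
      'D_v (c x) y ^+ 2 * gibbs c eps (phi n.+1) (psi n.+1) (x, y))) ->
    \int[rho]_x ('D_v (c x) y ^+ 2 * gibbs c eps (phi n.+1) (psi n.+1) (x, y)) -
    (\int[rho]_x ('D_v (c x) y * gibbs c eps (phi n.+1) (psi n.+1) (x, y))) ^+ 2
      <= Vb * enorm v ^+ 2).

(** The contraction holds from the first plan on, where the entropies are finite;
   the entropy of the zeroth plan, possibly infinite, is not smaller. *)
Lemma sinkhorn_rate_of_gaps :
  sinkhorn_rate pi piN (eps / (eps + tau * (Lam - ell + Vb / eps))).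
Proof.
set a := tau * _; have a0 : 0 <= a by rewrite mulr_ge0// ltW.
have mc := measurable_cost dc.
pose h n := fine (KL pi (piN n.+1)).
have hE n : KL pi (piN n.+1) = (h n)%:E.
  rewrite /h (KL_next mc (measurable_sinkhorn_phi _) (measurable_sinkhorn_psi _) mphis mpsis
    cpi piG (plans n.+1) (gap n).1 (gap n).2).
  by [].
have h0 n : 0 <= h n by rewrite -lee_fin -hE; exact: KL_plans_ge0.
have gapB (p q s : R) : (p - s) / eps - (q - s) / eps = (p - q) / eps by ring.
have step n : exists F : R, h n.+1 + F <= h n /\ h n.+1 <= a / eps * F.
  have fint : rho.-integrable setT
      (EFin \o (fun x => (phi n.+1 x - phi n.+2 x) / eps)).
    have := integrable_sub (gap n).1 (gap n.+1).1.
    by apply: eq_integrable => // x _; rewrite /= gapB.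
  have [F [h1 h2]] := step_contraction eps0 mc
    (measurable_sinkhorn_phi n.+1) (measurable_sinkhorn_psi n.+1)
    (measurable_sinkhorn_phi n.+2) (measurable_sinkhorn_psi n.+2) mphis mpsis
    (sinkhorn_psi_normalized n.+1) (sinkhorn_phi_normalized n.+1)
    (sinkhorn_psi_normalized n.+2) cpi piG (plans n.+1) (plans n.+2)
    (gap n.+1).1 (gap n.+1).2 oY nuY tau0 ti Lam0
    (psi_step_linear_integrable eps0 dc (adm.2 n.+2).1)
    (psi_step_linear_mean0 eps0 dc (adm.2 n.+2).1)
    (fun x y z => psi_step_semiconcave eps0 dc hess2P (adm.2 n.+2).1
       (@variance_le n.+1) x y z) fint.
  by exists F; move: h1 h2; rewrite !hE -EFinD !lee_fin.
have rate := geometric_rate eps0 a0 h0 step.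
move=> n _; rewrite hE.
apply: (@le_trans _ _ (((1 - eps / (eps + a)) ^+ n)%:E * KL pi (piN 1%N))%E).
  by rewrite hE -EFinM lee_fin.
apply: lee_wpmul2l.
  rewrite lee_fin exprn_ge0// subr_ge0 ler_pdivrMr ?mul1r ?lerDl//.
  by rewrite ltr_pwDl.
exact: (KL_nonincreasing mc
    (measurable_sinkhorn_phi 0) (measurable_sinkhorn_psi 0)
    (measurable_sinkhorn_phi 1) (measurable_sinkhorn_psi 1) mphis mpsis
    (sinkhorn_psi_normalized 0) (sinkhorn_phi_normalized 0)
    (sinkhorn_psi_normalized 1) cpi piG (plans 0) (plans 1) (gap 0).1 (gap 0).2).
Qed.

End assembly.

(** * The two cases of the theorem *)

Section cases.
Context {R : realType} {d : nat}.
Local Notation V := 'rV[R]_d.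
Variables (X Y : set V) (rho nu : probability V R) (c : V -> V -> R)
  (eps ell Lam tau : R) (phi0 phis psis : V -> R)
  (pi : probability (V * V)%type R) (piN : nat -> probability (V * V)%type R).
Hypotheses (d0 : (0 < d)%N) (eps0 : 0 < eps) (dc : twice_differentiable c)
  (adm : admissible_init rho nu c eps phi0)
  (hess2P : forall x y, psd_le ell%:M (hess2 c x y) /\ psd_le (hess2 c x y) Lam%:M)
  (oY : open Y) (nuY : nu Y = 1%E) (tau0 : 0 < tau) (ti : TI Y nu tau)
  (cpi : coupling rho nu pi)
  (mphis : measurable_fun setT phis) (mpsis : measurable_fun setT psis)
  (piG : has_density pi (rho \x nu)%E (gibbs c eps phis psis))
  (plans : sinkhorn_plans rho nu c eps phi0 piN).
Local Notation phi := (sinkhorn_phi rho nu c eps phi0).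
Local Notation psi := (sinkhorn_psi rho nu c eps phi0).

Let mc1 x : measurable_fun setT (c x).
Proof. by apply: differentiable_measurable_rV => y; exact: differentiable_snd. Qed.

Let mc2 y : measurable_fun setT (c^~ y).
Proof. by apply: differentiable_measurable_rV => x; exact: differentiable_fst. Qed.

Let mphi n : measurable_fun setT (phi n).
Proof. exact: (measurable_sinkhorn_phi adm n). Qed.

Let mpsi n : measurable_fun setT (psi n).
Proof. exact: (measurable_sinkhorn_psi adm n). Qed.

Let ell_le_Lam : ell <= Lam.
Proof. exact: (psd_le_scalar d0 (hess2P 0 0).1 (hess2P 0 0).2). Qed.

Let star_snd : {ae nu, forall y, (\int[rho]_x (gibbs c eps phis psis (x, y))%:E = 1)%E}.
Proof.
apply: (marginal_density_snd (fun z => expR_ge0 _) piG) => B mB.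
exact: (coupling_snd cpi mB).
Qed.

Let star_fst : {ae rho, forall x, (\int[nu]_y (gibbs c eps phis psis (x, y))%:E = 1)%E}.
Proof.
apply: (marginal_density_fst (fun z => expR_ge0 _) piG) => A mA.
exact: (coupling_fst cpi mA).
Qed.

Lemma rate_in_unit_interval (a : R) : 0 <= a -> 0 < eps / (eps + a) <= 1.
Proof.
move=> a0; have ea : 0 < eps + a by rewrite ltr_pwDl.
by rewrite divr_gt0//= ler_pdivrMr// mul1r lerDl.
Qed.

Let converges (Vb : R) : 0 <= Lam - ell + Vb / eps ->
  sinkhorn_rate pi piN (eps / (eps + tau * (Lam - ell + Vb / eps))) ->
  converges_exponentially pi piN.
Proof.
move=> Lb; apply: rate_converges_exponentially.
  by apply: rate_in_unit_interval; rewrite mulr_ge0// ltW.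
exact: (KL_plans_ge0 dc adm mphis mpsis piG plans).
Qed.

(** The second potentials are Lipschitz, and TI gives nu exponential moments. *)
Lemma sinkhorn_lipschitz_snd (L : R) :
  (forall y y' x, `|c x y - c x y'| <= L * enorm (y - y')) ->
  converges_exponentially pi piN /\
  sinkhorn_rate pi piN (eps / (eps + tau * (Lam - ell + L ^+ 2 / eps))).
Proof.
move=> cL; have L0 : 0 <= L by apply: (lipschitz_const_ge0 d0) => x x'; exact: (cL x x' 0).
have Lb : 0 <= Lam - ell + L ^+ 2 / eps.
  by rewrite addr_ge0 ?subr_ge0// divr_ge0 ?sqr_ge0// ltW.
have psiL n y y' : `|psi n y - psi n y'| <= L * enorm (y - y').
  exact: (potential_lipschitz eps0 mc2 cL (mphi n) (sinkhorn_psi_normalized eps0 adm n y)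
    (sinkhorn_psi_normalized eps0 adm n y')).
have gap n := potential_gaps_integrable eps0 L0 mc1 mc2 cL (ti_exp_moment oY nuY tau0 ti)
  mphis mpsis star_snd star_fst (mphi n.+1) (mpsi n) (mpsi n.+1) (psiL n) (psiL n.+1)
  (sinkhorn_phi_normalized eps0 adm n).
have rate : sinkhorn_rate pi piN (eps / (eps + tau * (Lam - ell + L ^+ 2 / eps))).
  apply: (sinkhorn_rate_of_gaps eps0 dc adm hess2P oY nuY tau0 ti cpi mphis mpsis piG plans gap Lb).
  move=> n y v i1 i2.
  apply: (conditional_variance_lipschitz dc (sinkhorn_psi_normalized eps0 adm n.+1) cL _ i2).
  exact: (integrable_gibbs_section eps0 dc adm n.+1 y).
by split=> //; exact: converges Lb rate.
Qed.

Lemma gibbs_swap (f g : V -> R) x y :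
  gibbs (fun y x => c x y) eps g f (y, x) = gibbs c eps f g (x, y).
Proof. by rewrite /gibbs /= addrAC. Qed.

(** The roles of the two variables are exchanged: the first potentials are now the
   Lipschitz ones, and rho has the exponential moments. *)
Lemma sinkhorn_lipschitz_fst (L C : R) :
  open X -> rho X = 1%E -> LSI X rho C ->
  (forall x x' y, `|c x y - c x' y| <= L * enorm (x - x')) ->
  (forall x y, opnorm2 (hess12 c x y) <= Lam) ->
  converges_exponentially pi piN /\
  sinkhorn_rate pi piN (eps / (eps + tau * (Lam - ell +
    2 * C * Lam ^+ 2 * (1 + 4 * C * L ^+ 2 / eps ^+ 2) / eps))).
Proof.
move=> oX rhoX lsi cL opL.
have L0 : 0 <= L by apply: (lipschitz_const_ge0 (f := c^~ 0) d0) => x x'; exact: (cL x x' 0).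
have C0 := lsi_constant_ge0 oX rhoX lsi d0.
have Lam0 : 0 <= Lam := opnorm2_bound_ge0 d0 (opL 0 0).
set Vb := 2 * C * Lam ^+ 2 * _.
have Vb0 : 0 <= Vb.
  have CL : 0 <= 4 * C * L ^+ 2 / eps ^+ 2.
    by apply: divr_ge0; last exact: sqr_ge0; apply: mulr_ge0; [exact: mulr_ge0|exact: sqr_ge0].
  apply: mulr_ge0; last exact: addr_ge0.
  by apply: mulr_ge0; [exact: mulr_ge0|exact: sqr_ge0].
have Lb : 0 <= Lam - ell + Vb / eps.
  by apply: addr_ge0; [rewrite subr_ge0|apply: divr_ge0 => //; exact: ltW].
pose c' (y x : V) := c x y.
have cL' (x x' y : V) : `|c' y x - c' y x'| <= L * enorm (x - x') := cL x x' y.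
have nphi n x : (\int[nu]_y (gibbs c' eps (psi n) (phi n.+1) (y, x))%:E = 1)%E.
  by under eq_integral do rewrite gibbs_swap; exact: (sinkhorn_phi_normalized eps0 adm n).
have npsi n y : (\int[rho]_x (gibbs c' eps (psi n) (phi n) (y, x))%:E = 1)%E.
  by under eq_integral do rewrite gibbs_swap; exact: (sinkhorn_psi_normalized eps0 adm n).
have phiL n x x' : `|phi n.+1 x - phi n.+1 x'| <= L * enorm (x - x').
  exact: (potential_lipschitz eps0 mc1 cL' (mpsi n) (nphi n x) (nphi n x')).
have star1 : {ae rho, forall x, (\int[nu]_y (gibbs c' eps psis phis (y, x))%:E = 1)%E}.
  by apply: filterS star_fst => x; under eq_integral do rewrite -gibbs_swap.
have star2 : {ae nu, forall y, (\int[rho]_x (gibbs c' eps psis phis (y, x))%:E = 1)%E}.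
  by apply: filterS star_snd => y; under eq_integral do rewrite -gibbs_swap.
have gap n := potential_gaps_integrable eps0 L0 mc2 mc1 cL'
  (fun s => lsi_exp_moment oX rhoX lsi s C0) mpsis mphis star1 star2
  (mpsi n.+1) (mphi n.+1) (mphi n.+1) (phiL n) (phiL n) (npsi n.+1).
have rate : sinkhorn_rate pi piN (eps / (eps + tau * (Lam - ell + Vb / eps))).
  apply: (sinkhorn_rate_of_gaps eps0 dc adm hess2P oY nuY tau0 ti cpi mphis mpsis piG plans
    (fun n => conj (gap n).2 (gap n).1) Lb).
  move=> n y v i1 i2.
  exact: (conditional_variance_lsi eps0 dc (sinkhorn_psi_normalized eps0 adm n.+1) oX rhoX
    lsi C0 L0 Lam0 cL (phiL n) (differentiable_sinkhorn_phi adm n) opL i1 i2).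
by split=> //; exact: converges Lb rate.
Qed.

End cases.

Section dimension_zero.
Context {R : realType} {d : nat}.
Local Notation V := 'rV[R]_d.

(** The log-density ratio is constant, hence 0 because total masses agree. *)
Lemma KL_singleton {disp} {T : measurableType disp} (p q : probability T R) (w : T -> R) (z0 : T) :
  (forall z, z = z0) -> measurable_fun setT w -> has_density p q (expR \o w) ->
  KL p q = 0%E.
Proof.
move=> all1 mw pq; have [_] := expectation_exp_opp mw pq.
have -> : (fun x => expR (- w x)) = cst (expR (- w z0)).
  by apply/funext => x; rewrite (all1 x).
rewrite expectation_cst -[RHS]expR0 => /expR_inj/eqP; rewrite oppr_eq0 => /eqP w0.
by rewrite (KL_density mw pq); apply: integral0_eq => x _; rewrite (all1 x) w0.
Qed.

(** In dimension 0 the Hessian bounds are void, so that Lam - ell may be negative,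
   but all plans coincide. *)
Lemma rate_dim0 (rho nu : probability V R) (c : V -> V -> R) (eps : R) (phi0 phis psis : V -> R)
  (pi : probability (V * V)%type R) (piN : nat -> probability (V * V)%type R) (kappa : R) :
  d = 0%N -> twice_differentiable c -> admissible_init rho nu c eps phi0 ->
  measurable_fun setT phis -> measurable_fun setT psis ->
  has_density pi (rho \x nu)%E (gibbs c eps phis psis) ->
  sinkhorn_plans rho nu c eps phi0 piN -> sinkhorn_rate pi piN kappa.
Proof.
move=> d0 dc adm mphis mpsis piG plans.
have all0 (z : V * V) : z = 0.
  by case: z => x y; subst d; rewrite (thinmx0 x) (thinmx0 y).
suff KL0 n : KL pi (piN n) = 0%E by move=> n _; rewrite !KL0 mule0.
have mc := measurable_cost dc.
have mphi := measurable_sinkhorn_phi adm n; have mpsi := measurable_sinkhorn_psi adm n.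
apply: (KL_singleton all0 _ (gibbs_density_ratio mc mphis mpsis mphi mpsi piG (plans n))).
apply: measurable_funD; apply: measurable_funM => //.
  by apply: measurable_funB; exact: measurableT_comp.
by apply: measurable_funB; exact: measurableT_comp.
Qed.

End dimension_zero.

Theorem mainTheorem7 (R : realType) (d : nat) (X Y : set 'rV[R]_d)
  (rho nu : probability 'rV[R]_d R) (c : 'rV[R]_d -> 'rV[R]_d -> R)
  (ell Lam tau : R) :
  open X -> connected X -> open Y -> connected Y ->
  rho X = 1%E -> nu Y = 1%E ->
  twice_differentiable c ->
  (forall x y, psd_le ell%:M (hess2 c x y) /\ psd_le (hess2 c x y) Lam%:M) ->
  (forall x y, psd_le (hess1 c x y) Lam%:M) ->
  0 < tau -> TI Y nu tau ->
  (forall L : R,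
     (forall y y' x, `|c x y - c x y'| <= L * enorm (y - y')) ->
     forall (eps : R) (phi0 : 'rV[R]_d -> R)
            (pi : probability ('rV[R]_d * 'rV[R]_d)%type R)
            (piN : nat -> probability ('rV[R]_d * 'rV[R]_d)%type R),
     0 < eps ->
     admissible_init rho nu c eps phi0 ->
     eot_plan rho nu c eps pi ->
     sinkhorn_plans rho nu c eps phi0 piN ->
     converges_exponentially pi piN /\
     (eps <= (tau * (Lam - ell) +
              Num.sqrt (tau ^+ 2 * (Lam - ell) ^+ 2 + 4 * tau * L ^+ 2)) / 2 ->
      sinkhorn_rate pi piN
        (eps ^+ 2 / (eps ^+ 2 + tau * eps * (Lam - ell) + tau * L ^+ 2)))) /\
  (forall L C : R,
     (forall x x' y, `|c x y - c x' y| <= L * enorm (x - x')) ->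
     (forall x y, opnorm2 (hess12 c x y) <= Lam) ->
     LSI X rho C ->
     forall (eps : R) (phi0 : 'rV[R]_d -> R)
            (pi : probability ('rV[R]_d * 'rV[R]_d)%type R)
            (piN : nat -> probability ('rV[R]_d * 'rV[R]_d)%type R),
     0 < eps ->
     admissible_init rho nu c eps phi0 ->
     eot_plan rho nu c eps pi ->
     sinkhorn_plans rho nu c eps phi0 piN ->
     converges_exponentially pi piN /\
     (eps <= Num.min 1
        ((tau * (Lam - ell) +
          2 * tau * Lam ^+ 2 * C * (1 + 4 * C * L ^+ 2)) `^ (4^-1)) ->
      sinkhorn_rate pi piN
        (eps ^+ 4 / (eps ^+ 4 + tau * eps ^+ 3 * (Lam - ell) +
           2 * tau * Lam ^+ 2 * C * (eps ^+ 2 + 4 * C * L ^+ 2))))).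

Proof.
move=> oX _ oY _ rhoX nuY dc hess2P _ tau0 ti.
have converges0 (pi : probability ('rV[R]_d * 'rV[R]_d)%type R) piN :
    (forall kappa : R, sinkhorn_rate pi piN kappa) -> converges_exponentially pi piN.
  by move=> rate; exists 2^-1; split; [apply/andP; split; lra|exact: rate].
split.
  move=> L cL eps phi0 pi piN eps0 adm [[cpi _] _ [phis [psis [mphis mpsis piG]]]] plans.
  case: (posnP d) => [d0|d0].
    have rate := rate_dim0 _ d0 dc adm mphis mpsis piG plans.
    by split=> //; exact: converges0.
  have [conv rate] := sinkhorn_lipschitz_snd d0 eps0 dc adm hess2P oY nuY tau0 ti cpi
    mphis mpsis piG plans cL.
  split=> // _; have eps_neq0 : eps != 0 by rewrite gt_eqF.
  suff -> : eps ^+ 2 + tau * eps * (Lam - ell) + tau * L ^+ 2 =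
      eps * (eps + tau * (Lam - ell + L ^+ 2 / eps)).
    by rewrite expr2 invfM mulrACA mulfV// mul1r.
  by field.
move=> L C cL opL lsi eps phi0 pi piN eps0 adm [[cpi _] _ [phis [psis [mphis mpsis piG]]]] plans.
case: (posnP d) => [d0|d0].
  have rate := rate_dim0 _ d0 dc adm mphis mpsis piG plans.
  by split=> //; exact: converges0.
have [conv rate] := sinkhorn_lipschitz_fst d0 eps0 dc adm hess2P oY nuY tau0 ti cpi
  mphis mpsis piG plans oX rhoX lsi cL opL.
split=> // _; have eps_neq0 : eps != 0 by rewrite gt_eqF.
have eps3_neq0 : eps ^+ 3 != 0 by rewrite expf_neq0.
suff -> : eps ^+ 4 + tau * eps ^+ 3 * (Lam - ell) +
      2 * tau * Lam ^+ 2 * C * (eps ^+ 2 + 4 * C * L ^+ 2) =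
    eps ^+ 3 * (eps + tau * (Lam - ell +
      2 * C * Lam ^+ 2 * (1 + 4 * C * L ^+ 2 / eps ^+ 2) / eps)).
  by rewrite [eps ^+ 4]exprSr invfM mulrACA mulfV// mul1r.
by field.
Qed.
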